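(* Let $\mathbb{k}$ be a field and let $\mathcal A=\{\ell_1,\dots,\ell_n\}\subset R=\mathbb{k}[x_1,\dots,x_k]$ be a central arrangement of size $n$ and rank $k$. Let $I=I_{n-1}(\mathcal A)=\langle f_1,\dots,f_n\rangle$ with $f_i=\prod_{j\ne i}\ell_j$. Then the Rees algebra $R[It]=\bigoplus_{s\ge0}I^st^s$ is Cohen-Macaulay.
   Context: A central arrangement of size $n$ and rank $k$ is given by $n$ pairwise non-proportional nonzero linear forms $\ell_1,\dots,\ell_n\in R=\mathbb{k}[x_1,\dots,x_k]$ with $\langle \ell_1,\dots,\ell_n\rangle=\langle x_1,\dots,x_k\rangle$ (so $n\ge k$). *)

(* Defs.v *)
From HB Require Import structures.
From mathcomp Require Import all_boot all_order all_algebra.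
From mathcomp Require Import boolp.
From mathcomp Require Export mpoly.

Set Implicit Arguments.
Unset Strict Implicit.
Unset Printing Implicit Defensive.

Import GRing.Theory.
Local Open Scope ring_scope.

(* Ideals are boolean predicates {pred A}; by the classical axioms of boolp
   every Prop-valued predicate is of this form.  In ring_quotient,
   idealr_closed J means "J is a PROPER ideal". *)

Section CommutativeAlgebra.
Variable A : comNzRingType.
Implicit Types (S J P M : {pred A}) (s : seq A) (d : nat).

Definition ideal_gen S : {pred A} :=
  [pred x | `[< exists m (c g : 'I_m -> A),
                  (forall i, g i \in S) /\ x = \sum_i c i * g i >]].

Definition ideal_pow J d : {pred A} :=
  ideal_gen [pred x | `[< exists g : 'I_d -> A,
                            (forall i, g i \in J) /\ x = \prod_i g i >]].

Definition prime_ideal P := idealr_closed P /\ prime_idealr_closed P.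

Definition maximal_ideal M :=
  idealr_closed M /\
  forall J, idealr_closed J -> {subset M <= J} -> {subset J <= M}.

(* The unit ideal, not covered by idealr_closed, is generated by 1. *)
Definition noetherian :=
  forall J, idealr_closed J -> exists s, J =i ideal_gen (mem s).

Definition regular_sequence s :=
  1 \notin ideal_gen (mem s) /\
  forall i, (i < size s)%N -> forall a,
    s`_i * a \in ideal_gen (mem (take i s)) -> a \in ideal_gen (mem (take i s)).

Definition is_depth J d :=
  (exists s, [/\ regular_sequence s, {subset s <= J} & size s = d]) /\
  (forall s, regular_sequence s -> {subset s <= J} -> (size s <= d)%N).

(* Only C 0, ..., C d matter: C 0 < C 1 < ... < C d = M, of length d. *)
Definition prime_chain M d (C : nat -> {pred A}) :=
  [/\ forall i, (i <= d)%N -> prime_ideal (C i),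
      forall i, (i < d)%N ->
        {subset C i <= C i.+1} /\ ~ {subset C i.+1 <= C i}
    & C d =i M].

Definition is_height M d :=
  (exists C, prime_chain M d C) /\
  (forall e C, prime_chain M e C -> (e <= d)%N).

(* Eisenbud, Commutative Algebra, Section 18.2: a Noetherian ring is
   Cohen-Macaulay when depth M = codim M for every maximal ideal M.  Both
   numbers are finite in a Noetherian ring. *)
Definition cohen_macaulay :=
  noetherian /\
  forall M, maximal_ideal M -> exists d, is_depth M d /\ is_height M d.

End CommutativeAlgebra.

Arguments cohen_macaulay A : clear implicits.
Arguments noetherian A : clear implicits.

Section ReesAlgebra.
Variables (R : comNzRingType) (I : {pred R}).

(* The subring of R[t] of the polynomials whose coefficient of t^s lies in
   I^s for all s; here t is the variable 'X of {poly R}. *)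
Definition rees_pred : {pred {poly R}} :=
  [pred p : {poly R} | `[< forall s, p`_s \in ideal_pow I s >]].

Lemma ideal_gen0 (S : {pred R}) : 0 \in ideal_gen S.
Proof.
apply/asboolP; exists 0%N, (fun=> 0), (fun=> 0); split; first by case.
by rewrite big_ord0.
Qed.

Lemma ideal_genD (S : {pred R}) x y :
  x \in ideal_gen S -> y \in ideal_gen S -> x + y \in ideal_gen S.
Proof.
move=> /asboolP[m [c [g [gS ->]]]] /asboolP[m' [c' [g' [gS' ->]]]].
apply/asboolP; exists (m + m')%N.
exists (fun i => match split i with inl j => c j | inr j => c' j end).
exists (fun i => match split i with inl j => g j | inr j => g' j end).
split=> [i|]; first by case: (split i).
rewrite big_split_ord /=; congr (_ + _); apply: eq_bigr => i _.
  by rewrite (unsplitK (inl i)).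
by rewrite (unsplitK (inr i)).
Qed.

Lemma ideal_genM (S : {pred R}) a x :
  x \in ideal_gen S -> a * x \in ideal_gen S.
Proof.
move=> /asboolP[m [c [g [gS ->]]]]; apply/asboolP.
exists m, (fun i => a * c i), g; split=> //.
by rewrite mulr_sumr; apply: eq_bigr => i _; rewrite mulrA.
Qed.

Lemma ideal_gen_sum (S : {pred R}) m (F : 'I_m -> R) :
  (forall i, F i \in ideal_gen S) -> \sum_i F i \in ideal_gen S.
Proof.
move=> FS; apply: (big_ind (fun x => x \in ideal_gen S)) => //.
  exact: ideal_gen0.
exact: ideal_genD.
Qed.

Lemma mem_ideal_gen (S : {pred R}) x : x \in S -> x \in ideal_gen S.
Proof.
move=> xS; apply/asboolP; exists 1%N, (fun=> 1), (fun=> x); split=> //.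
by rewrite big_ord1 mul1r.
Qed.

Lemma ideal_powM s t x y : x \in ideal_pow I s -> y \in ideal_pow I t ->
  x * y \in ideal_pow I (s + t).
Proof.
move=> /asboolP[m [c [g [gS ->]]]] /asboolP[m' [c' [g' [gS' ->]]]].
rewrite mulr_suml; apply: ideal_gen_sum => i.
rewrite mulr_sumr; apply: ideal_gen_sum => j.
rewrite mulrACA; apply: ideal_genM; apply: mem_ideal_gen.
have /asboolP[u [uI ->]] := gS i; have /asboolP[v [vI ->]] := gS' j.
apply/asboolP.
exists (fun i => match split i with inl j => u j | inr j => v j end).
split=> [h|]; first by case: (split h).
rewrite big_split_ord /=; congr (_ * _); apply: eq_bigr => h _.
  by rewrite (unsplitK (inl h)).
by rewrite (unsplitK (inr h)).
Qed.

Lemma ideal_pow0 x : x \in ideal_pow I 0.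
Proof.
rewrite -[x]mulr1; apply: ideal_genM; apply: mem_ideal_gen; apply/asboolP.
by exists (fun=> 0); split; [case | rewrite big_ord0].
Qed.

Lemma rees_subring : subring_closed rees_pred.
Proof.
split=> [|p q /asboolP pI /asboolP qI|p q /asboolP pI /asboolP qI].
- apply/asboolP => s; rewrite coef1; case: s => [|s] /=.
    exact: ideal_pow0.
  exact: ideal_gen0.
- apply/asboolP => s; rewrite coefB -mulN1r; apply: ideal_genD => //.
  exact: ideal_genM.
- apply/asboolP => s; rewrite coefM; apply: ideal_gen_sum => i.
  by have := ideal_powM (pI i) (qI (s - i)%N); rewrite subnKC // -ltnS.
Qed.

HB.instance Definition _ :=
  GRing.isSubringClosed.Build {poly R} rees_pred rees_subring.

Record rees_algebra :=
  ReesAlgebra { rees_val :> {poly R}; _ : rees_val \in rees_pred }.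

HB.instance Definition _ := [isSub for rees_val].
HB.instance Definition _ := [Choice of rees_algebra by <:].
HB.instance Definition _ :=
  [SubChoice_isSubComNzRing of rees_algebra by <:].

End ReesAlgebra.

Section Arrangement.
Variables (K : fieldType) (k n : nat) (l : 'I_n -> {mpoly K[k]}).

Definition central_arrangement :=
  [/\ forall i, l i \is 1.-homog /\ l i != 0,
      forall i j, i != j -> forall c : K, l i != c *: l j
    & ideal_gen (mem (codom l)) =i
      ideal_gen (mem (codom (fun i : 'I_k => 'X_i : {mpoly K[k]})))].

Definition deleted_product (i : 'I_n) : {mpoly K[k]} := \prod_(j | j != i) l j.

Definition arrangement_ideal : {pred {mpoly K[k]}} :=
  ideal_gen (mem (codom deleted_product)).

End Arrangement.

(* Main.v *)
(* Put f = l_1 ... l_n and T = f t; as f_i t = T / l_i, the Rees algebra is the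
   algebra A generated by x_1, ..., x_k, T and the T / l_i.  For any forms l_i and
   any maximal ideal M of the polynomial ring presenting A, the Koszul cohomology
   of A on generators of M vanishes in degrees at most k, by induction on the
   number of forms.

   If some T / l_r lies in M, let A' be the algebra with l_r deleted, A'' the one
   restricted to l_r = 0, and Q the kernel of A' -> A''.  Expanding in partial
   fractions shows that (T / l_r) Q is contained in A' and that
   A / (T / l_r) A = A' / (T / l_r) Q.  The bounds for A' in dimension k and A'' in
   dimension k - 1 thus give the bound for A / (T / l_r) A, hence the one for A,
   since T / l_r is regular on A and kills the cohomology.  If no T / l_i lies in
   M, A can be replaced by its localization at their product, which is a
   localization of a polynomial ring in k + 1 variables; one-variable polynomials,
   found in M by Zariski's lemma, then form a regular sequence.

   Since A is Noetherian, this vanishing yields a regular sequence of length k + 1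
   in every maximal ideal.  A regular sequence gives a chain of primes of the same
   length, and no chain is longer than k + 1, because any k + 2 elements of A are
   algebraically dependent over K. *)

Require Import Defs.
From HB Require Import structures.
From mathcomp Require Import all_boot all_order all_algebra.
From mathcomp Require Import ring_quotient boolp.
From mathcomp Require Import zify ring.

Set Implicit Arguments.
Unset Strict Implicit.
Unset Printing Implicit Defensive.

Import GRing.Theory.
Local Open Scope ring_scope.

(** * Koszul complexes *)

(** Restriction to [l_r = 0] may make distinct forms proportional, so the induction runs over
    arbitrary families of forms, and one step removes all multiples of [l_r] together. Every algebra
    that occurs is the quotient of one polynomial ring [S] by the kernel of an evaluation into one
    field: a deleted form becomes the zero vector, with [T / 0 = 0], and a restriction becomes a
    matrix acting on coefficient vectors. Thus [M] and its generators never change, and A, A', A''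
    and Q are compared as subquotients of [S]. Koszul cohomology suits this better than depth: it
    makes sense for Q, passes through long exact sequences, and vanishes in all degrees on an
    algebra whose support misses [M], so no case distinction is made on whether [M] survives a
    deletion or a restriction. The main obstacle is that [(T / l_r) Q] lies in A'. It is tested on
    generators of Q: the form [l_r], and one element for each linear relation expressing [l_r] by
    other forms. That these suffice is a second induction on the forms, which passes to codimension
    two. *)

Section Koszul.
Variable G : comNzRingType.
Implicit Types (N : G -> Prop) (m : seq G) (z w : seq bool -> G) (s : seq bool).

(** Modules are additive subgroups of one ambient ring, stable only under the elements at hand;
    ideals of a polynomial ring and subalgebras of a field are thus treated alike. *)
Definition subgroup N := N 0 /\ forall x y, N x -> N y -> N (x - y).
Definition stable a N := forall x, N x -> N (a * x).
Definition stables m N := forall a, a \in m -> stable a N.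

Lemma subgroupN N x : subgroup N -> N x -> N (- x).
Proof. by case=> N0 NB Nx; rewrite -sub0r; apply: NB. Qed.

Lemma subgroupD N x y : subgroup N -> N x -> N y -> N (x + y).
Proof.
by move=> NN Nx Ny; rewrite -[y]opprK; apply: NN.2 => //; apply: subgroupN.
Qed.

Lemma subgroup_sum N (I : Type) (r : seq I) (P : pred I) (E : I -> G) :
  subgroup N -> (forall i, N (E i)) -> N (\sum_(i <- r | P i) E i).
Proof.
move=> NN NE; apply: (big_ind N) => //; first exact: NN.1.
by move=> x y; apply: subgroupD.
Qed.

(* A cochain of the Koszul complex on the sequence m is given by its components
   z s, where the boolean mask s selects a subset of m.  The complex on a :: m
   is the mapping cone of the multiplication by a on the complex on m. *)
Fixpoint kd m z s : G :=
  match m, s with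
  | a :: m', false :: s' => kd m' (fun t => z (false :: t)) s'
  | a :: m', true :: s' => a * z (false :: s') - kd m' (fun t => z (true :: t)) s'
  | _, _ => 0
  end.

(** The degree of a component is the number of elements that its mask selects. Masks of the wrong
    length are unconstrained, and degrees are integers so that [i - 1] makes sense in degree 0. *)
Definition kdeg m (i : int) z :=
  forall s, size s = size m -> z s <> 0 -> (count id s : int) = i.

(** Contraction along the [j]-th basis vector, with the sign of the mapping cone. *)
Fixpoint kh (j : nat) z s : G :=
  match j, s with
  | 0%N, false :: s' => z (true :: s')
  | 0%N, true :: _ => 0
  | j'.+1, false :: s' => kh j' (fun t => z (false :: t)) s'
  | j'.+1, true :: s' => - kh j' (fun t => z (true :: t)) s'
  | _, [::] => 0
  end.

Lemma kd_ext m z z' s : (forall s, size s = size m -> z s = z' s) ->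
  size s = size m -> kd m z s = kd m z' s.
Proof.
elim: m z z' s => [|a m IH] z z' [|[] s] //= zz [szs].
  rewrite zz /= ?szs //; congr (_ - _); apply: IH => // t szt.
  by rewrite zz //= szt.
by apply: IH => // t szt; rewrite zz //= szt.
Qed.

Lemma kdB m z z' s : kd m (fun t => z t - z' t) s = kd m z s - kd m z' s.
Proof.
elim: m z z' s => [|a m IH] z z' [|[] s] //=; rewrite ?subr0 //.
by rewrite (IH (fun t => z (true :: t)) (fun t => z' (true :: t))); ring.
Qed.

Lemma kdZ m c z s : kd m (fun t => c * z t) s = c * kd m z s.
Proof.
elim: m z s => [|a m IH] z [|[] s] //=; rewrite ?mulr0 //.
by rewrite (IH (fun t => z (true :: t))); ring.
Qed.

Lemma kd0 m s : kd m (fun=> 0) s = 0.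
Proof.
by elim: m s => [|a m IH] [|[] s] //=; rewrite IH mulr0 subr0.
Qed.

Lemma kd_sum m n (c : 'I_n -> G) (z : 'I_n -> seq bool -> G) s :
  kd m (fun t => \sum_j c j * z j t) s = \sum_j c j * kd m (z j) s.
Proof.
elim: m z s => [|a m IH] z [|[] s] //=.
all: try by rewrite big1 // => j _; rewrite mulr0.
rewrite (IH (fun j t => z j (true :: t))) mulr_sumr -sumrB.
by apply: eq_bigr => j _; ring.
Qed.

Lemma kd_in m N z s : subgroup N -> stables m N -> size s = size m ->
  (forall s, size s = size m -> N (z s)) -> N (kd m z s).
Proof.
move=> NN; elim: m z s => [|a m IH] z [|b s] //= mN; first by move=> *; exact: NN.1.
move=> [szs] Nz.
have mN' : stables m N by move=> c cm; apply: mN; rewrite inE cm orbT.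
have Nz' c s' : size s' = size m -> N (z (c :: s')).
  by move=> szs'; apply: Nz; rewrite /= szs'.
case: b; last by apply: IH => // t; exact: Nz'.
apply: NN.2; first by apply: mN; [exact: mem_head|exact: Nz'].
by apply: IH => // t; exact: Nz'.
Qed.

Lemma kdeg_tail m a (b : bool) i z :
  kdeg (a :: m) i z -> kdeg m (i - b%:Z) (fun t => z (b :: t)).
Proof.
move=> dz s szs zs; have /= := dz (b :: s); rewrite szs => /(_ erefl zs) <-.
by case: b {zs} => /=; lia.
Qed.

Lemma kdegB m i z z' : kdeg m i z -> kdeg m i z' -> kdeg m i (fun s => z s - z' s).
Proof.
move=> dz dz' s szs zz; have [z0|/eqP/(dz s szs)//] := eqVneq (z s) 0.
have [z'0|/eqP/(dz' s szs)//] := eqVneq (z' s) 0.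
by case: zz; rewrite z0 z'0 subrr.
Qed.

Lemma kdegZ m i c z : kdeg m i z -> kdeg m i (fun s => c * z s).
Proof. by move=> dz s szs zz; apply: dz => // z0; apply: zz; rewrite z0 mulr0. Qed.

Lemma kdeg0 m i : kdeg m i (fun=> 0).
Proof. by move=> s _ /(_ erefl). Qed.

Lemma kdeg_kd m i z : kdeg m i z -> kdeg m (i + 1) (kd m z).
Proof.
elim: m i z => [|a m IH] i z dz [|[] s] //= [szs] nz; last first.
  by have := IH _ _ (kdeg_tail (b := false) dz) s szs nz; lia.
have [z0|/eqP z0] := eqVneq (z (false :: s)) 0.
  have nz' : kd m (fun t => z (true :: t)) s <> 0.
    by move=> k0; apply: nz; rewrite z0 k0 mulr0 subr0.
  by have := IH _ _ (kdeg_tail (b := true) dz) s szs nz'; lia.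
by have := dz (false :: s); rewrite /= szs => /(_ erefl z0); lia.
Qed.

Lemma kdd m z s : kd m (kd m z) s = 0.
Proof.
elim: m z s => [|a m IH] z [|[] s] //=.
by rewrite kdB kdZ IH subr0 subrr.
Qed.

Lemma kdeg_kh m i j z : (j < size m)%N -> kdeg m i z -> kdeg m (i - 1) (kh j z).
Proof.
elim: j m i z => [|j IH] [|a m] i z //= jm dz [|b s] //= [szs].
  case: b => // nz; have := dz (true :: s); rewrite /= szs.
  by move=> /(_ erefl nz); lia.
case: b => nz.
  have nz' : kh j (fun t => z (true :: t)) s <> 0.
    by move=> k0; apply: nz; rewrite k0 oppr0.
  by have := IH _ _ _ jm (kdeg_tail (b := true) dz) s szs nz'; lia.
by have := IH _ _ _ jm (kdeg_tail (b := false) dz) s szs nz; lia.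
Qed.

Lemma khB j z z' s : kh j (fun t => z t - z' t) s = kh j z s - kh j z' s.
Proof.
elim: j z z' s => [|j IH] z z' [|[] s] //=; rewrite ?subr0 //.
by rewrite (IH (fun t => z (true :: t)) (fun t => z' (true :: t))); ring.
Qed.

Lemma khZ j c z s : kh j (fun t => c * z t) s = c * kh j z s.
Proof.
elim: j z s => [|j IH] z [|[] s] //=; rewrite ?mulr0 //.
by rewrite (IH (fun t => z (true :: t))); ring.
Qed.

Lemma kh_in N n j z s : subgroup N -> (j < n)%N -> size s = n ->
  (forall s, size s = n -> N (z s)) -> N (kh j z s).
Proof.
move=> NN; elim: j n z s => [|j IH] [|n] z [|b s] //= jn [szs] Nz.
  by case: b; [exact: NN.1|apply: Nz; rewrite /= szs].
case: b; [apply: subgroupN => //|]; apply: (IH n) => // t szt;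
  by apply: Nz; rewrite /= szt.
Qed.

(** This is why every element of the sequence acts by zero on cohomology. The case [j = 0] is the
    contraction of a mapping cone; the minus signs in [kd] and [kh] let the induction pass. *)
Lemma kh_homotopy m j z s : (j < size m)%N -> size s = size m ->
  kd m (kh j z) s + kh j (kd m z) s = m`_j * z s.
Proof.
elim: j m z s => [|j IH] [|a m] z [|[] s] //= jm [szs].
- by rewrite kd0 subr0 addr0.
- by rewrite addrC subrK.
- rewrite khB khZ opprB -(IH m (fun t => z (true :: t)) s jm szs).
  have -> : kd m (fun t => - kh j (fun u => z (true :: u)) t) s =
            - kd m (kh j (fun u => z (true :: u))) s.
    rewrite -mulN1r -kdZ; apply: kd_ext => // t _; by rewrite mulN1r.
  ring.
- exact: IH.
Qed.

End Koszul.

(** * Vanishing of Koszul cohomology and long exact sequences *)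

Section KoszulVanishing.
Variables (G : comNzRingType) (m : seq G).
Implicit Types (N : G -> Prop) (z w : seq bool -> G) (s : seq bool) (d i : int).

Definition submod N := subgroup N /\ stables m N.

(* The Koszul cohomology of the subquotient N1 / N2 vanishes below degree d. *)
Definition kvan d N1 N2 := forall i z, i < d ->
  (forall s, size s = size m -> N1 (z s)) -> kdeg m i z ->
  (forall s, size s = size m -> N2 (kd m z s)) ->
  exists w, [/\ forall s, size s = size m -> N1 (w s), kdeg m (i - 1) w
    & forall s, size s = size m -> N2 (z s - kd m w s)].

(** The coefficients have to act on both groups, since these are not modules over all of [G]. *)
Definition in_koszul_ideal y N1 N2 := exists e : 'I_(size m) -> G,
  [/\ y = \sum_j e j * m`_j, forall j, stable (e j) N1
    & forall j, stable (e j) N2].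

(** The contractions, combined with the coefficients of [y], form a homotopy from multiplication by
    [y] to zero on [N1 / N2]. *)
Lemma koszul_homotopy y N1 N2 i z :
    subgroup N1 -> subgroup N2 -> in_koszul_ideal y N1 N2 ->
    (forall s, size s = size m -> N1 (z s)) -> kdeg m i z ->
    (forall s, size s = size m -> N2 (kd m z s)) ->
  exists w, [/\ forall s, size s = size m -> N1 (w s), kdeg m (i - 1) w
    & forall s, size s = size m -> N2 (y * z s - kd m w s)].
Proof.
move=> N1s N2s [e [-> eN1 eN2]] N1z dz N2dz.
exists (fun s => \sum_j e j * kh j z s); split.
- by move=> s szs; apply: subgroup_sum => // j; apply: eN1; apply: (kh_in N1s (ltn_ord j)).
- move=> s szs nz; have [j nzj] : exists j : 'I_(size m), e j * kh j z s <> 0.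
    apply: contrapT => nex; apply: nz; apply: big1 => j _.
    by apply: contrapT => nzj; apply: nex; exists j.
  have nzj' : kh j z s <> 0 by move=> k0; apply: nzj; rewrite k0 mulr0.
  exact: (kdeg_kh (ltn_ord j) dz szs nzj').
- move=> s szs.
  rewrite kd_sum mulr_suml -sumrB; apply: subgroup_sum => // j.
  have -> : e j * m`_j * z s - e j * kd m (kh j z) s = e j * kh j (kd m z) s.
    by rewrite -mulrA -(kh_homotopy z (ltn_ord j) szs); ring.
  apply: eN2; exact: (kh_in N2s (ltn_ord j)).
Qed.

Lemma kvan_le d d' N1 N2 : d' <= d -> kvan d N1 N2 -> kvan d' N1 N2.
Proof. by move=> dd V i z id'; apply: V; lia. Qed.

Lemma kvan_neg N1 N2 : submod N1 -> submod N2 -> kvan 0 N1 N2.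
Proof.
move=> N1m N2m i z i0 N1z dz _; exists (fun=> 0); split.
- by move=> *; exact: N1m.1.1.
- exact: kdeg0.
move=> s szs; rewrite kd0 subr0; have [->|/eqP/(dz s szs)] := eqVneq (z s) 0.
  exact: N2m.1.1.
by move=> ci; rewrite -ci in i0.
Qed.

(** Exactness of [H^(i-1)(N1/N2) -> H^i(N2/N3) -> H^i(N1/N3)]. *)
Lemma kvan_sub d N1 N2 N3 : submod N1 -> submod N2 -> submod N3 ->
    (forall x, N2 x -> N1 x) -> (forall x, N3 x -> N2 x) ->
  kvan d N1 N3 -> kvan (d - 1) N1 N2 -> kvan d N2 N3.
Proof.
move=> N1m N2m N3m N21 N32 V13 V12 i z id N2z dz N3dz.
have [|w [N1w dw N3w]] := V13 i z id _ dz N3dz.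
  by move=> s szs; apply: N21; exact: N2z.
have [||v [N1v dv N2v]] := V12 (i - 1) w _ N1w dw; first by lia.
  move=> s szs; rewrite -[kd m w s](subrKC (z s)) -opprB.
  by apply: N2m.1.2; [exact: N2z|apply: N32; exact: N3w].
exists (fun s => w s - kd m v s); split=> //.
  by apply: kdegB => //; have := kdeg_kd dv; rewrite subrK.
by move=> s szs; rewrite kdB kdd subr0; exact: N3w.
Qed.

(** Exactness of [H^i(N1/N3) -> H^i(N1/N2) -> H^(i+1)(N2/N3)]. *)
Lemma kvan_quo d N1 N2 N3 : submod N1 -> submod N2 -> submod N3 ->
    (forall x, N2 x -> N1 x) -> (forall x, N3 x -> N2 x) ->
  kvan d N1 N3 -> kvan (d + 1) N2 N3 -> kvan d N1 N2.
Proof.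
move=> N1m N2m N3m N21 N32 V13 V23 i z id N1z dz N2dz.
have [||w [N2w dw N3w]] := V23 (i + 1) (kd m z) _ N2dz (kdeg_kd dz); first by lia.
  by move=> s szs; rewrite kdd; exact: N3m.1.1.
have [||| v [N1v dv N3v]] := V13 i (fun s => z s - w s) id.
- by move=> s szs; apply: N1m.1.2; [exact: N1z|apply: N21; exact: N2w].
- by apply: kdegB => //; move: dw; rewrite addrK.
- by move=> s szs; rewrite kdB; exact: N3w.
exists v; split=> // s szs.
have -> : z s - kd m v s = (z s - w s - kd m v s) + w s by ring.
by apply: (subgroupD N2m.1); [apply: N32; exact: N3v|exact: N2w].
Qed.

Lemma kvan_ext d N1 N2 N1' N2' : (forall x, N1 x <-> N1' x) ->
  (forall x, N2 x <-> N2' x) -> kvan d N1 N2 -> kvan d N1' N2'.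
Proof.
move=> e1 e2 V i z id N1z dz N2dz.
have [||w [N1w dw N2w]] := V i z id _ dz.
- by move=> s szs; apply/e1; exact: N1z.
- by move=> s szs; apply/e2; exact: N2dz.
exists w; split=> // s szs; first by apply/e1; exact: N1w.
by apply/e2; exact: N2w.
Qed.

(** Lifts are chosen mask by mask; taking zero outside degree [i] keeps the cochain homogeneous. *)
Lemma kcochain_choice (P : seq bool -> G -> Prop) N i :
    (forall s, size s = size m -> exists2 u, N u & P s u) ->
    (forall s, size s = size m -> (count id s : int) <> i -> P s 0) -> subgroup N ->
  exists w, [/\ forall s, size s = size m -> N (w s), kdeg m i w
    & forall s, size s = size m -> P s (w s)].
Proof.
move=> ex ex0 N0.
have ch s : exists u, size s = size m -> [/\ N u, P s u & u <> 0 -> (count id s : int) = i].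
  have [szs|nszs] := eqVneq (size s) (size m); last by exists 0 => /eqP; rewrite (negPf nszs).
  have [ci|/eqP ci] := eqVneq (count id s : int) i.
    by have [u Nu Pu] := ex s szs; exists u => _; split.
  by exists 0 => _; split=> //; [exact: N0.1|exact: ex0].
have [w Hw] := choice ch; exists w; split=> s szs; by have [] := Hw s szs.
Qed.

(** A cocycle [z] satisfies [a z = d w] because [a] acts by zero on cohomology. Modulo [a] the
    cochain [w] is then a cocycle, hence [w = d v + a u], so [a (z - d u)] vanishes modulo [N2] and
    [a] can be cancelled. *)
Lemma kvan_regularS d a N1 N2 : submod N1 -> submod N2 ->
    in_koszul_ideal a N1 N2 ->
    (forall x, N1 x -> N2 (a * x) -> N2 x) ->
    (forall x, N2 x -> N1 x) ->
    stable a N1 -> stable a N2 ->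
  kvan d N1 (fun x => exists2 u, N1 u & N2 (x - a * u)) -> kvan (d + 1) N1 N2.
Proof.
move=> N1m N2m am reg N21 aN1 aN2 V i z id N1z dz N2dz.
have [w [N1w dw N2w]] := koszul_homotopy N1m.1 N2m.1 am N1z dz N2dz.
have [|| v [N1v dv Nv]] := V (i - 1) w _ N1w dw; first by lia.
  move=> s szs; exists (z s); first exact: N1z.
  by rewrite -opprB; apply: (subgroupN N2m.1); exact: N2w.
have [s szs ci|u [N1u du Pu]] := kcochain_choice (i := i - 1) Nv _ N1m.1.
  have [w0|/eqP w0] := eqVneq (w s) 0; last by case: ci; exact: dw.
  have [k0|/eqP k0] := eqVneq (kd m v s) 0; last first.
    by case: ci; have := kdeg_kd dv szs k0; rewrite subrK.
  by rewrite w0 k0 mulr0 !subr0; exact: N2m.1.1.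
exists u; split=> // s szs; apply: reg.
  by apply: N1m.1.2; [exact: N1z|exact: kd_in N1m.1 N1m.2 szs N1u].
rewrite mulrBr -kdZ.
have -> : a * z s - kd m (fun t => a * u t) s
  = (a * z s - kd m w s) + kd m (fun t => w t - kd m v t - a * u t) s.
  rewrite (kdB _ (fun t => w t - kd m v t)) kdB kdd; ring.
by apply: (subgroupD N2m.1); [exact: N2w|exact: kd_in N2m.1 N2m.2 szs Pu].
Qed.

(** The long exact sequence of multiplication by [a] places the cohomology of the cokernel in degree
    [i] between degrees [i] and [i + 1] of that of [N1 / N2]. *)
Lemma kvan_quo_regular d a N1 N2 : submod N1 -> submod N2 ->
    (forall x, N1 x -> N2 (a * x) -> N2 x) ->
    (forall x, N2 x -> N1 x) -> stable a N1 -> stable a N2 ->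
  kvan (d + 1) N1 N2 -> kvan d N1 (fun x => exists2 u, N1 u & N2 (x - a * u)).
Proof.
move=> N1m N2m reg N21 aN1 aN2 V i z id N1z dz Nz.
have [s szs ci|u [N1u du Pu]] := kcochain_choice (i := i + 1) Nz _ N1m.1.
  have [k0|/eqP k0] := eqVneq (kd m z s) 0; last first.
    by case: ci; exact: (kdeg_kd dz szs k0).
  by rewrite k0 mulr0 subrr; exact: N2m.1.1.
have [|s szs|v [N1v dv Nv]] := V (i + 1) u _ N1u du; first by lia.
  apply: reg; first exact: kd_in N1m.1 N1m.2 szs N1u.
  rewrite -kdZ.
  have -> : kd m (fun t => a * u t) s = - kd m (fun t => kd m z t - a * u t) s.
    by rewrite kdB kdd sub0r opprK.
  by apply: subgroupN => //; [exact: N2m.1|exact: kd_in N2m.1 N2m.2 szs Pu].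
rewrite addrK in dv.
have [|s szs|s szs|w [N1w dw Nw]] := V i (fun s => z s - a * v s) _ _ (kdegB dz (kdegZ dv)).
- by lia.
- by apply: N1m.1.2; [exact: N1z|apply: aN1; exact: N1v].
- rewrite kdB kdZ.
  have -> : kd m z s - a * kd m v s = (kd m z s - a * u s) + a * (u s - kd m v s) by ring.
  by apply: (subgroupD N2m.1); [exact: Pu|apply: aN2; exact: Nv].
exists w; split=> // s szs; exists (v s); first exact: N1v.
have -> : z s - kd m w s - a * v s = z s - a * v s - kd m w s by ring.
exact: Nw.
Qed.

(* An isomorphism N1 / N0 -> N2 / N0 given by a fraction b / a. *)
Lemma kvan_iso d a b N N0 N1 N2 : submod N -> submod N0 -> submod N1 -> submod N2 ->
    stable a N -> stable a N0 -> stable b N0 ->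
    (forall x, N1 x -> N x) -> (forall x, N2 x -> N x) ->
    (forall x, N0 x -> N1 x) -> (forall x, N0 x -> N2 x) ->
    (forall x, N x -> N0 (a * x) -> N0 x) -> (forall x, N x -> N0 (b * x) -> N0 x) ->
    (forall x, N1 x -> exists2 y, N2 y & N0 (b * x - a * y)) ->
    (forall y, N2 y -> exists2 x, N1 x & N0 (a * y - b * x)) ->
  kvan d N1 N0 -> kvan d N2 N0.
Proof.
move=> Nm N0m N1m N2m aN aN0 bN0 N1N N2N N01 N02 rega regb fwd bwd V i z id N2z dz N0dz.
have [s szs|s szs ci|z' [N1z' dz' Pz']] := @kcochain_choice (fun s x => N0 (a * z s - b * x)) N1 i _ _ N1m.1.
- exact/bwd/N2z.
- have [z0|/eqP z0] := eqVneq (z s) 0; last by case: ci; exact: dz.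
  by rewrite z0 !mulr0 subr0; exact: N0m.1.1.
have [s szs|w' [N1w' dw' Nw']] := V i z' id N1z' dz'.
  apply: regb; first by apply: N1N; exact: kd_in N1m.1 N1m.2 szs N1z'.
  rewrite -kdZ.
  have -> : kd m (fun t => b * z' t) s
    = a * kd m z s - kd m (fun t => a * z t - b * z' t) s.
    by rewrite kdB !kdZ; ring.
  apply: N0m.1.2; first by apply: aN0; exact: N0dz.
  exact: kd_in N0m.1 N0m.2 szs Pz'.
have [s szs|s szs ci|w [N2w dw Pw]] := @kcochain_choice (fun s y => N0 (b * w' s - a * y)) N2 (i - 1) _ _ N2m.1.
- exact/fwd/N1w'.
- have [w0|/eqP w0] := eqVneq (w' s) 0; last by case: ci; exact: dw'.
  by rewrite w0 !mulr0 subr0; exact: N0m.1.1.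
exists w; split=> // s szs; apply: rega.
  apply: Nm.1.2; first by apply: N2N; exact: N2z.
  apply: N2N; exact: kd_in N2m.1 N2m.2 szs N2w.
have -> : a * (z s - kd m w s) = (a * z s - b * z' s) + b * (z' s - kd m w' s)
   + kd m (fun t => b * w' t - a * w t) s.
  by rewrite kdB !kdZ; ring.
apply: (subgroupD N0m.1); last exact: kd_in N0m.1 N0m.2 szs Pw.
by apply: (subgroupD N0m.1); [exact: Pz'|apply: bN0; exact: Nw'].
Qed.

End KoszulVanishing.

(** * Polynomial evaluations and specializations of fractions *)

Section MpolyMorphisms.
Variables (D : comNzRingType) (n : nat).

Lemma mpoly_ring_ind (P : {mpoly D[n]} -> Prop) :
    (forall c, P c%:MP) -> (forall i, P 'X_i) ->
    (forall p q, P p -> P q -> P (p + q)) ->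
    (forall p q, P p -> P q -> P (p * q)) ->
  forall p, P p.
Proof.
move=> PC PX PD PM; elim/mpolyind => [|c m p _ _ IH]; first by rewrite -mpolyC0.
apply: PD => //; rewrite -mul_mpolyC; apply: (PM) => //.
rewrite mpolyXE_id; apply: (big_ind P); [by rewrite -mpolyC1|exact: PM|].
move=> i _; elim: (m i) => [|e IHe]; first by rewrite expr0 -mpolyC1.
by rewrite exprS; apply: PM.
Qed.

Lemma mpoly_rmorph_ext (L : nzRingType) (f g : {rmorphism {mpoly D[n]} -> L}) :
  (forall c, f c%:MP = g c%:MP) -> (forall i, f 'X_i = g 'X_i) -> f =1 g.
Proof.
move=> fgC fgX; elim/mpoly_ring_ind => // p q fp fq; first by rewrite !rmorphD fp fq.
by rewrite !rmorphM fp fq.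
Qed.

End MpolyMorphisms.

Section MpolyEval.
Variables (n : nat) (B : nzRingType) (L : comNzRingType).
Variables (f : {rmorphism B -> L}) (h : 'I_n -> L).

(* Sealed: unifying two values of mmap at distinct polynomials diverges. *)
Fact mev_key : unit. Proof. exact: tt. Qed.
Definition mev : {mpoly B[n]} -> L := locked_with mev_key (mmap f h).

Lemma mevE : mev =1 mmap f h.
Proof. by rewrite /mev unlock. Qed.

Fact mev_is_zmod_morphism : zmod_morphism mev.
Proof. by move=> p q; rewrite !mevE rmorphB. Qed.
HB.instance Definition _ :=
  GRing.isZmodMorphism.Build {mpoly B[n]} L mev mev_is_zmod_morphism.

Fact mev_is_monoid_morphism : monoid_morphism mev.
Proof. by split=> [|p q]; rewrite !mevE ?rmorph1 ?rmorphM. Qed.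
HB.instance Definition _ :=
  GRing.isMonoidMorphism.Build {mpoly B[n]} L mev mev_is_monoid_morphism.

Lemma mevC c : mev c%:MP = f c.
Proof. by rewrite mevE mmapC. Qed.

Lemma mevX i : mev 'X_i = h i.
Proof. by rewrite mevE mmapX mmap1U. Qed.

End MpolyEval.

Section Specialization.
Variables (D : comNzRingType) (F L : fieldType).
Variables (iota : {rmorphism D -> F}) (g : {rmorphism D -> L}).

(* The graph of the partial extension of g to the fractions in F whose
   denominator is not killed by g. *)
Definition spec (a : F) (b : L) :=
  exists e d, [/\ g d != 0, a = iota e / iota d & b = g e / g d].

Lemma spec_iota x : spec (iota x) (g x).
Proof. by exists x, 1; rewrite !rmorph1 !divr1 oner_neq0. Qed.

Hypothesis iota_inj : injective iota.

Lemma spec_den_neq0 d : g d != 0 -> iota d != 0.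
Proof.
apply: contraNneq => d0; rewrite (iota_inj (x1 := d) (x2 := 0)) ?rmorph0 //.
Qed.

Lemma specD a b a' b' : spec a b -> spec a' b' -> spec (a + a') (b + b').
Proof.
move=> [e [d [gd -> ->]]] [e' [d' [gd' -> ->]]].
exists (e * d' + e' * d), (d * d'); rewrite !rmorphM !rmorphD !rmorphM mulf_neq0 //.
have nd := spec_den_neq0 gd; have nd' := spec_den_neq0 gd'.
by split=> //; rewrite addf_div.
Qed.

Lemma specM a b a' b' : spec a b -> spec a' b' -> spec (a * a') (b * b').
Proof.
move=> [e [d [gd -> ->]]] [e' [d' [gd' -> ->]]].
exists (e * e'), (d * d'); rewrite !rmorphM mulf_neq0 //.
by split=> //; rewrite mulf_div.
Qed.

(** For [y = 0] both quotients are zero by convention; this makes the encoding of a deleted form by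
    zero compatible with specialization. *)
Lemma spec_div x y : (y != 0 -> g y != 0) -> spec (iota x / iota y) (g x / g y).
Proof.
have [-> _|y0 /(_ isT) gy] := eqVneq y 0; last by exists x, y.
rewrite !rmorph0 !invr0 !mulr0 -(rmorph0 g) -(rmorph0 iota); exact: spec_iota.
Qed.

(** Independence of the chosen fraction, at zero: it turns a relation among fractions into a
    relation among their specializations. *)
Lemma spec0 b : spec 0 b -> b = 0.
Proof.
move=> [e [d [gd /esym/eqP e0 ->]]]; move: e0.
rewrite mulf_eq0 invr_eq0 (negPf (spec_den_neq0 gd)) orbF -(rmorph0 iota).
by move=> /eqP/iota_inj->; rewrite rmorph0 mul0r.
Qed.

Lemma mev_spec (B : nzRingType) n (f : {rmorphism B -> D}) (h : 'I_n -> F) h' :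
    (forall i, spec (h i) (h' i)) ->
  forall p : {mpoly B[n]}, 
    spec (mev (iota \o f) h p) (mev (g \o f) h' p).
Proof.
move=> hh p; rewrite !mevE; apply: (big_ind2 spec).
- rewrite -(rmorph0 g) -(rmorph0 iota); exact: spec_iota.
- by move=> *; exact: specD.
move=> m _; apply: specM; first exact: spec_iota.
apply: (big_ind2 spec).
- rewrite -(rmorph1 g) -(rmorph1 iota); exact: spec_iota.
- by move=> *; exact: specM.
move=> i _; elim: (m i) => [|e IH].
  by rewrite !expr0 -(rmorph1 g) -(rmorph1 iota); exact: spec_iota.
by rewrite !exprS; apply: specM.
Qed.

End Specialization.

(** * Linear forms and linear substitutions *)

Section LinearSubstitutions.
Variable K : fieldType.

(** The variable of index [ord0] is reserved for T; the other [k] variables are the coordinates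
    x. *)
Definition lf k (v : 'rV[K]_k) : {mpoly K[k.+1]} :=
  \sum_j (v 0 j)%:MP * 'X_(lift ord0 j).

Definition endo_var k k' (P : 'M[K]_(k, k')) (i : 'I_k.+1) : {mpoly K[k'.+1]} :=
  if unlift ord0 i is Some j then lf (row j P) else 'X_ord0.

(** A linear substitution in x that fixes T. With the matrix [cokermx h] it kills exactly the linear
    forms that are multiples of [h], so it models restriction to [h = 0] without changing the number
    of variables. *)
Definition endo k k' (P : 'M[K]_(k, k')) : {mpoly K[k.+1]} -> {mpoly K[k'.+1]} :=
  mev (@mpolyC _ K) (endo_var P).

HB.instance Definition _ k k' (P : 'M[K]_(k, k')) :=
  GRing.RMorphism.copy (endo P) (mev (@mpolyC _ K) (endo_var P)).

Lemma endoC k k' (P : 'M[K]_(k, k')) c : endo P c%:MP = c%:MP.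
Proof. exact: mevC. Qed.

Lemma endoX0 k k' (P : 'M[K]_(k, k')) : endo P 'X_ord0 = 'X_ord0.
Proof. by rewrite /endo mevX /endo_var unlift_none. Qed.

Lemma endoX k k' (P : 'M[K]_(k, k')) j : endo P 'X_(lift ord0 j) = lf (row j P).
Proof. by rewrite /endo mevX /endo_var liftK. Qed.

Lemma lfD k (u v : 'rV[K]_k) : lf (u + v) = lf u + lf v.
Proof.
rewrite /lf -big_split; apply: eq_bigr => j _.
by rewrite mxE mpolyCD mulrDl.
Qed.

Lemma lfZ k a (u : 'rV[K]_k) : lf (a *: u) = a%:MP * lf u.
Proof.
rewrite /lf mulr_sumr; apply: eq_bigr => j _.
by rewrite mxE mpolyCM mulrA.
Qed.

Lemma lf0 k : lf (0 : 'rV[K]_k) = 0.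
Proof. by rewrite -(scale0r 0) lfZ mpolyC0 mul0r. Qed.

Lemma lfB k (u v : 'rV[K]_k) : lf (u - v) = lf u - lf v.
Proof. by rewrite lfD -scaleN1r lfZ mpolyCN mpolyC1 mulN1r. Qed.

Lemma lf_sum k (I : finType) (P : pred I) (E : I -> 'rV[K]_k) :
  lf (\sum_(i | P i) E i) = \sum_(i | P i) lf (E i).
Proof. exact: (big_morph _ (@lfD k) (lf0 k)). Qed.

Lemma lf_delta k (j : 'I_k) : lf (delta_mx 0 j) = 'X_(lift ord0 j).
Proof.
rewrite /lf (bigD1 j) //= big1 => [|i ij]; last by rewrite mxE (negPf ij) andbF mpolyC0 mul0r.
by rewrite mxE !eqxx mpolyC1 mul1r addr0.
Qed.

Lemma lf_eq0 k (v : 'rV[K]_k) : (lf v == 0) = (v == 0).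
Proof.
apply/eqP/eqP => [lv|->]; last exact: lf0.
apply/rowP => j; have := congr1 (mcoeff U_(lift ord0 j)) lv.
rewrite /lf mcoeff0 raddf_sum /= (bigD1 j) //= big1 => [|i ij].
  by rewrite mul_mpolyC mcoeffZ mcoeffX eqxx mulr1 addr0 mxE.
rewrite mul_mpolyC mcoeffZ mcoeffX (_ : (_ == _) = false) ?mulr0 //.
apply/negbTE; rewrite eq_mnm1; apply: contra ij => /eqP/lift_inj->; exact: eqxx.
Qed.

Lemma endo_lf k k' (P : 'M[K]_(k, k')) v : endo P (lf v) = lf (v *m P).
Proof.
rewrite {1}/lf rmorph_sum /= mulmx_sum_row lf_sum; apply: eq_bigr => j _.
by rewrite rmorphM /= endoC endoX lfZ.
Qed.

Lemma ord0_or_lift k (i : 'I_k.+1) : i = ord0 \/ exists j, i = lift ord0 j.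
Proof. by case: (unliftP ord0 i) => [j ->|->]; [right; exists j|left]. Qed.

Lemma endo_comp k k' k'' (A : 'M[K]_(k, k')) (B : 'M[K]_(k', k'')) p :
  endo B (endo A p) = endo (A *m B) p.
Proof.
move: p; apply: (mpoly_rmorph_ext (f := (endo B \o endo A)%FUN) (g := endo (A *m B))).
  by move=> c /=; rewrite !endoC.
move=> i /=; have [->|[j ->]] := ord0_or_lift i; first by rewrite !endoX0.
by rewrite !endoX endo_lf row_mul.
Qed.

Lemma endo1 k p : endo (1%:M : 'M[K]_k) p = p.
Proof.
move: p; apply: (mpoly_rmorph_ext (f := endo 1%:M) (g := idfun)) => [c|i /=]; first exact: endoC.
have [->|[j ->]] := ord0_or_lift i; first exact: endoX0.
by rewrite endoX row1 lf_delta.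
Qed.

End LinearSubstitutions.

(** * Ideals and Noetherian rings *)

Section Ideals.
Variable G : comNzRingType.
Implicit Types (I : G -> Prop) (p q : G).

(** The unit ideal is allowed, unlike in [idealr_closed]. *)
Definition pideal I := subgroup I /\ forall a x, I x -> I (a * x).

Lemma pideal_congD I p q p' q' : pideal I ->
  I (p - p') -> I (q - q') -> I (p + q - (p' + q')).
Proof. by move=> [Is _] Ip Iq; rewrite opprD addrACA; exact: subgroupD. Qed.

Lemma pideal_congM I p q p' q' : pideal I ->
  I (p - p') -> I (q - q') -> I (p * q - p' * q').
Proof.
move=> [Is Im] Ip Iq.
have -> : p * q - p' * q' = q * (p - p') + p' * (q - q') by ring.
by apply: subgroupD => //; exact: Im.
Qed.

Lemma pideal_sub I p q : pideal I -> I (p - q) -> I q -> I p.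
Proof. by move=> [Is _] Ipq Iq; rewrite -(subrK q p); exact: subgroupD. Qed.

Lemma pideal_linB I x a a' b b' : pideal I -> I (x * a - a') -> I (x * b - b') ->
  I (x * (a - b) - (a' - b')).
Proof.
move=> [Is _] Ia Ib; have -> : x * (a - b) - (a' - b') = (x * a - a') - (x * b - b') by ring.
exact: Is.2.
Qed.

Lemma pideal_linM I x a a' c : pideal I -> I (x * a - a') -> I (x * (c * a) - c * a').
Proof. by move=> [_ Im] Ia; rewrite mulrCA -mulrBr; exact: Im. Qed.

Lemma cone_linB (x z e y t : G) : x * z - t - e * x * y = x * (z - e * y) - t.
Proof. ring. Qed.

Lemma horner_swap (q u x b : G) m :
  q - (q - u * x ^+ m.+1 + b * x ^+ m) = x ^+ m * (x * u - b).
Proof. by rewrite exprS; ring. Qed.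

Lemma unit_mulB (x y t u : G) :
  1 - x * y * (t * u) = (1 - x * t) + x * t * (1 - y * u).
Proof. ring. Qed.

End Ideals.

(** * Weakly regular sequences and their localization *)

Section WeaklyRegular.
Variable G : comNzRingType.
Implicit Types (N : G -> Prop) (gs m : seq G).

Definition quo_mul N1 N2 (g : G) : G -> Prop :=
  fun x => exists2 u, N1 u & N2 (x - g * u).

(** Each term is regular modulo [N2] and the previous terms, that is, on [N1 / (N2 + g N1)] after
    the first step. No properness is asked, so the notion survives localization. *)
Fixpoint wreg N1 N2 gs : Prop :=
  if gs is g :: gs' then
    (forall x, N1 x -> N2 (g * x) -> N2 x) /\ wreg N1 (quo_mul N1 N2 g) gs'
  else True.

Definition subring N := [/\ subgroup N, N 1 & forall x y, N x -> N y -> N (x * y)].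

Definition ideal_of N1 N2 := [/\ subgroup N2, forall x, N2 x -> N1 x
  & forall x y, N1 x -> N2 y -> N2 (x * y)].

Lemma ideal_of_quo_mul N1 N2 g : subring N1 -> ideal_of N1 N2 -> N1 g ->
  ideal_of N1 (quo_mul N1 N2 g).
Proof.
move=> [N1s N11 N1M] [N2s N21 N2M] N1g; split.
- split; first by exists 0; [exact: N1s.1|rewrite mulr0 subr0; exact: N2s.1].
  move=> x y [u N1u Nx] [v N1v Ny]; exists (u - v); first exact: N1s.2.
  have -> : x - y - g * (u - v) = (x - g * u) - (y - g * v) by ring.
  exact: N2s.2.
- move=> x [u N1u Nx]; rewrite -(subrK (g * u) x).
  by apply: subgroupD => //; [exact: N21|exact: N1M].
move=> x y N1x [u N1u Ny]; exists (x * u); first exact: N1M.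
have -> : x * y - g * (x * u) = x * (y - g * u) by ring.
exact: N2M.
Qed.

Lemma ideal_of_submod m N1 N2 : subring N1 -> ideal_of N1 N2 ->
  (forall a, a \in m -> N1 a) -> submod m N1 /\ submod m N2.
Proof.
move=> [N1s N11 N1M] [N2s N21 N2M] mN; split; split=> //.
  by move=> a /mN N1a x N1x; exact: N1M.
by move=> a /mN N1a x N1x; exact: N2M.
Qed.

(** Each regular element taken from the Koszul ideal raises the range of vanishing by one, starting
    from negative degrees. *)
Lemma kvan_wreg m N1 N2 gs : subring N1 -> ideal_of N1 N2 ->
    (forall a, a \in m -> N1 a) ->
    (forall g, g \in gs -> exists2 e : 'I_(size m) -> G,
        forall j, N1 (e j) & g = \sum_j e j * m`_j) ->
    wreg N1 N2 gs ->
  kvan m (size gs : int) N1 N2.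
Proof.
move=> N1r N2i mN; elim: gs N2 N2i => [|g gs IH] N2 N2i gN.
  by move=> _; have [? ?] := ideal_of_submod N1r N2i mN; exact: kvan_neg.
move=> [reg wr]; have [N1m N2m] := ideal_of_submod N1r N2i mN.
have [e Ne ge] := gN g (mem_head _ _).
have N1g : N1 g.
  rewrite ge; have [N1s _ N1M] := N1r; apply: subgroup_sum => // j.
  by apply: N1M => //; apply: mN; rewrite mem_nth.
have -> : (size (g :: gs) : int) = (size gs : int) + 1 by rewrite /= -addn1 PoszD.
have [N1s N11 N1M] := N1r; have [N2s N21 N2M] := N2i.
apply: (@kvan_regularS _ _ _ g) => //.
- by exists e; split=> // j x; [exact: N1M|exact: N2M].
- by move=> x; exact: N1M.
- by move=> x; exact: N2M.
apply: IH => //; first exact: ideal_of_quo_mul.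
by move=> g' g'gs; apply: gN; rewrite inE g'gs orbT.
Qed.

End WeaklyRegular.

Section LocalizeRegular.
Variables (G : comNzRingType) (F : fieldType) (phi : {rmorphism G -> F}) (w : G).
Hypothesis (phi_inj : injective phi).
Hypothesis w0 : phi w != 0.

(** The localization of [phi N] at [phi w], inside [F]. *)
Definition locz (N : G -> Prop) : F -> Prop :=
  fun x => exists e a, N a /\ phi w ^+ e * x = phi a.

Lemma wreg_locz (N2 : G -> Prop) gs : pideal N2 -> wreg (fun=> True) N2 gs ->
  wreg (locz (fun=> True)) (locz N2) (map phi gs).
Proof.
elim: gs N2 => //= g gs IH N2 [N2s N2M] [reg wr]; split.
  move=> x [e [a [_ xa]]] [e' [b [Nb gx]]].
  exists (e' + e)%N, (w ^+ e' * a); split; last by rewrite exprD -mulrA xa rmorphM rmorphXn.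
  apply: reg => //; have -> : g * (w ^+ e' * a) = w ^+ e * b; last exact: N2M.
  apply: phi_inj; rewrite !rmorphM !rmorphXn -gx -xa /=; ring.
have -> : quo_mul (locz (fun=> True)) (locz N2) (phi g)
    = locz (quo_mul (fun=> True) N2 g).
  apply/funext => x; apply/propext; split.
    move=> [u [e [a [_ ua]]] [e' [b [Nb xb]]]].
    exists (e + e')%N, (w ^+ e' * (g * a) + w ^+ e * b); split.
      exists (w ^+ e' * a) => //.
      have -> : w ^+ e' * (g * a) + w ^+ e * b - g * (w ^+ e' * a) = w ^+ e * b by ring.
      exact: N2M.
    rewrite rmorphD !rmorphM !rmorphXn -ua -xb /= exprD; ring.
  move=> [e [a [[u _ Nau] xa]]]; exists (phi u / phi w ^+ e).
    by exists e, u; split=> //; rewrite mulrC divfK // expf_neq0.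
  exists e, (a - g * u); split=> //.
  by rewrite rmorphB rmorphM -xa mulrBr mulrCA [_ * (_ / _)]mulrC divfK // expf_neq0.
apply: IH => //; split; last first.
  move=> a x [u _ Nx]; exists (a * u) => //.
  have -> : a * x - g * (a * u) = a * (x - g * u) by ring.
  exact: N2M.
split; first by exists 0 => //; rewrite mulr0 subr0; exact: N2s.1.
move=> x y [u _ Nx] [v _ Ny]; exists (u - v) => //.
have -> : x - y - g * (u - v) = (x - g * u) - (y - g * v) by ring.
exact: N2s.2.
Qed.

Lemma locz_subring : subring (locz (fun=> True)).
Proof.
split; first split.
- by exists 0%N, 0; split=> //; rewrite mulr0 rmorph0.
- move=> x y [e [a [_ xa]]] [e' [b [_ yb]]]; exists (e + e')%N, (w ^+ e' * a - w ^+ e * b).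
  by split=> //; rewrite rmorphB !rmorphM !rmorphXn -xa -yb /= exprD; ring.
- by exists 0%N, 1; split=> //; rewrite mulr1 rmorph1.
move=> x y [e [a [_ xa]]] [e' [b [_ yb]]]; exists (e + e')%N, (a * b); split=> //.
by rewrite rmorphM -xa -yb exprD; ring.
Qed.

Lemma locz_zero : locz (fun a => a = 0) = (fun x => x = 0).
Proof.
apply/funext => x; apply/propext; split=> [[e [a [-> /eqP]]]|->].
  by rewrite rmorph0 mulf_eq0 expf_eq0 (negPf w0) andbF => /eqP.
by exists 0%N, 0; rewrite mulr0 rmorph0.
Qed.

End LocalizeRegular.

Section CoordinatePolynomials.
Variables (K : fieldType) (n : nat).
Local Notation D := {mpoly K[n]}.

Definition coord_poly (q : {poly K}) (x : D) : D := (map_poly (@mpolyC n K) q).[x].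

(** A polynomial is read as a polynomial in ['X_i]; its coefficients stay in [D] but no longer
    involve ['X_i]. *)
Definition split_var (i : 'I_n) : D -> {poly D} :=
  mev (@polyC D \o @mpolyC n K)%FUN (fun j => if j == i then 'X else ('X_j)%:P).
HB.instance Definition _ i := GRing.RMorphism.copy (split_var i)
  (mev (@polyC D \o @mpolyC n K)%FUN (fun j => if j == i then 'X else ('X_j)%:P)).

Lemma split_varC i c : split_var i c%:MP = (c%:MP)%:P.
Proof. exact: mevC. Qed.
Lemma split_varX i j : split_var i 'X_j = if j == i then 'X else ('X_j)%:P.
Proof. exact: mevX. Qed.

Lemma split_varK i a : (split_var i a).['X_i] = a.
Proof.
elim/mpoly_ring_ind: a => [c|j|p q ep eq|p q ep eq].
- by rewrite split_varC hornerC.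
- by rewrite split_varX; case: eqP => [->|_]; rewrite ?hornerX ?hornerC.
- by rewrite (rmorphD (split_var i)) hornerD ep eq.
by rewrite (rmorphM (split_var i)) hornerM ep eq.
Qed.

Lemma split_var_coord i q j :
  split_var i (coord_poly q 'X_j) =
  if j == i then map_poly (@mpolyC n K) q else (coord_poly q 'X_j)%:P.
Proof.
rewrite /coord_poly -horner_map /= -map_poly_comp split_varX.
have -> : map_poly (split_var i \o @mpolyC n K) q
    = map_poly polyC (map_poly (@mpolyC n K) q).
  by rewrite -map_poly_comp; apply: eq_map_poly => c /=; rewrite split_varC.
by case: eqP => _; [rewrite -[RHS]comp_polyXr|rewrite horner_map].
Qed.

(** The ideal is extended from the polynomials free of ['X_i]: it is closed under taking
    coefficients in that variable. *)
Definition indep i (I : D -> Prop) := forall a, I a -> forall j, I (split_var i a)`_j.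

(** The top coefficient of [q b] is a unit times that of [b], so the latter lies in [I] and the top
    term of [b] can be removed. *)
Lemma unit_lead_coef_mul (I : D -> Prop) (q b : {poly D}) : pideal I ->
    (exists u, u * lead_coef q = 1) ->
    (forall j, I (q * b)`_j) -> forall j, I b`_j.
Proof.
move=> [Is IM] [u uq]; have [m] := ubnP (size b); elim: m b => // m IH b szb Iqb.
have [->|b0] := eqVneq b 0; first by move=> j; rewrite coef0; exact: Is.1.
have Ilb : I (lead_coef b).
  rewrite -[lead_coef b]mul1r -uq -mulrA; apply: (IM).
  by rewrite mul_lead_coef; exact: Iqb.
pose b1 := b - (lead_coef b)%:P * 'X^((size b).-1).
have bE : b = b1 + (lead_coef b)%:P * 'X^((size b).-1) by rewrite /b1 subrK.
have Ib1 j : I b1`_j.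
  apply: IH.
    rewrite ltnS in szb; apply: leq_trans szb.
    rewrite -[X in (_ < X)%N](prednK (n := size b)) ?size_poly_gt0 // ltnS.
    apply/leq_sizeP => l bl; rewrite coefB coefCM coefXn.
    have [->|lb] := eqVneq l (size b).-1; first by rewrite mulr1 subrr.
    rewrite mulr0 subr0 nth_default //.
    by rewrite -(prednK (n := size b)) ?size_poly_gt0 // ltn_neqAle eq_sym lb.
  move=> l; rewrite mulrBr coefB mulrCA coefCM; apply: Is.2 => //.
  by rewrite mulrC; exact: IM.
move=> j; rewrite bE coefD coefCM; apply: (subgroupD Is); first exact: Ib1.
by rewrite mulrC; exact: IM.
Qed.

Lemma coord_regular i q (I : D -> Prop) a : pideal I -> indep i I -> q != 0 ->
  I (coord_poly q 'X_i * a) -> I a.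
Proof.
move=> Ii Ii' q0 Iqa; rewrite -(split_varK i a) horner_coef.
apply: subgroup_sum => [|j]; first exact: Ii.1.
rewrite mulrC; apply: Ii.2.
apply: (unit_lead_coef_mul (q := map_poly (@mpolyC n K) q)) => //.
  exists ((lead_coef q)^-1)%:MP; rewrite lead_coef_map_eq ?mpolyC_eq0 ?lead_coef_eq0 //.
  by rewrite -mpolyCM mulVf ?lead_coef_eq0 // mpolyC1.
move=> l; have := Ii' _ Iqa l.
by rewrite rmorphM /= split_var_coord eqxx.
Qed.

Lemma indep_quo_mul i j q (I : D -> Prop) : pideal I -> indep i I -> j != i ->
  indep i (quo_mul (fun=> True) I (coord_poly q 'X_j)).
Proof.
move=> Ii Ii' ji a [u _ Iau] l; exists (split_var i u)`_l => //.
have := Ii' _ Iau l; rewrite rmorphB rmorphM /= split_var_coord (negPf ji).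
by rewrite coefB coefCM.
Qed.

Lemma pideal_quo_mul (G : comNzRingType) (I : G -> Prop) g : pideal I ->
  pideal (quo_mul (fun=> True) I g).
Proof.
move=> [Is IM].
have [|||Qs _ QM] := @ideal_of_quo_mul G (fun=> True) I g.
- by split=> //; split.
- by split=> // x y _; exact: IM.
- by [].
by split=> // a x; exact: QM.
Qed.

(** Adjoining a polynomial in one variable keeps the ideal independent of the remaining variables,
    and a nonzero one-variable polynomial over a field has a unit as leading coefficient. *)
Lemma coord_wreg (q : 'I_n -> {poly K}) (js : seq 'I_n) (I : D -> Prop) :
    (forall i, q i != 0) -> uniq js -> pideal I ->
    (forall i, i \in js -> indep i I) ->
  wreg (fun=> True) I [seq coord_poly (q i) 'X_i | i <- js].
Proof.
move=> q0; elim: js I => //= i js IH I /andP[ijs ujs] Ii Ij; split.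
  by move=> x _; apply: coord_regular => //; apply: Ij; exact: mem_head.
apply: IH => //; first exact: pideal_quo_mul.
move=> j jjs; apply: indep_quo_mul => //; first by apply: Ij; rewrite inE jjs orbT.
by apply: contraNneq ijs => ->.
Qed.

End CoordinatePolynomials.

Lemma ideal_gen_nth (A : comNzRingType) (s : seq A) x : x \in ideal_gen (mem s) ->
  exists e : 'I_(size s) -> A, x = \sum_j e j * s`_j.
Proof.
move=> /asboolP[m [c [g [gs ->]]]].
have idx i : (index (g i) s < size s)%N by rewrite index_mem; exact: gs.
exists (fun j => \sum_(i | Ordinal (idx i) == j) c i).
rewrite (partition_big (fun i => Ordinal (idx i)) xpredT) //=; apply: eq_bigr => j _.
rewrite mulr_suml; apply: eq_bigr => i /eqP <- /=.
by rewrite nth_index //; exact: gs.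
Qed.

Section Noetherian.
Variable A : comNzRingType.
Implicit Types (I J : A -> Prop) (s : seq A).

Definition pset I : {pred A} := [pred x | `[<I x>]].

Definition fin_gen I := exists s, forall x, I x <-> x \in ideal_gen (mem s).

Lemma pideal_gen (S : {pred A}) : pideal (fun x => x \in ideal_gen S).
Proof.
split; last by move=> a x; exact: ideal_genM.
split; first exact: ideal_gen0.
move=> x y xS yS; rewrite -mulN1r; apply: ideal_genD => //; exact: ideal_genM.
Qed.

Lemma ideal_gen_min (S : {pred A}) I x : pideal I -> (forall y, y \in S -> I y) ->
  x \in ideal_gen S -> I x.
Proof.
move=> [Is IM] SI /asboolP[m [c [g [gS ->]]]].
by apply: subgroup_sum => // i; apply: IM; apply: SI.
Qed.

Lemma ideal_gen_subset (s t : seq A) x : {subset s <= t} ->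
  x \in ideal_gen (mem s) -> x \in ideal_gen (mem t).
Proof.
move=> st; apply: (ideal_gen_min (pideal_gen (mem t))) => y ys.
by apply: mem_ideal_gen; exact: st.
Qed.

Lemma pideal_idealr I : pideal I -> ~ I 1 -> idealr_closed (pset I).
Proof.
move=> [Is IM] I1; split.
- by apply/asboolP; exact: Is.1.
- by apply/negP => /asboolP.
by move=> a u v /asboolP Iu /asboolP Iv; apply/asboolP; apply: subgroupD => //; exact: IM.
Qed.

Lemma idealr_pideal (J : {pred A}) : idealr_closed J -> pideal (fun x => x \in J).
Proof.
move=> [J0 _ JD]; have JN x : x \in J -> forall a, a * x \in J.
  by move=> xJ a; rewrite -[a * x]addr0; exact: JD.
split; first split=> // x y xJ yJ; last by move=> a x xJ; exact: JN.
by rewrite addrC -mulN1r; exact: JD.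
Qed.

Lemma noetherianP : noetherian A <-> forall I, pideal I -> fin_gen I.
Proof.
split=> [nA I Ii|nA J Ji]; last first.
  by have [s sP] := nA _ (idealr_pideal Ji); exists s => x; apply/idP/idP => /sP.
have [I1|I1] := pselect (I 1).
  exists [:: 1] => x; split=> _; last by rewrite -[x]mulr1; exact: Ii.2.
  by rewrite -[x]mulr1; apply: ideal_genM; apply: mem_ideal_gen; rewrite inE.
have [s sP] := nA _ (pideal_idealr Ii I1); exists s => x.
by rewrite -sP; split=> [Ix|/asboolP//]; apply/asboolP.
Qed.

Hypothesis nA : noetherian A.

(** Without a maximal member above [I0], choice yields a strictly increasing chain; the generators
    of its union already lie in one term. *)
Lemma noetherian_max (Fam : (A -> Prop) -> Prop) I0 :
    Fam I0 -> (forall I, Fam I -> pideal I) ->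
  exists I, [/\ Fam I, forall x, I0 x -> I x &
    forall J, Fam J -> (forall x, I x -> J x) -> forall x, J x -> I x].
Proof.
move=> F0 Fi; apply: contrapT => nomax.
pose T := {I | Fam I /\ forall x, I0 x -> I x}.
have ex (I : T) : exists J : T, (forall x, sval I x -> sval J x) /\
    exists x, sval J x /\ ~ sval I x.
  case: I => I [FI I0I] /=; apply: contrapT => noJ; apply: nomax; exists I; split=> // J FJ IJ x Jx.
  apply: contrapT => nIx; apply: noJ.
  have FJ' : Fam J /\ forall x, I0 x -> J x by split=> // y /I0I/IJ.
  by exists (exist _ J FJ') => /=; split=> //; exists x.
have [next nextP] := choice ex.
pose c j : T := iter j next (exist _ I0 (conj F0 (fun x h => h))).
have cS j x : sval (c j) x -> sval (c j.+1) x by case: (nextP (c j)) => + _; exact.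
have cle i j x : (i <= j)%N -> sval (c i) x -> sval (c j) x.
  by move=> /subnK <-; elim: (j - i)%N => // l IH /IH; exact: cS.
pose U x := exists j, sval (c j) x.
have Ui : pideal U.
  split; first split.
  - by exists 0%N; have [[h _] _] := Fi _ F0.
  - move=> x y [i cx] [j cy]; exists (maxn i j).
    have [[_ h] _] := Fi _ (svalP (c (maxn i j))).1.
    by apply: h; [apply: cle cx; exact: leq_maxl|apply: cle cy; exact: leq_maxr].
  by move=> a x [j cx]; exists j; have [_ h] := Fi _ (svalP (c j)).1; exact: h.
have [s sP] := (noetherianP.1 nA) U Ui.
have [j sj] : exists j, forall x, x \in s -> sval (c j) x.
  have : forall x, x \in s -> U x by move=> x xs; apply/sP; exact: mem_ideal_gen.
  elim: s {sP} => [|y s IH] sU; first by exists 0%N.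
  have [j sj] := IH (fun x xs => sU x (mem_behead (s := y :: s) xs)).
  have [i yi] := sU y (mem_head _ _); exists (maxn i j) => x; rewrite inE => /orP[/eqP->|/sj].
    by apply: cle yi; exact: leq_maxl.
  by apply: cle; exact: leq_maxr.
have [_ [x [cx ncx]]] := nextP (c j); apply: ncx.
have Ux : U x by exists j.+1.
by move/sP: Ux; apply: ideal_gen_min => //; exact: (Fi _ (svalP (c j)).1).
Qed.

Definition pprime (P : A -> Prop) :=
  [/\ pideal P, ~ P 1 & forall a b, P (a * b) -> P a \/ P b].

(** [Q] is maximal among the ideals above [J] that miss the multiplicative set of all [s^e u] with
    [u] outside [P]; regularity of [s] modulo [J] ensures that [J] itself misses it. *)
Lemma prime_below J P (s : A) : pideal J -> pprime P -> (forall x, J x -> P x) ->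
    (forall x, J (s * x) -> J x) ->
  exists Q, [/\ pprime Q, forall x, J x -> Q x, forall x, Q x -> P x & ~ Q s].
Proof.
move=> Ji [Pi P1 PM] JP regs.
pose Fam I := [/\ pideal I, forall x, J x -> I x & forall e u, I (s ^+ e * u) -> P u].
have FJ : Fam J.
  split=> // e u; elim: e => [|e IH]; first by rewrite mul1r; exact: JP.
  by rewrite exprS -mulrA => /regs.
have [|Q [[Qi JQ QP] _ Qmax]] := noetherian_max FJ; first by move=> I [].
have QP' x : Q x -> P x by move=> Qx; apply: (QP 0%N); rewrite mul1r.
exists Q; split=> //; last by move=> Qs; apply: P1; apply: (QP 1%N); rewrite mulr1.
have grow a : ~ Q a -> exists e u, [/\ ~ P u & quo_mul (fun=> True) Q a (s ^+ e * u)].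
  move=> nQa; apply: contrapT => no; apply: nQa.
  apply: (Qmax (quo_mul (fun=> True) Q a)).
  - split; first exact: pideal_quo_mul.
      by move=> x /JQ Qx; exists 0; rewrite ?mulr0 ?subr0.
    by move=> e u Iu; apply: contrapT => nPu; apply: no; exists e, u.
  - by move=> x Qx; exists 0; rewrite ?mulr0 ?subr0.
  by exists 1 => //; rewrite mulr1 subrr; exact: Qi.1.1.
split=> //; first by move/QP'.
move=> a b Qab; apply: contrapT => /not_orP[nQa nQb].
have [e [u [nPu [x _ Qx]]]] := grow a nQa; have [f [v [nPv [y _ Qy]]]] := grow b nQb.
have : P (u * v).
  apply: (QP (e + f)%N).
  have -> : s ^+ (e + f) * (u * v) = (s ^+ e * u - a * x) * (s ^+ f * v)
     + (a * x * (s ^+ f * v - b * y) + x * y * (a * b)) by rewrite exprD; ring.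
  apply: (subgroupD Qi.1); first by rewrite mulrC; exact: Qi.2.
  by apply: (subgroupD Qi.1); exact: Qi.2.
by case/PM.
Qed.

Lemma pprime_prime P : pprime P -> prime_ideal (pset P).
Proof.
move=> [Pi P1 PM]; split; first exact: pideal_idealr.
by move=> u v /asboolP/PM[] Pu; apply/orP; [left|right]; apply/asboolP.
Qed.

Lemma maximal_prime (M : {pred A}) : maximal_ideal M ->
  pprime (fun x => x \in M) /\ forall a, a \notin M -> exists b, 1 - a * b \in M.
Proof.
move=> [Mi Mmax]; have Mp := idealr_pideal Mi; have [M0 M1 MD] := Mi.
have inv a : a \notin M -> exists b, 1 - a * b \in M.
  move=> aM; apply: contrapT => no; move/negP: aM; apply.
  pose J := quo_mul (fun=> True) (fun x => x \in M) a.
  have Ji : pideal J by exact: pideal_quo_mul.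
  have J1 : ~ J 1 by move=> [b _ Mb]; apply: no; exists b.
  apply: (Mmax _ (pideal_idealr Ji J1)).
    by move=> x xM; apply/asboolP; exists 0; rewrite ?mulr0 ?subr0.
  by apply/asboolP; exists 1 => //; rewrite mulr1 subrr.
split=> //; split=> //; first exact/negP.
move=> a b Mab; have [|/inv[c Mc]] := boolP (a \in M); first by left.
right; have -> : b = b * (1 - a * c) + c * (a * b) by ring.
by apply: (subgroupD Mp.1); exact: Mp.2.
Qed.

(** The chain is built downwards: a prime over the first [i + 1] elements contains a prime over the
    first [i] that avoids the last of them. *)
Lemma regular_chain s (P : A -> Prop) : regular_sequence s -> pprime P ->
    (forall x, x \in s -> P x) ->
  exists C, prime_chain (pset P) (size s) C.
Proof.
move=> [_ reg] Pp sP.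
suff cl i Q : (i <= size s)%N -> pprime Q -> (forall x, x \in take i s -> Q x) ->
    exists C, prime_chain (pset Q) i C.
  by apply: cl => // x; rewrite take_size; exact: sP.
elim: i Q => [|i IH] Q si Qp sQ.
  by exists (fun=> (pset Q)); split=> // j _; exact: pprime_prime.
have Qi : pideal Q by case: Qp.
have [|Q' [Q'p JQ' Q'Q nQ's]] := prime_below (pideal_gen (mem (take i s))) Qp _ (reg i si).
  move=> x; apply: ideal_gen_min => // y yt; apply: sQ.
  by rewrite (take_nth 0 si) mem_rcons inE yt orbT.
have [|C [Cp Cs Ce]] := IH Q' (ltnW si) Q'p.
  by move=> x xs; apply: JQ'; exact: mem_ideal_gen.
exists (fun j => if (j <= i)%N then C j else (pset Q)); split.
- by move=> j _; case: ifP => ji; [exact: Cp|exact: pprime_prime].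
- move=> j; rewrite ltnS => ji; have [->|ne] := eqVneq j i; last first.
    have jl : (j < i)%N by rewrite ltn_neqAle ne.
    by rewrite /= ji jl; exact: Cs.
  rewrite /= leqnn ltnn; split=> [x|sub].
    by rewrite Ce => /asboolP/Q'Q Qx; apply/asboolP.
  apply: nQ's; apply/(asboolP (Q' s`_i)); rewrite -[`[<_>]]/(s`_i \in pset Q') -Ce; apply: sub.
  by apply/asboolP; apply: sQ; rewrite (take_nth 0 si) mem_rcons mem_head.
by rewrite /= ltnn.
Qed.

End Noetherian.

(** * The algebra generated by x, T and the T / lam i *)

Section Evaluation.
Variables (K : fieldType) (n k : nat).
Local Notation D := {mpoly K[k.+1]}.
Local Notation S := {mpoly D[n]}.
Implicit Types (P : 'M[K]_k) (lam : 'I_n -> 'rV[K]_k) (p a b : S) (Z : pred 'I_n).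

Variables (F : fieldType) (iota : {rmorphism D -> F}).

Definition frac_T : F := iota 'X_ord0.

(* 'X_i is evaluated at T / lam i.  A deleted hyperplane is encoded by lam i = 0,
   where T / 0 = 0, so that 'X_i then acts as zero. *)
Definition ev P lam : S -> F :=
  mev (iota \o endo P) (fun i => frac_T / iota (lf (lam i))).

HB.instance Definition _ P lam := GRing.RMorphism.copy (ev P lam)
  (mev (iota \o endo P) (fun i => frac_T / iota (lf (lam i)))).

Lemma evC P lam c : ev P lam c%:MP = iota (endo P c).
Proof. exact: mevC. Qed.

Lemma evX P lam i : ev P lam 'X_i = frac_T / iota (lf (lam i)).
Proof. by rewrite /ev mevX. Qed.

Lemma evX0 P lam : ev P lam ('X_ord0)%:MP = frac_T.
Proof. by rewrite evC endoX0. Qed.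

Lemma ev_lf P lam v : ev P lam (lf v)%:MP = iota (lf (v *m P)).
Proof. by rewrite evC endo_lf. Qed.

Lemma ev_scal P lam c : ev P lam c%:MP%:MP = iota c%:MP.
Proof. by rewrite evC endoC. Qed.

Lemma frac_lf0 : iota (lf (0 : 'rV_k)) = 0.
Proof. by rewrite lf0 rmorph0. Qed.

Hypothesis iota_inj : injective iota.

Lemma iota_eq0 d : (iota d == 0) = (d == 0).
Proof. by rewrite -(rmorph0 iota) (inj_eq iota_inj). Qed.

Lemma frac_T_neq0 : frac_T != 0.
Proof.
rewrite iota_eq0; apply/negP => /eqP/(congr1 (mcoeff U_(ord0))).
by rewrite mcoeffX eqxx mcoeff0 => /eqP; rewrite oner_eq0.
Qed.

Lemma frac_lf_eq0 (v : 'rV[K]_k) : (iota (lf v) == 0) = (v == 0).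
Proof. by rewrite iota_eq0 lf_eq0. Qed.

(** Evaluation is compatible with the substitution [s] as long as no nonzero form is sent to zero,
    for then no denominator vanishes. *)
Lemma ev_spec P lam (s : 'M[K]_k) p : (forall i, lam i != 0 -> lam i *m s != 0) ->
  spec iota (iota \o endo s)%FUN
    (ev P lam p) (ev (P *m s) (fun i => lam i *m s) p).
Proof.
move=> ls.
have -> : ev (P *m s) (fun i => lam i *m s) p =
    mev ((iota \o endo s) \o endo P)
         (fun i => frac_T / iota (lf (lam i *m s))) p.
  move: p; apply: (mpoly_rmorph_ext (f := ev (P *m s) (fun i => lam i *m s))) => [c|i].
    by rewrite /= evC mevC /= endo_comp.
  by rewrite /= evX mevX.
apply: (mev_spec iota_inj) => i.
have := @spec_div _ _ _ iota (iota \o endo s)%FUN 'X_ord0 (lf (lam i)).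
rewrite /= endoX0 endo_lf; apply; rewrite lf_eq0 => li.
by rewrite frac_lf_eq0 ls.
Qed.

(** The ideal presenting the algebra generated by T, the rows of [P] and the [T / lam i]. *)
Definition jker P lam p : Prop := ev P lam p = 0.

Lemma jker_spec P lam (s : 'M[K]_k) p : (forall i, lam i != 0 -> lam i *m s != 0) ->
  jker P lam p -> jker (P *m s) (fun i => lam i *m s) p.
Proof. by move=> ls jp; have := ev_spec P p ls; rewrite jp; exact: (spec0 iota_inj). Qed.

Lemma jker_ideal P lam : pideal (jker P lam).
Proof.
split; first by split=> [|x y jx jy]; rewrite /jker ?rmorph0 // rmorphB /= jx jy subr0.
by move=> a x jx; rewrite /jker rmorphM /= jx mulr0.
Qed.

(** By [ev_tau], killing the variables of [Z] amounts to deleting the forms of [Z]; an element fixed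
    by [tau Z] has the same value before and after the deletion. *)
Definition tau Z : S -> S := mev (@mpolyC n D) (fun i => if Z i then 0 else 'X_i).
HB.instance Definition _ Z := GRing.RMorphism.copy (tau Z)
  (mev (@mpolyC n D) (fun i => if Z i then 0 else 'X_i)).

Definition lam_zero Z lam i := if Z i then 0 else lam i.

Lemma tauC Z c : tau Z c%:MP = c%:MP. Proof. exact: mevC. Qed.
Lemma tauX Z i : tau Z 'X_i = if Z i then 0 else 'X_i.
Proof. by rewrite /tau mevX. Qed.

Lemma ev_tau P lam Z p : ev P lam (tau Z p) = ev P (lam_zero Z lam) p.
Proof.
move: p; apply: (mpoly_rmorph_ext (f := (ev P lam \o tau Z)%FUN)) => [c|i].
  by rewrite /= tauC !evC.
rewrite /= tauX evX /lam_zero; case: ifP => _; last by rewrite evX.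
by rewrite rmorph0 frac_lf0 invr0 mulr0.
Qed.

Lemma tau_idem Z p : tau Z (tau Z p) = tau Z p.
Proof.
move: p; apply: (mpoly_rmorph_ext (f := (tau Z \o tau Z)%FUN)) => [c|i].
  by rewrite /= !tauC.
by rewrite /= tauX; case: ifP => Zi; rewrite ?rmorph0 // tauX Zi.
Qed.

(** If the forms indexed by [Z] are proportional, their variables are multiples of a single one;
    [kap] collects them into powers of the polynomial variable ['X]. *)
Definition kap Z (c : 'I_n -> K) : S -> {poly S} :=
  mev (@polyC S \o @mpolyC n D)
    (fun i => if Z i then ((c i)%:MP%:MP)%:P * 'X else ('X_i)%:P).
HB.instance Definition _ Z c := GRing.RMorphism.copy (kap Z c)
  (mev (@polyC S \o @mpolyC n D)
    (fun i => if Z i then ((c i)%:MP%:MP)%:P * 'X else ('X_i)%:P)).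

Lemma kapC Z c d : kap Z c d%:MP = (d%:MP)%:P. Proof. exact: mevC. Qed.
Lemma kapX Z c i :
  kap Z c 'X_i = if Z i then ((c i)%:MP%:MP)%:P * 'X else ('X_i)%:P.
Proof. by rewrite /kap mevX. Qed.

Lemma tau_kap Z c p : map_poly (tau Z) (kap Z c p) = kap Z c p.
Proof.
move: p; apply: (mpoly_rmorph_ext (f := (map_poly (tau Z) \o kap Z c)%FUN)) => [d|i].
  by rewrite /= kapC map_polyC /= tauC.
rewrite /= kapX; case: ifP => Zi; last by rewrite map_polyC /= tauX Zi.
by rewrite rmorphM /= map_polyX map_polyC /= tauC.
Qed.

Lemma tau_coef_kap Z c p i : tau Z (kap Z c p)`_i = (kap Z c p)`_i.
Proof. by rewrite -coef_map /= tau_kap. Qed.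

Lemma kap_mod (I : S -> Prop) Z c r p : pideal I ->
    (forall i, Z i -> I ('X_i - (c i)%:MP%:MP * 'X_r)) ->
  I (p - (kap Z c p).['X_r]).
Proof.
move=> Ii IZ; elim/mpoly_ring_ind: p => [d|i|p q Ip Iq|p q Ip Iq].
- by rewrite kapC hornerC subrr; exact: Ii.1.1.
- rewrite kapX; case: ifP => Zi; last by rewrite hornerC subrr; exact: Ii.1.1.
  by rewrite hornerM hornerC hornerX; exact: IZ.
- by rewrite (rmorphD (kap Z c)) hornerD; exact: (pideal_congD Ii Ip Iq).
by rewrite (rmorphM (kap Z c)) hornerM; exact: (pideal_congM Ii Ip Iq).
Qed.

(* For a linear relation sum_(i in C) alpha i * lam i = 0 this is the element of
   the Orlik-Terao ideal obtained by clearing denominators in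
   sum_(i in C) alpha i / 'X_i = 0. *)
Definition dep (C : {set 'I_n}) (alpha : 'I_n -> K) : S :=
  \sum_(i in C) (alpha i)%:MP%:MP * \prod_(j in C :\ i) 'X_j.

(** Since ['X_i] stands for [T / lam i], replacing it by T in the product of all variables is the
    same as multiplying that product by [lam i]. *)
Lemma dep_ev P lam (C : {set 'I_n}) alpha : (forall i, i \in C -> lam i != 0) ->
  ev P lam (dep C alpha) * frac_T
  = iota (lf (\sum_(i in C) alpha i *: lam i)) * ev P lam (\prod_(i in C) 'X_i).
Proof.
move=> Cl; rewrite /dep rmorph_sum mulr_suml lf_sum rmorph_sum mulr_suml.
apply: eq_bigr => i iC; rewrite rmorphM /= ev_scal lfZ rmorphM -!mulrA.
congr (_ * _); rewrite (big_setD1 i iC) /= rmorphM /= evX.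
by rewrite mulrC !mulrA [_ * frac_T]mulrC mulfK // frac_lf_eq0 Cl.
Qed.

Lemma dep_scale C alpha e :
  dep C (fun i => e * alpha i) = e%:MP%:MP * dep C alpha.
Proof. by rewrite /dep mulr_sumr; apply: eq_bigr => i _; rewrite !mpolyCM mulrA. Qed.

(** Expansion along [r]: a relation expressing [lam r] by the forms of [C] rewrites
    ['X_r * dep C alpha] as a product without ['X_r]. *)
Lemma dep_cons (C : {set 'I_n}) alpha r : r \notin C ->
  dep (r |: C) (fun i => if i == r then -1 else alpha i)
  = 'X_r * dep C alpha - \prod_(i in C) 'X_i.
Proof.
move=> rC; rewrite /dep big_setU1 //= eqxx addrC; congr (_ + _).
  rewrite mulr_sumr; apply: eq_bigr => i iC.
  have ir : i != r by apply: contraNneq rC => <-.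
  rewrite (negPf ir) mulrCA; congr (_ * _).
  have -> : (r |: C) :\ i = r |: (C :\ i).
    by apply/setP => j; rewrite !inE; case: eqP => // ->; case: eqP => // jr; rewrite jr eqxx in ir.
  by rewrite big_setU1 //= !inE (negPf rC) andbF.
rewrite setU1K // !mpolyCN !mpolyC1; by rewrite mulN1r.
Qed.

End Evaluation.

(** * Partial fractions: vanishing on a hyperplane *)

Section Residue.
Variables (K : fieldType) (n k : nat).
Local Notation D := {mpoly K[k.+1]}.
Local Notation S := {mpoly D[n]}.
Implicit Types (P Q : 'M[K]_k) (lam : 'I_n -> 'rV[K]_k) (Z : pred 'I_n).

Variables (F : fieldType) (iota : {rmorphism D -> F}).
Hypothesis iota_inj : injective iota.

(** For [E = Q *m pinvmx Q] the linear forms [x - endo E x] are killed by [Q], so [p] and [endo E p]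
    agree modulo [I] for every [p]; and [endo E] factors through [endo Q]. *)
Lemma endo_ker Q (I : D -> Prop) : pideal I ->
  (forall v, v *m Q = 0 -> I (lf v)) -> forall a, endo Q a = 0 -> I a.
Proof.
move=> Ii IQ a a0; set E := Q *m pinvmx Q.
have QE : E *m Q = Q by rewrite /E mulmxKpV.
have EE (p : D) : I (p - endo E p).
  elim/mpoly_ring_ind: p => [c|i|p q Ip Iq|p q Ip Iq].
  - by rewrite endoC subrr; exact: Ii.1.1.
  - have [->|[j ->]] := ord0_or_lift i; first by rewrite endoX0 subrr; exact: Ii.1.1.
    rewrite endoX -lf_delta -lfB; apply: IQ.
    by rewrite mulmxBl -row_mul QE -rowE subrr.
  - by rewrite (rmorphD (endo E)); exact: (pideal_congD Ii Ip Iq).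
  by rewrite (rmorphM (endo E)); exact: (pideal_congM Ii Ip Iq).
apply: (pideal_sub Ii (EE a)).
by rewrite -endo_comp a0 rmorph0; exact: Ii.1.1.
Qed.

(** Without live forms every ['X_i] lies in [I], and what remains is a polynomial in x and T that
    vanishes on [h = 0]. *)
Lemma residue_base P lam (h : 'rV[K]_k) (I : S -> Prop) :
    (forall i, lam i = 0) -> (h <= P)%MS -> pideal I ->
    (forall a, jker iota P lam a -> I a) ->
    (forall c, c *m P = h -> I (lf c)%:MP) ->
    (forall a, I a -> jker iota (P *m cokermx h) (fun i => lam i *m cokermx h) a) ->
  forall a, jker iota (P *m cokermx h) (fun i => lam i *m cokermx h) a -> I a.
Proof.
move=> lam0 hP Ii JI Ih IJ a Ja.
have XI i : I 'X_i.
  by apply: JI; rewrite /jker evX lam0 frac_lf0 invr0 mulr0.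
have [c Ic] : exists c : D, I (a - c%:MP).
  elim/mpoly_ring_ind: (a) => [c|i|p q [c Ip] [d Iq]|p q [c Ip] [d Iq]].
  - by exists c; rewrite subrr; exact: Ii.1.1.
  - by exists 0; rewrite mpolyC0 subr0.
  - by exists (c + d); rewrite mpolyCD; exact: (pideal_congD Ii Ip Iq).
  by exists (c * d); rewrite mpolyCM; exact: (pideal_congM Ii Ip Iq).
apply: (pideal_sub Ii Ic).
have Jc : jker iota (P *m cokermx h) (fun i => lam i *m cokermx h) c%:MP.
  have := IJ _ Ic; rewrite /jker rmorphB /= Ja sub0r => /eqP.
  by rewrite oppr_eq0 => /eqP.
have {Jc} c0 : endo (P *m cokermx h) c = 0.
  by move: Jc; rewrite /jker evC => /eqP; rewrite (iota_eq0 iota_inj) => /eqP.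
pose I' (x : D) := I x%:MP.
have I'i : pideal I'.
  split; first split; rewrite /I'.
  - by rewrite mpolyC0; exact: Ii.1.1.
  - by move=> x y Ix Iy; rewrite mpolyCB; exact: (Ii.1.2 _ _ Ix Iy).
  by move=> x y Iy; rewrite mpolyCM; exact: (Ii.2 _ _ Iy).
(* On the space given by [P] the form [v] is a multiple of [h]; subtracting that multiple of a lift
   [w] of [h] leaves a form killed by [P]. *)
apply: (endo_ker I'i _ c0) => v; rewrite mulmxA => /eqP; rewrite -submxE.
move=> /sub_rVP[e vPe]; have /submxP[w hw] := hP.
have J0 : I (lf (v - e *: w))%:MP.
  by apply: JI; rewrite /jker ev_lf mulmxBl -scalemxAl -hw vPe subrr frac_lf0.
move: J0; rewrite lfB mpolyCB => J0; apply: (pideal_sub Ii J0).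
by rewrite lfZ mpolyCM; apply: Ii.2; exact: Ih.
Qed.

Lemma tau_dep Z (C : {set 'I_n}) alpha : (forall i, i \in C -> ~~ Z i) ->
  tau Z (dep k C alpha : S) = dep k C alpha.
Proof.
move=> CZ; rewrite /dep rmorph_sum; apply: eq_bigr => i iC.
rewrite rmorphM /= tauC; congr (_ * _); rewrite rmorph_prod; apply: eq_bigr => j.
by rewrite !inE => /andP[_ /CZ/negPf]; rewrite /= tauX => ->.
Qed.

Lemma tau_prod Z (C : {set 'I_n}) : (forall i, i \in C -> ~~ Z i) ->
  tau Z (\prod_(i in C) 'X_i : S) = \prod_(i in C) 'X_i.
Proof.
move=> CZ; rewrite rmorph_prod; apply: eq_bigr => j.
by move=> /CZ/negPf; rewrite /= tauX => ->.
Qed.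

Lemma dep_pair i r (alpha : 'I_n -> K) : i != r ->
  dep k [set i; r] alpha =
  (alpha r)%:MP%:MP * 'X_i + (alpha i)%:MP%:MP * 'X_r :> S.
Proof.
move=> ir; have nr : i \notin [set r] by rewrite inE.
rewrite /dep big_setU1 //= big_set1 setU1K // big_set1 addrC; congr (_ + _).
have -> : [set i; r] :\ r = [set i].
  by apply/setP => j; rewrite !inE; case: eqP => [->|_] /=; rewrite ?orbF // eq_sym (negPf ir).
by rewrite big_set1.
Qed.

Lemma dep_jker P lam (C : {set 'I_n}) alpha : (forall i, i \in C -> lam i != 0) ->
  \sum_(i in C) alpha i *: lam i = 0 -> jker iota P lam (dep k C alpha).
Proof.
move=> Cl al0; have := dep_ev iota_inj P alpha Cl; rewrite al0 frac_lf0 mul0r => /eqP.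
by rewrite mulf_eq0 (negPf (frac_T_neq0 iota_inj)) orbF => /eqP.
Qed.

End Residue.

Section Residue.
Variables (K : fieldType) (n k : nat).
Local Notation D := {mpoly K[k.+1]}.
Local Notation S := {mpoly D[n]}.
Implicit Types (P : 'M[K]_k) (lam : 'I_n -> 'rV[K]_k) (Z : pred 'I_n).

Variables (F : fieldType) (iota : {rmorphism D -> F}).
Hypothesis iota_inj : injective iota.

Definition lam_mul lam (s : 'M[K]_k) i := lam i *m s.
Definition nlive lam := #|[pred i | lam i != 0]|.

Lemma lam_mul_zero Z lam s : lam_mul (lam_zero Z lam) s = lam_zero Z (lam_mul lam s).
Proof. by apply/funext => i; rewrite /lam_mul /lam_zero; case: ifP => // _; rewrite mul0mx. Qed.

Lemma lam_zero_live Z lam i : lam_zero Z lam i != 0 -> ~~ Z i /\ lam_zero Z lam i = lam i.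
Proof. by rewrite /lam_zero; case: (Z i); rewrite ?eqxx. Qed.

Lemma nlive_zero Z lam r : Z r -> lam r != 0 -> (nlive (lam_zero Z lam) < nlive lam)%N.
Proof.
move=> Zr lr; apply: proper_card; apply/properP; split.
  by apply/subsetP => i; rewrite !inE => /[dup] /lam_zero_live[_ ->].
by exists r; rewrite !inE // /lam_zero Zr eqxx.
Qed.

Lemma nlive_mul lam s : (nlive (lam_mul lam s) <= nlive lam)%N.
Proof.
apply: subset_leq_card; apply/subsetP => i; rewrite !inE.
by apply: contraNneq; rewrite /lam_mul => ->; rewrite mul0mx.
Qed.

Lemma lam_zero_sub P Z lam i : (forall i, (lam i <= P)%MS) -> (lam_zero Z lam i <= P)%MS.
Proof. by move=> lP; rewrite /lam_zero; case: (Z i) => //; exact: sub0mx. Qed.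

Lemma pideal_tau Z (I : S -> Prop) : pideal I -> pideal (fun a => I (tau Z a)).
Proof.
move=> Ii; split; first split.
- by rewrite rmorph0; exact: Ii.1.1.
- by move=> x y Ix Iy; rewrite (rmorphB (tau Z)); exact: (Ii.1.2 _ _ Ix Iy).
by move=> x y Iy; rewrite (rmorphM (tau Z)); exact: (Ii.2 _ _ Iy).
Qed.

Lemma jker_tau P lam Z p : jker iota P lam (tau Z p) <-> jker iota P (lam_zero Z lam) p.
Proof. by rewrite /jker ev_tau. Qed.

Section TopCoef.
Variables (P : 'M[K]_k) (lam : 'I_n -> 'rV[K]_k) (Z : pred 'I_n) (r : 'I_n) (s : 'M[K]_k).
Hypotheses (lamr : lam r != 0) (lP : (lam r <= P)%MS) (lrs : lam r *m s = 0).
Hypothesis (Zs : forall i, lam i != 0 -> ~~ Z i -> lam i *m s != 0).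

(* Multiplying q('X_r) by the m-th power of the form lam r, whose quotient into T
   is 'X_r, only the top coefficient survives on lam r = 0. *)
Lemma top_coef_residue (q : {poly S}) m : (size q <= m.+1)%N ->
    (forall i, tau Z q`_i = q`_i) -> jker iota P lam q.['X_r] ->
  jker iota (P *m s) (lam_mul (lam_zero Z lam) s) q`_m.
Proof.
move=> szq tq Jq; have [w lw] := submxP lP.
pose c : S := (lf w)%:MP; pose t : S := ('X_ord0)%:MP.
pose p : S := \sum_(i < m.+1) q`_i * (t ^+ i * c ^+ (m - i)).
have tp : tau Z p = p.
  rewrite /p rmorph_sum; apply: eq_bigr => i _.
  by rewrite rmorphM rmorphM !rmorphXn /= /t /c !tauC tq.
have [hF hFE] : exists hF : F, hF = iota (lf (lam r)) by eexists.
have h0 : hF != 0 by rewrite hFE (frac_lf_eq0 iota_inj).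
have Jp : jker iota P (lam_zero Z lam) p.
  rewrite -jker_tau tp; apply: (mulfI (x := hF ^- m)).
    by rewrite invr_eq0 expf_neq0.
  rewrite mulr0 -Jq (horner_coef_wide _ szq) /p !rmorph_sum mulr_sumr.
  apply: eq_bigr => i _; rewrite !rmorphM !rmorphXn /= ev_lf evX0 evX -lw -hFE.
  have hm : hF ^+ m = hF ^+ i * hF ^+ (m - i).
    by rewrite -exprD subnKC // -ltnS.
  rewrite hm expr_div_n invfM mulrCA; congr (_ * _).
  by rewrite mulrACA mulVf ?expf_neq0 // mulr1 mulrC.
have ls i : lam_zero Z lam i != 0 -> lam_zero Z lam i *m s != 0.
  by move=> /[dup] /lam_zero_live[Zi ->] li; apply: Zs.
have := jker_spec iota_inj ls Jp; rewrite /jker /p rmorph_sum big_ord_recr /= big1 => [|i _].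
  rewrite add0r subnn expr0 mulr1 rmorphM rmorphXn /= evX0 => /eqP.
  by rewrite mulf_eq0 expf_eq0 (negPf (frac_T_neq0 iota_inj)) andbF orbF => /eqP.
rewrite rmorphM rmorphM !rmorphXn /= ev_lf mulmxA -lw lrs frac_lf0 expr0n.
by rewrite subn_eq0 leqNgt ltn_ord !mulr0.
Qed.

End TopCoef.

(** The leading term, ['X_r] to the power [m + 1] times a coefficient, is replaced by the power [m]
    times some [tau Z b]. The degree drops until a constant polynomial, free of the variables of
    [Z], remains. *)
Lemma poly_descent Z r (I J : S -> Prop) : pideal I ->
    (forall x y, I (x - y) -> J x -> J y) ->
    (forall (q : {poly S}) m, (size q <= m.+2)%N -> (forall i, tau Z q`_i = q`_i) ->
       J q.['X_r] -> exists b, I ('X_r * q`_m.+1 - tau Z b)) ->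
  forall q : {poly S}, (forall i, tau Z q`_i = q`_i) -> J q.['X_r] ->
  exists a, [/\ tau Z a = a, I (q.['X_r] - a) & J a].
Proof.
move=> Ii IJ top q; have [m] := ubnP (size q).
elim: m q => // m IHm q szq tq Jq; rewrite ltnS in szq.
case: m => [|[|m]] in IHm szq *.
- move: szq Jq; rewrite leqn0 size_poly_eq0 => /eqP->; rewrite horner0 => J0.
  by exists 0; rewrite rmorph0 subr0; split=> //; exact: Ii.1.1.
- move: Jq; rewrite (size1_polyC szq) hornerC => Jq.
  by exists q`_0; split=> //; rewrite subrr; exact: Ii.1.1.
have [b Ib] := top q m szq tq Jq.
pose q1 := q - q`_m.+1 *: 'X^(m.+1) + tau Z b *: 'X^m.
have q1q : q.['X_r] - q1.['X_r] = 'X_r ^+ m * ('X_r * q`_m.+1 - tau Z b).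
  rewrite /q1 2!hornerD hornerN !hornerZ !hornerXn.
  exact: horner_swap.
have Iq1 : I (q.['X_r] - q1.['X_r]) by rewrite q1q; exact: Ii.2.
have [||a [ta Ia Ja]] := IHm q1 _ _ (IJ _ _ Iq1 Jq).
- rewrite ltnS; apply/leq_sizeP => i mi; rewrite /q1 !coefD coefN !coefZ !coefXn.
  have [->|im] := eqVneq i m.+1; first by rewrite mulr1 subrr gtn_eqF // mulr0 addr0.
  rewrite gtn_eqF // mulr0 subr0 mulr0 addr0 nth_default //.
  by apply: leq_trans szq _; rewrite ltn_neqAle eq_sym im.
- move=> i; rewrite /q1 !coefD coefN !coefZ !coefXn (rmorphD (tau Z)) (rmorphB (tau Z)).
  by rewrite !(rmorphM (tau Z)) /= !tq tau_idem !rmorph_nat.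
exists a; split=> //.
have -> : q.['X_r] - a = (q.['X_r] - q1.['X_r]) + (q1.['X_r] - a) by rewrite addrA subrK.
exact: subgroupD Ii.1 Iq1 Ia.
Qed.

(* Partial fractions: an element vanishing on h = 0 is written as a polynomial in
   'X_r whose coefficients do not involve the forms that become proportional to
   lam r on h = 0.  Its leading coefficient vanishes on the codimension two space
   h = lam r = 0, and this is described by induction inside h = 0. *)
Theorem residue_ideal P lam (h : 'rV[K]_k) (I : S -> Prop) :
    (h <= P)%MS -> (forall i, (lam i <= P)%MS) ->
    (forall i, lam i != 0 -> lam i *m cokermx h != 0) -> pideal I ->
    (forall a, jker iota P lam a -> I a) ->
    (forall a, I a -> jker iota (P *m cokermx h) (lam_mul lam (cokermx h)) a) ->
    (forall c, c *m P = h -> I (lf c)%:MP) ->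
    (forall (C : {set 'I_n}) alpha, (forall i, i \in C -> lam i != 0) ->
       \sum_(i in C) alpha i *: lam i = h -> I (dep k C alpha)) ->
  forall a, jker iota (P *m cokermx h) (lam_mul lam (cokermx h)) a -> I a.
Proof.
have [N] := ubnP (nlive lam); elim: N P lam h I => // N IH P lam h I leN hP lP ls Ii JI IJ Ih Idep.
have [r lr|nolive] := pickP [pred i | lam i != 0]; last first.
  apply: (residue_base iota_inj) => // i; have /= := nolive i; by case: eqP.
rewrite /= in lr; set s := cokermx h in ls IJ *.
pose Z : pred 'I_n := [pred i | (lam i *m s <= lam r *m s)%MS].
have Zr : Z r by rewrite /Z /=.
have lrs := ls r lr.
have dex i : exists d, Z i -> lam i *m s = d *: (lam r *m s).
  by case Zi : (Z i); [have /sub_rVP[e ->] := Zi; exists e|exists 0].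
have [d Hd] := choice dex.
(* A combination of forms that vanishes on [h = 0] is a multiple of [h]: multiple zero gives a
   genuine relation, otherwise rescaling gives one of the assumed elements of [I]. *)
have depI (C : {set 'I_n}) alpha : (forall i, i \in C -> lam i != 0) ->
    (\sum_(i in C) alpha i *: lam i) *m s = 0 -> I (dep k C alpha).
  move=> Cl /eqP; rewrite -submxE => /sub_rVP[e se].
  have [e0|e0] := eqVneq e 0; first by apply/JI/(dep_jker iota_inj); rewrite // se e0 scale0r.
  have -> : alpha = (fun i => e * (e^-1 * alpha i)).
    by apply/funext => i; rewrite mulVKf.
  rewrite dep_scale; apply: (Ii.2); apply: Idep => //.
  transitivity (e^-1 *: \sum_(i in C) alpha i *: lam i).
    by rewrite scaler_sumr; apply: eq_bigr => i _; rewrite scalerA.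
  by rewrite se scalerA mulVf // scale1r.
(* Live forms that are proportional on [h = 0] satisfy a two-term relation there, so their variables
   are proportional modulo [I]. *)
have XI i : Z i -> I ('X_i - ((d i)^-1)%:MP%:MP * 'X_r).
  move=> Zi; have [li|li] := eqVneq (lam i) 0.
    have /eqP := Hd i Zi; rewrite li mul0mx eq_sym scaler_eq0 (negPf lrs) orbF => /eqP->.
    rewrite invr0 !mpolyC0 mul0r subr0.
    by apply: JI; rewrite /jker evX li frac_lf0 invr0 mulr0.
  have [ir|ir] := eqVneq i r.
    have dr1 : d r = 1.
      have := Hd r Zr; rewrite -{1}[lam r *m s]scale1r => /eqP.
      by rewrite -subr_eq0 -scalerBl scaler_eq0 (negPf lrs) orbF subr_eq0 => /eqP.
    by rewrite ir dr1 invr1 !mpolyC1 mul1r subrr; exact: Ii.1.1.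
  have := @depI [set i; r] (fun j => if j == i then - (d i)^-1 else 1).
  rewrite (dep_pair _ _ ir) eqxx eq_sym (negPf ir) !mpolyC1 mul1r !mpolyCN mulNr; apply.
    by move=> j; rewrite !inE => /orP[] /eqP->.
  rewrite big_setU1 ?inE //= big_set1 eqxx eq_sym (negPf ir) scale1r mulmxDl -scalemxAl.
  rewrite (Hd i Zi) scalerA mulNr mulVf ?scaleN1r ?addNr //.
  by apply: contraNneq (ls i li) => d0; rewrite (Hd i Zi) d0 scale0r.
set lam' := lam_zero Z lam.
have lN : (nlive lam' < N)%N by exact: leq_trans (nlive_zero Zr lr) leN.
have Cl (C : {set 'I_n}) : (forall i, i \in C -> lam' i != 0) ->
    (forall i, i \in C -> ~~ Z i) /\ (forall i, i \in C -> lam' i = lam i).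
  by move=> Cl; split=> i /Cl/lam_zero_live[].
have lP' i : (lam' i <= P)%MS by apply: lam_zero_sub.
have ls' i : lam' i != 0 -> lam' i *m s != 0.
  by move=> /[dup] /lam_zero_live[_]; rewrite -/lam' => -> /ls.
(* Induction for the forms outside [Z], with the pullback of [I] along [tau Z]. *)
have IHtau a : jker iota (P *m s) (lam_mul lam' s) a -> I (tau Z a).
  apply: (IH P lam' h _ lN hP lP' ls' (pideal_tau Z Ii)).
  - by move=> b Jb; apply/JI/jker_tau.
  - by move=> b /IJ/jker_tau; rewrite /lam' lam_mul_zero.
  - by move=> c cP; rewrite tauC; exact: Ih.
  move=> C alpha CL sh; have [CZ Clam] := Cl C CL.
  rewrite (tau_dep _ _ CZ); apply: Idep => [i iC|]; first by rewrite -Clam // CL.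
  by rewrite -sh; apply: eq_bigr => i iC; rewrite Clam.
have [w lw] := submxP (lP r).
(* The elements whose product with ['X_r] can be rewritten modulo [I] without the variables of [Z].
   Induction inside [h = 0], with [lam r] in the role of [h], shows that vanishing on
   [h = lam r = 0] suffices. *)
pose I2 (b : S) := exists b', I ('X_r * tau Z b - tau Z b').
have IH2 b : jker iota (P *m s *m cokermx (lam r *m s))
    (lam_mul (lam_mul lam' s) (cokermx (lam r *m s))) b -> I2 b.
  have cards : (nlive (lam_mul lam' s) < N)%N.
    exact: leq_ltn_trans (nlive_mul lam' s) lN.
  have hP2 : (lam r *m s <= P *m s)%MS by exact: submxMr.
  have lP2 i : (lam_mul lam' s i <= P *m s)%MS by exact: submxMr.
  have ls2 i : lam_mul lam' s i != 0 -> lam_mul lam' s i *m cokermx (lam r *m s) != 0.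
    rewrite /lam_mul -submxE => li.
    have li' : lam' i != 0 by apply: contraNneq li => ->; rewrite mul0mx.
    by have [] := lam_zero_live li'; rewrite -/lam' => Zi ->.
  have I2i : pideal I2.
    split; first split.
    - by exists 0; rewrite !rmorph0 mulr0 subr0; exact: Ii.1.1.
    - move=> x y [x' Ix] [y' Iy]; exists (x' - y').
      rewrite !(rmorphB (tau Z)); exact: (pideal_linB Ii Ix Iy).
    move=> x y [y' Iy]; exists (x * y'); rewrite !(rmorphM (tau Z)).
    exact: (pideal_linM _ Ii Iy).
  apply: (IH (P *m s) (lam_mul lam' s) (lam r *m s) I2 cards hP2 lP2 ls2 I2i).
  - move=> x Jx; exists 0; rewrite rmorph0 subr0; apply: Ii.2; exact: IHtau.
  (* On [h = 0] the rewriting says [(T / lam r) x = x'], that is [T x = lam r x']; setting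
     [lam r = 0] leaves [T x = 0]. *)
  - move=> x [x' /IJ]; have evt y : ev iota (P *m s) (lam_mul lam s) (tau Z y)
        = ev iota (P *m s) (lam_mul lam' s) y by rewrite ev_tau -lam_mul_zero.
    rewrite /jker.
    rewrite (rmorphB (ev _ _ _)).
    rewrite (rmorphM (ev _ _ _)).
    rewrite /=.
    rewrite evX.
    rewrite (evt x).
    rewrite (evt x').
    move=> /eqP; rewrite subr_eq0 => /eqP xx'.
    pose u : S := ('X_ord0)%:MP * x - (lf w)%:MP * x'.
    have Ju : jker iota (P *m s) (lam_mul lam' s) u.
      rewrite /jker /u rmorphB !rmorphM /= evX0 ev_lf mulmxA -lw -xx'.
      rewrite [iota _ * (_ / _ * _)]mulrA [X in _ - X * _]mulrC divfK ?subrr //.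
      by rewrite (frac_lf_eq0 iota_inj).
    have := jker_spec iota_inj ls2 Ju; rewrite /jker /u rmorphB !rmorphM /= evX0 ev_lf.
    rewrite (mulmxA w (P *m s)) (mulmxA w P) -lw mulmx_coker frac_lf0 mul0r subr0 => /eqP.
    by rewrite mulf_eq0 (negPf (frac_T_neq0 iota_inj)) => /eqP.
  (* A form that agrees with [lam r] on [h = 0] has product T with ['X_r] modulo [I]. *)
  - move=> c cP; exists ('X_ord0)%:MP; rewrite !tauC.
    have : (c *m P - lam r) *m s == 0 by rewrite mulmxBl -mulmxA cP subrr.
    rewrite -submxE => /sub_rVP[e ce]; have [wh wP] := submxP hP.
    have J0 : I ('X_r * (lf (c - e *: wh))%:MP - ('X_ord0)%:MP).
      apply: JI; rewrite /jker rmorphB rmorphM /= evX0 ev_lf evX mulmxBl -scalemxAl -wP -ce.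
      by rewrite subKr divfK ?subrr // (frac_lf_eq0 iota_inj).
    move: J0; rewrite lfB lfZ mpolyCB mpolyCM => J0.
    apply: (pideal_sub Ii (q := e%:MP%:MP * 'X_r * (lf wh)%:MP)); last first.
      by apply: Ii.2; apply: Ih.
    move: J0; set y := (lf wh)%:MP; set z := (lf c)%:MP => J0.
    have -> : 'X_r * z - ('X_ord0)%:MP - e%:MP%:MP * 'X_r * y
      = 'X_r * (z - e%:MP%:MP * y) - ('X_ord0)%:MP by exact: cone_linB.
    exact: J0.
  (* By [dep_cons] the required difference is the element of a relation between [lam r] and the
     forms of [C] that holds on [h = 0]. *)
  move=> C alpha CL sh.
  have CL' i : i \in C -> lam' i != 0.
    by move=> /CL; apply: contraNneq; rewrite /lam_mul => ->; rewrite mul0mx.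
  have [CZ Clam] := Cl C CL'; exists (\prod_(i in C) 'X_i).
  rewrite (tau_dep _ _ CZ) (tau_prod _ _ CZ).
  have rC : r \notin C by apply/negP => /CZ; rewrite Zr.
  rewrite -(dep_cons _ _ rC); apply: depI.
    by move=> i; rewrite !inE => /orP[/eqP->//|iC]; rewrite -Clam // CL'.
  rewrite big_setU1 //= eqxx scaleN1r mulmxDl mulNmx -sh addrC.
  apply/eqP; rewrite subr_eq0 mulmx_suml; apply/eqP; apply: eq_bigr => i iC.
  rewrite (_ : (i == r) = false); last by apply: contraNF rC => /eqP <-.
  by rewrite -scalemxAl /lam_mul Clam.
have IJ' x y : I (x - y) -> jker iota (P *m s) (lam_mul lam s) x ->
    jker iota (P *m s) (lam_mul lam s) y.
  by move=> /IJ; rewrite /jker rmorphB /= => /eqP; rewrite subr_eq0 => /eqP->.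
have top (q : {poly S}) m : (size q <= m.+2)%N -> (forall i, tau Z q`_i = q`_i) ->
    jker iota (P *m s) (lam_mul lam s) q.['X_r] ->
    exists b, I ('X_r * q`_m.+1 - tau Z b).
  move=> szq tq Jq.
  have /IH2[b] : jker iota (P *m s *m cokermx (lam r *m s))
      (lam_mul (lam_mul lam' s) (cokermx (lam r *m s))) q`_m.+1.
    rewrite /lam' lam_mul_zero.
    apply: (top_coef_residue lrs _ (mulmx_coker _) _ szq tq Jq).
      exact: submxMr.
    by move=> i _; rewrite -submxE.
  by rewrite tq; exists b.
move=> a Ja; have Ika := kap_mod a Ii XI.
have [b [tb Ib Jb]] := poly_descent Ii IJ' top (tau_coef_kap Z _ a) (IJ' _ _ Ika Ja).
apply: (pideal_sub Ii Ika); apply: (pideal_sub Ii Ib); rewrite -tb; apply: IHtau.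
by rewrite /lam' lam_mul_zero; apply/jker_tau; rewrite tb.
Qed.

End Residue.

(** * Deletion of a hyperplane *)

Section Deletion.
Variables (K : fieldType) (n k : nat).
Local Notation D := {mpoly K[k.+1]}.
Local Notation S := {mpoly D[n]}.
Implicit Types (P : 'M[K]_k) (lam : 'I_n -> 'rV[K]_k) (Z : pred 'I_n).
Variables (F : fieldType) (iota : {rmorphism D -> F}).
Hypothesis iota_inj : injective iota.

Lemma jkerB P lam x y : jker iota P lam (x - y) <-> ev iota P lam x = ev iota P lam y.
Proof.
rewrite /jker rmorphB /=; split=> [/eqP|->]; last by rewrite subrr.
by rewrite subr_eq0 => /eqP.
Qed.

(** The [a] for which [T a / h] stays in the algebra form an ideal, so [residue_ideal] reduces the
    claim to generators: for [h] the quotient is T, for a relation summing to [h] it is the product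
    of the variables involved. *)
Lemma residue_div P lam (h w : 'rV[K]_k) : w *m P = h -> (forall i, (lam i <= P)%MS) ->
    (forall i, lam i != 0 -> lam i *m cokermx h != 0) ->
  forall a, jker iota (P *m cokermx h) (lam_mul lam (cokermx h)) a ->
    exists b, ev iota P lam b * iota (lf h) = frac_T iota * ev iota P lam a.
Proof.
move=> wP lP ls; have hP : (h <= P)%MS by rewrite -wP submxMl.
apply: (residue_ideal iota_inj hP lP ls).
- split; first split.
  + by exists 0; rewrite !rmorph0 mul0r mulr0.
  + by move=> x y [b bx] [c cy]; exists (b - c); rewrite !rmorphB /= mulrBl bx cy mulrBr.
  by move=> a x [b bx]; exists (a * b); rewrite !rmorphM /= -mulrA bx mulrCA.
- by move=> a ja; exists 0; rewrite ja rmorph0 mul0r mulr0.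
- move=> a [b ba]; pose u : S := b * (lf w)%:MP - ('X_ord0)%:MP * a.
  have ju : jker iota P lam u.
    by rewrite /u; apply/jkerB; rewrite !rmorphM /= ev_lf evX0 wP.
  have := jker_spec iota_inj ls ju; rewrite /u => /jkerB.
  rewrite !rmorphM /= ev_lf evX0 (mulmxA w) wP mulmx_coker frac_lf0 mulr0 => /esym/eqP.
  by rewrite mulf_eq0 (negPf (frac_T_neq0 iota_inj)) => /eqP.
- by move=> c cP; exists ('X_ord0)%:MP; rewrite evX0 ev_lf cP.
move=> C alpha Cl <-; exists (\prod_(i in C) 'X_i).
by rewrite mulrC -(dep_ev iota_inj P alpha Cl) mulrC.
Qed.

Section Step.
Variables (P : 'M[K]_k) (lam : 'I_n -> 'rV[K]_k) (r : 'I_n).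
Hypotheses (lP : forall i, (lam i <= P)%MS) (lr : lam r != 0).
(** [J], [J0] and [Js] present A, A' and A'', and [I] presents A modulo ['X_r]. As [Z] contains
    every multiple of [h], no nonzero form of [lam'] dies on [h = 0]. *)
Let h := lam r.
Let s := cokermx h.
Let Z : pred 'I_n := [pred i | (lam i <= h)%MS].
Let lam' := lam_zero Z lam.
Let J := jker iota P lam.
Let J0 := jker iota P lam'.
Let Js := jker iota (P *m s) (lam_mul lam' s).
Let I (b : S) := exists2 u, True & J (b - 'X_r * u).

Let Zr : Z r. Proof. by rewrite /Z /=. Qed.
Let h0 : iota (lf h) != 0. Proof. by rewrite (frac_lf_eq0 iota_inj). Qed.
Let T0 : frac_T iota != 0. Proof. exact: frac_T_neq0. Qed.

Let ls i : lam' i != 0 -> lam' i *m s != 0.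
Proof. by move=> /lam_zero_live[Zi e]; rewrite -submxE /lam' e. Qed.

Let lP' i : (lam' i <= P)%MS. Proof. exact: lam_zero_sub. Qed.

Let ratio : exists c : 'I_n -> K, forall i, Z i -> J ('X_i - (c i)%:MP%:MP * 'X_r).
Proof.
have dex i : exists d, Z i -> lam i = d *: h.
  by case Zi : (Z i); [have /sub_rVP[e ->] := Zi; exists e|exists 0].
have [d Hd] := choice dex; exists (fun i => (d i)^-1) => i Zi.
apply/jkerB; rewrite rmorphM /= ev_scal !evX (Hd i Zi) lfZ rmorphM /= invfM.
rewrite -/h mulrCA; congr (_ * _).
have [->|d0] := eqVneq (d i) 0; first by rewrite invr0 mpolyC0 rmorph0 invr0.
apply: (mulfI (x := iota (d i)%:MP)); first by rewrite (iota_eq0 iota_inj) mpolyC_eq0.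
by rewrite mulfV ?(iota_eq0 iota_inj) ?mpolyC_eq0 // -rmorphM -mpolyCM mulfV // mpolyC1 rmorph1.
Qed.

Lemma ev_tau_lam' p : ev iota P lam' (tau Z p) = ev iota P lam' p.
Proof. by rewrite -ev_tau tau_idem ev_tau. Qed.

(** Multiplication by [T / h] carries [Js / J0] into [I / J0]: the result lies in A' by
    [residue_div], and seen in A it is a multiple of ['X_r]. *)
Lemma deletion_fwd (w : 'rV_k) x : w *m P = h -> Js x ->
  exists2 y, I y & J0 (('X_ord0)%:MP * x - (lf w)%:MP * y).
Proof.
move=> wP Jx; have [b eb] := residue_div wP lP' ls Jx.
exists (tau Z b).
  exists (tau Z x) => //; apply/jkerB; rewrite rmorphM /= evX !ev_tau -/lam' -/h.
  by apply: (mulIf h0); rewrite eb mulrAC divfK.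
apply/jkerB; rewrite !rmorphM /= evX0 ev_lf wP ev_tau_lam' -eb; exact: mulrC.
Qed.

Lemma kap_horner0 c y : (kap Z c y : {poly S}).[0] = tau Z y.
Proof.
elim/mpoly_ring_ind: y => [d|i|p q ep eq|p q ep eq].
- by rewrite kapC tauC hornerC.
- by rewrite kapX tauX; case: ifP => _; rewrite ?hornerM ?hornerX ?hornerC ?mulr0.
- by rewrite (rmorphD (kap Z c)) (rmorphD (tau Z)) hornerD ep eq.
by rewrite (rmorphM (kap Z c)) (rmorphM (tau Z)) hornerM ep eq.
Qed.

Lemma horner_sub0 (G : comNzRingType) (q : {poly G}) x : exists v, q.[x] - q.[0] = x * v.
Proof.
elim/poly_ind: q => [|q c [v qv]]; first by exists 0; rewrite !horner0 subr0 mulr0.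
by exists q.[x]; rewrite !hornerMXaddC mulr0 add0r addrK mulrC.
Qed.

(** In A, [y] is a polynomial in ['X_r] whose constant term [tau Z y] is the value of [y] in A',
    here zero; the other terms are divisible by ['X_r]. *)
Lemma deletion_sub y : J0 y -> I y.
Proof.
move=> J0y; have [c Jc] := ratio; have Ji : pideal J by exact: jker_ideal.
have [v yv] := horner_sub0 (kap Z c y) 'X_r; rewrite kap_horner0 in yv.
exists v => //; apply/jkerB; rewrite -yv rmorphB /= ev_tau -/lam' J0y subr0.
by apply/jkerB; exact: (kap_mod (c := c) (r := r) y Ji Jc).
Qed.

(** Surjectivity of multiplication by [T / h]: an element of A' that is ['X_r] times an element of A
    is ['X_r] times an element of A' vanishing on [h = 0]. The cofactor, a polynomial in ['X_r], is
    brought down to a constant by the descent. *)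
Lemma deletion_bwd (w : 'rV_k) y : w *m P = h -> I y ->
  exists2 x, Js x & J0 ((lf w)%:MP * y - ('X_ord0)%:MP * x).
Proof.
move=> wP [u _ Jyu]; have [c Jc] := ratio.
have Ji : pideal J by exact: jker_ideal.
have [v yv] := horner_sub0 (kap Z c y) 'X_r; rewrite kap_horner0 in yv.
have Jy : J (tau Z y - 'X_r * (kap Z c (u - v)).['X_r]).
  have Jk := kap_mod (c := c) (r := r) y Ji Jc.
  have Jk2 := kap_mod (c := c) (r := r) (u - v) Ji Jc.
  apply/jkerB; move: Jk Jk2 Jyu => /jkerB Jk /jkerB Jk2 /jkerB Jyu.
  move/(congr1 (ev iota P lam)): yv; rewrite rmorphB rmorphM /= -Jk => /eqP.
  rewrite subr_eq addrC -subr_eq => /eqP <-.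
  by rewrite rmorphM /= -Jk2 rmorphB /= Jyu rmorphM /= mulrBr.
pose Q (x : S) := J (tau Z y - 'X_r * x).
have JQ a b : J (a - b) -> Q a -> Q b.
  by rewrite /Q => /jkerB ab /jkerB ta; apply/jkerB; rewrite ta !rmorphM /= ab.
have top (q : {poly S}) m : (size q <= m.+1)%N -> (forall i, tau Z q`_i = q`_i) ->
    Q q.['X_r] -> Js q`_m.
  (* [q1] vanishes at ['X_r] in A and has the top coefficient of [q] one degree higher, so
     [top_coef_residue] applies to it. *)
  move=> szq tq Qq; pose q1 := q * 'X - (tau Z y)%:P.
  have q1m : q1`_m.+1 = q`_m by rewrite /q1 coefB coefMX coefC subr0.
  rewrite -q1m; apply: (top_coef_residue iota_inj lr (lP r)) => //.
  - exact: mulmx_coker.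
  - by move=> i li Zi; rewrite -submxE.
  - apply/leq_sizeP => i mi; rewrite /q1 coefB coefMX coefC.
    by case: i mi => //= i mi; rewrite subr0 nth_default //; exact: leq_trans szq _.
  - move=> i; rewrite /q1 coefB coefMX coefC; case: i => [|i] /=.
      by rewrite (rmorphB (tau Z)) /= tau_idem rmorph0.
    by rewrite subr0 tq.
  move: Qq; rewrite /q1 hornerD hornerN hornerC hornerM hornerX => /jkerB Qq.
  by apply/jkerB; rewrite Qq mulrC.
have desc (q : {poly S}) m : (size q <= m.+2)%N -> (forall i, tau Z q`_i = q`_i) ->
    Q q.['X_r] -> exists b, J ('X_r * q`_m.+1 - tau Z b).
  move=> szq tq Qq; have [b eb] := residue_div wP lP' ls (top q m.+1 szq tq Qq).
  exists b; apply/jkerB; rewrite rmorphM /= evX ev_tau -/lam' -/h.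
  by apply: (mulIf h0); rewrite eb mulrAC divfK // -[in LHS]tq ev_tau.
have [x [tx _ Qx]] := poly_descent Ji JQ desc (tau_coef_kap Z c (u - v)) Jy.
exists x.
  have := top x%:P 0%N; rewrite hornerC coefC /=; apply=> //; first exact: size_polyC_leq1.
  by move=> i; rewrite coefC; case: eqP => _; rewrite ?rmorph0.
apply/jkerB; rewrite !rmorphM /= ev_lf wP evX0.
move/jkerB: Qx; rewrite rmorphM /= evX !ev_tau -/lam' -/h => ->.
by rewrite -[in LHS]tx ev_tau mulrA [iota _ * _]mulrC divfK.
Qed.

End Step.
End Deletion.

(** * Maximal ideals avoiding all the T / lam i *)

Section KoszulImage.
Variables (S G : comNzRingType) (e : {rmorphism S -> G}).

Lemma kd_map (m : seq S) z s : kd (map e m) (fun t => e (z t)) s = e (kd m z s).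
Proof.
elim: m z s => [|a m IH] z [|[] s] //=; rewrite ?rmorph0 //.
by rewrite (IH (fun t => z (true :: t))) rmorphB rmorphM.
Qed.

Lemma kvan_image (m : seq S) d :
    kvan (map e m) d (fun x => exists p, x = e p) (fun x => x = 0) ->
  kvan m d (fun=> True) (fun p => e p = 0).
Proof.
move=> V i z id _ dz ez.
have [|||w [Aw dw ew]] := V i (fun s => e (z s)) id.
- by move=> s _; exists (z s).
- move=> s; rewrite size_map => szs nz; apply: dz => // z0.
  by apply: nz; rewrite z0 rmorph0.
- by move=> s; rewrite size_map kd_map => szs; exact: ez.
have [s szs|s szs ci||w' [_ dw' ew']] :=
    @kcochain_choice S m (fun s u => w s = e u) (fun=> True) (i - 1).
- by have [|u ->] := Aw s; rewrite ?size_map //; exists u.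
- rewrite rmorph0; have [//|/eqP w0] := eqVneq (w s) 0.
  by case: ci; apply: dw; rewrite ?size_map.
- by split.
exists w'; split=> // s szs; rewrite rmorphB -kd_map.
rewrite -[RHS](ew s) ?size_map //; congr (_ - _).
by apply: kd_ext => [t|]; rewrite size_map // => szt; rewrite ew'.
Qed.

End KoszulImage.

(** * Localization at an element invertible modulo the Koszul ideal *)

Section KoszulLocalize.
Variables (G : comNzRingType) (m : seq G) (N : G -> Prop) (s t : G).
Hypotheses (Nr : subring N) (mN : forall a, a \in m -> N a) (Ns : N s) (Nt : N t).

Definition locs : G -> Prop := fun x => exists e, N (s ^+ e * x).

Let NX a e : N a -> N (a ^+ e).
Proof.
have [_ N1 NM] := Nr; move=> Na; elim: e => [|e IH]; first by rewrite expr0.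
by rewrite exprS; exact: NM.
Qed.

Lemma subring_locs : subring locs.
Proof.
have [Nsub N1 NM] := Nr; split; first split.
- by exists 0%N; rewrite mulr0; exact: Nsub.1.
- move=> x y [e Nx] [f Ny]; exists (e + f)%N.
  have -> : s ^+ (e + f) * (x - y) = s ^+ f * (s ^+ e * x) - s ^+ e * (s ^+ f * y).
    by rewrite exprD; ring.
  by apply: Nsub.2; apply: (NM) => //; exact: NX.
- by exists 0%N; rewrite mulr1 expr0.
move=> x y [e Nx] [f Ny]; exists (e + f)%N.
have -> : s ^+ (e + f) * (x * y) = (s ^+ e * x) * (s ^+ f * y) by rewrite exprD; ring.
exact: NM.
Qed.

Hypothesis st : exists2 e : 'I_(size m) -> G,
  forall j, N (e j) & 1 - s * t = \sum_j e j * m`_j.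

Lemma unit_expr_mod f : exists2 e : 'I_(size m) -> G,
  forall j, N (e j) & 1 - s ^+ f * t ^+ f = \sum_j e j * m`_j.
Proof.
have [[Nsub N1 NM] [e Ne ste]] := (Nr, st).
elim: f => [|f [e' Ne' ste']].
  exists (fun=> 0) => [j|]; first exact: Nsub.1.
  by rewrite !expr0 mulr1 subrr big1 // => j _; rewrite mul0r.
exists (fun j => e j + s * t * e' j) => [j|].
  apply: subgroupD => //; apply: (NM) => //; exact: NM.
have -> : 1 - s ^+ f.+1 * t ^+ f.+1 = (1 - s * t) + s * t * (1 - s ^+ f * t ^+ f).
  by rewrite !exprS; ring.
rewrite ste ste' mulr_sumr -big_split; apply: eq_bigr => j _ /=; ring.
Qed.

(** A primitive over the localization has a common denominator [s^E], there being finitely many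
    masks. By homotopy [1 - s^E t^E] times [z] is a coboundary over [N], and the two primitives
    combine to one of [z]. *)
Lemma kvan_locs d : kvan m d locs (fun x => x = 0) -> kvan m d N (fun x => x = 0).
Proof.
have [Nsub N1 NM] := Nr.
move=> V i z id Nz dz z0.
have [u szu|w [lw dw zw]] := V i z id _ dz z0.
  by exists 0%N; rewrite expr0 mul1r; exact: Nz.
have fex u : exists f, size u = size m -> N (s ^+ f * w u).
  have [szu|szu] := eqVneq (size u) (size m); last by exists 0%N => /eqP; rewrite (negPf szu).
  by have [f Nf] := lw u szu; exists f.
have [f Nf] := choice fex.
pose E := (\sum_(u : (size m).-tuple bool) f u)%N.
have NE u : size u = size m -> N (s ^+ E * w u).
  move=> /[dup] szu /eqP szu'; have -> : E = (E - f u + f u)%N.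
    by rewrite subnK // /E (bigD1 (Tuple szu')) //= leq_addr.
  by rewrite exprD -mulrA; apply: (NM); [exact: NX|exact: Nf].
have [e Ne ste] := unit_expr_mod E.
have z0s : subgroup (fun x : G => x = 0) by split=> // x y -> ->; rewrite subr0.
have [|w' [Nw' dw' zw']] := koszul_homotopy (y := 1 - s ^+ E * t ^+ E) Nsub z0s _ Nz dz z0.
  by exists e; split=> // j x; [exact: NM|move=> ->; rewrite mulr0].
exists (fun u => w' u - (- t ^+ E) * (s ^+ E * w u)); split.
- move=> u szu; apply: Nsub.2; first exact: Nw'.
  by apply: (NM); [apply: subgroupN => //; exact: NX|exact: NE].
- by apply: kdegB => //; apply: kdegZ; exact: kdegZ.
move=> u szu; rewrite kdB !kdZ.
have /eqP := zw u szu; rewrite subr_eq0 => /eqP <-.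
have /eqP := zw' u szu; rewrite subr_eq0 => /eqP <-; ring.
Qed.

End KoszulLocalize.

(** * Coordinates on the localized algebra *)

Section AdaptedCoordinates.
Variables (K : fieldType) (k r1 r2 : nat) (B1 : 'M[K]_(r1, k)) (B2 : 'M[K]_(r2, k)).
Local Notation D := {mpoly K[k.+1]}.
Local Notation D' := {mpoly K[(r1 + r2).+1]}.
Variables (F : fieldType) (iota : {rmorphism D -> F}).
Hypothesis iota_inj : injective iota.
Hypothesis B_free : row_free (col_mx B1 B2).

(** The coordinates are T, the quotients by T of a first block of forms, later a basis of the span
    of the [lam i], and a complementary block of forms left as they are. *)
Definition zvar (i : 'I_(r1 + r2).+1) : F :=
  if unlift ord0 i is Some j then
    match split j with
    | inl a => iota (lf (row a B1)) / frac_T iota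
    | inr b => iota (lf (row b B2))
    end
  else frac_T iota.

Definition phi : D' -> F := mev (iota \o @mpolyC _ K)%FUN zvar.
HB.instance Definition _ := GRing.RMorphism.copy phi (mev (iota \o @mpolyC _ K)%FUN zvar).

Lemma phiC c : phi c%:MP = iota c%:MP. Proof. exact: mevC. Qed.
Lemma phiX i : phi 'X_i = zvar i. Proof. exact: mevX. Qed.

Lemma phi_lf (v : 'rV_(r1 + r2)) :
  phi (lf v) = iota (lf (lsubmx v *m B1)) / frac_T iota + iota (lf (rsubmx v *m B2)).
Proof.
rewrite {1}/lf rmorph_sum big_split_ord /=; congr (_ + _).
  rewrite mulmx_sum_row lf_sum rmorph_sum mulr_suml; apply: eq_bigr => a _.
  rewrite rmorphM /= phiC phiX /zvar liftK (unsplitK (inl a)).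
  by rewrite lfZ rmorphM mulrA mxE.
rewrite mulmx_sum_row lf_sum rmorph_sum; apply: eq_bigr => b _.
rewrite rmorphM /= phiC phiX /zvar liftK (unsplitK (inr b)).
by rewrite lfZ rmorphM mxE.
Qed.

Section Injective.
Variables (L : fieldType) (jj : {rmorphism D' -> L}).
Hypothesis jj_inj : injective jj.

Definition twist_var (i : 'I_(r1 + r2).+1) : D' :=
  if unlift ord0 i is Some j then
    if split j is inl _ then 'X_i * 'X_ord0 else 'X_i
  else 'X_ord0.
Definition twist : D' -> D' := mev (@mpolyC _ K) twist_var.
HB.instance Definition _ := GRing.RMorphism.copy twist (mev (@mpolyC _ K) twist_var).

Lemma twistC c : twist c%:MP = c%:MP. Proof. exact: mevC. Qed.
Lemma twistX i : twist 'X_i = twist_var i. Proof. exact: mevX. Qed.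

(** The twist multiplies the first block of variables by T and so undoes the division in [zvar].
    Composed with the substitution by a right inverse of the basis matrix it gives a map [g] whose
    extension to fractions sends [phi p] back to [p]. *)
Lemma phi_inj_aux : injective phi.
Proof.
pose Q := pinvmx (col_mx B1 B2).
have QE : col_mx B1 B2 *m Q = 1%:M by exact: mulmxVp.
pose g : {rmorphism D -> L} := (jj \o (twist \o endo Q))%FUN.
have gX0 : g 'X_ord0 = jj 'X_ord0.
  by rewrite /g /= endoX0 twistX /twist_var unlift_none.
have X00 : jj 'X_ord0 != 0.
  rewrite -(rmorph0 jj) (inj_eq jj_inj); apply/negP => /eqP/(congr1 (mcoeff U_(ord0))).
  by rewrite mcoeffX eqxx mcoeff0 => /eqP; rewrite oner_eq0.
have glf j : g (lf (row j (col_mx B1 B2))) = jj (twist_var (lift ord0 j)).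
  by rewrite /g /= endo_lf -row_mul QE row1 lf_delta twistX.
have sp p : spec iota g (phi p) (jj p).
  elim/mpoly_ring_ind: p => [c|i|p q sp sq|p q sp sq].
  - have := spec_iota iota g c%:MP; rewrite phiC.
    by rewrite (_ : g c%:MP = jj c%:MP) // /g /= endoC twistC.
  - rewrite phiX /zvar; case: (unliftP ord0 i) => [j ->|->]; last first.
      by rewrite -gX0; exact: spec_iota.
    case sj: (split j) => [a|b].
      have := @spec_div _ _ _ iota g (lf (row a B1)) 'X_ord0.
      rewrite gX0 => /(_ (fun _ => X00)).
      have -> : g (lf (row a B1)) = jj 'X_(lift ord0 j) * jj 'X_ord0.
        have := glf (lshift r2 a); rewrite rowKu => ->; rewrite /twist_var liftK.
        by rewrite (unsplitK (inl a)) rmorphM -(splitK j) sj.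
      by rewrite mulfK.
    have := spec_iota iota g (lf (row b B2)).
    have -> : g (lf (row b B2)) = jj 'X_(lift ord0 j); last by [].
    have := glf (rshift r1 b); rewrite rowKd => ->; rewrite /twist_var liftK.
    by rewrite (unsplitK (inr b)) -(splitK j) sj.
  - by rewrite !rmorphD; exact: (specD iota_inj sp sq).
  by rewrite !rmorphM; exact: (specM sp sq).
move=> x y xy; apply/eqP; rewrite -subr_eq0; apply/eqP; apply: jj_inj; rewrite rmorph0.
apply: (spec0 iota_inj (g := g)).
by have := sp (x - y); rewrite rmorphB /= xy subrr.
Qed.

End Injective.

Lemma phi_inj : injective phi.
Proof.
apply: (phi_inj_aux (L := {fraction D'}) (jj := @FracField.tofrac D')).
by move=> x y /eqP; rewrite tofrac_eq => /eqP.
Qed.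

End AdaptedCoordinates.

Section Units.
Variables (K : fieldType) (n k : nat).
Local Notation D := {mpoly K[k.+1]}.
Local Notation S := {mpoly D[n]}.
Variables (F : fieldType) (iota : {rmorphism D -> F}).
Hypothesis iota_inj : injective iota.
Variables (P : 'M[K]_k) (lam : 'I_n -> 'rV[K]_k) (ms : seq S).
Hypothesis lP : forall i, (lam i <= P)%MS.

Let M : {pred S} := ideal_gen (mem ms).
Hypothesis Minv : forall a, a \notin M -> exists b, 1 - a * b \in M.
Hypothesis Malg : forall a : S, exists2 q : {poly K}, q != 0 &
  (map_poly (fun c => c%:MP%:MP) q).[a] \in M.
Hypothesis Mlive : forall i, lam i != 0 -> 'X_i \notin M.

Local Notation e := (ev iota P lam).
Let T := frac_T iota.
Let T0 : T != 0. Proof. exact: frac_T_neq0. Qed.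

Definition live_prod : S := \prod_(i | lam i != 0) 'X_i.
Let sS := live_prod.
Let s := e sS.
Let Aim : F -> Prop := fun x => exists p, x = e p.
Let As := locs Aim s.

Let Aim_ring : subring Aim.
Proof.
split; first split.
- by exists 0; rewrite rmorph0.
- by move=> x y [p ->] [q ->]; exists (p - q); rewrite rmorphB.
- by exists 1; rewrite rmorph1.
by move=> x y [p ->] [q ->]; exists (p * q); rewrite rmorphM.
Qed.

Let Aim_s : Aim s. Proof. by exists sS. Qed.

Let As_ring : subring As. Proof. exact: subring_locs. Qed.

Let Aim_As x : Aim x -> As x.
Proof. by move=> Ax; exists 0%N; rewrite expr0 mul1r. Qed.

Let live_prod_inv : exists t, 1 - sS * t \in M.
Proof.
rewrite /sS /live_prod; apply: (big_ind (fun x => exists t, 1 - x * t \in M)).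
- by exists 1; rewrite mulr1 subrr; exact: ideal_gen0.
- move=> x y [t xt] [u yu]; exists (t * u).
  have -> : 1 - x * y * (t * u) = (1 - x * t) + x * t * (1 - y * u) by exact: unit_mulB.
  by apply: ideal_genD => //; exact: ideal_genM.
by move=> i li; apply: Minv; exact: Mlive.
Qed.

Let image_ideal x : x \in M -> exists2 c : 'I_(size (map e ms)) -> F,
  forall j, Aim (c j) & e x = \sum_j c j * (map e ms)`_j.
Proof.
move=> /ideal_gen_nth[c ->].
have szm : size (map e ms) = size ms by rewrite size_map.
exists (fun j => e (c (cast_ord szm j))); first by move=> j; exists (c (cast_ord szm j)).
rewrite rmorph_sum (reindex (cast_ord szm)) /=; last first.
  by exists (cast_ord (esym szm)) => j _; rewrite ?cast_ordK ?cast_ordKV.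
apply: eq_bigr => j _; rewrite rmorphM /=; congr (_ * _).
by rewrite (nth_map 0) // -szm.
Qed.

(** The extension of [M] to the localized algebra. *)
Let MA (x : F) := exists2 c : 'I_(size (map e ms)) -> F,
  forall j, As (c j) & x = \sum_j c j * (map e ms)`_j.

Let MA_add x y : MA x -> MA y -> MA (x + y).
Proof.
move=> [c Ac ->] [d Ad ->]; exists (fun j => c j + d j).
  by have [As1 _ _] := As_ring; move=> j; exact: subgroupD.
by rewrite -big_split; apply: eq_bigr => j _; rewrite mulrDl.
Qed.

Let MA_mul x y : As x -> MA y -> MA (x * y).
Proof.
move=> Ax [d Ad ->]; exists (fun j => x * d j).
  by have [_ _ As3] := As_ring; move=> j; exact: As3.
by rewrite mulr_sumr; apply: eq_bigr => j _; rewrite mulrA.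
Qed.

Let scal (c : K) : F := iota c%:MP.

Let As_scal c : As (scal c).
Proof. by apply: Aim_As; exists c%:MP%:MP; rewrite ev_scal. Qed.

Let horner_congr (q : {poly K}) x y : As x -> As y -> MA (x - y) ->
  As (map_poly scal q).[x] /\ MA ((map_poly scal q).[x] - (map_poly scal q).[y]).
Proof.
have scalE : scal = (iota \o @mpolyC _ K)%FUN by [].
have [As1 _ As3] := As_ring.
move=> Ax Ay Mxy; elim/poly_ind: q => [|q c [IH1 IH2]].
  rewrite scalE map_poly0 !horner0 subrr; split; first exact: As1.1.
  exists (fun=> 0); first by move=> j; exact: As1.1.
  by rewrite big1 // => j _; rewrite mul0r.
rewrite scalE rmorphD rmorphM /= map_polyX map_polyC -scalE !hornerMXaddC; split.
  by apply: (subgroupD As1); [exact: As3|exact: As_scal].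
have -> : forall a b c : F, a * x + c - (b * y + c) = y * (a - b) + a * (x - y).
  by move=> a b d; ring.
by apply: MA_add; apply: MA_mul.
Qed.

(** With [t] inverse to the inverted product modulo [M], a fraction [p / s^f] is congruent to
    [p t^f] and inherits its polynomial relation. *)
Let alg_As x : As x -> exists2 q : {poly K}, q != 0 & MA (map_poly scal q).[x].
Proof.
move=> [f [p sp]]; have [t st] := live_prod_inv.
have [||c Ac cE] := @unit_expr_mod F (map e ms) Aim s (e t) Aim_ring Aim_s _ _ f.
- by exists t.
- have [c Ac cE] := image_ideal st; exists c => //.
  by rewrite -cE rmorphB rmorphM rmorph1.
have [q q0 Mq] := Malg (p * t ^+ f); exists q => //.
have [|||Ax Md] := @horner_congr q x (e (p * t ^+ f)).
- by exists f, p.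
- by apply: Aim_As; exists (p * t ^+ f).
- rewrite rmorphM rmorphXn /= -sp.
  have -> : x - s ^+ f * x * e t ^+ f = x * (1 - s ^+ f * e t ^+ f) by ring.
  apply: MA_mul; first by exists f, p.
  by exists c => // j; exact: Aim_As.
rewrite -[_.[x]](subrK (map_poly scal q).[e (p * t ^+ f)]); apply: MA_add => //.
have [d Ad dE] := image_ideal Mq; exists d => [j|]; first exact: Aim_As.
rewrite -dE -horner_map /=; congr (_.[_]).
rewrite -map_poly_comp; apply: eq_map_poly => u /=.
by rewrite ev_scal.
Qed.

Let Lam : 'M[K]_(n, k) := \matrix_i lam i.
Let LamP : (Lam <= P)%MS.
Proof. by apply/row_subP => i; rewrite rowK. Qed.

Let r1 := \rank Lam.
Let r2 := \rank (P :\: Lam)%MS.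
Let B1 : 'M[K]_(r1, k) := row_base Lam.
Let B2 : 'M[K]_(r2, k) := row_base (P :\: Lam)%MS.

Let rank_split : (r1 + r2)%N = \rank P.
Proof. by rewrite -(mxrank_cap_compl P Lam) (capmx_idPr LamP). Qed.

Let PB : (P <= col_mx B1 B2)%MS.
Proof.
rewrite -addsmxE -(addsmx_diff_cap_eq P Lam) addsmx_sub.
apply/andP; split.
  by apply: submx_trans (addsmxSr _ _); rewrite eq_row_base.
by apply: submx_trans (addsmxSl _ _); rewrite eq_row_base capmxSr.
Qed.

Let B_free : row_free (col_mx B1 B2).
Proof.
rewrite /row_free eqn_leq rank_leq_row /=.
by apply: leq_trans (mxrankS PB); rewrite rank_split.
Qed.

Local Notation D' := {mpoly K[(r1 + r2).+1]}.
Local Notation f := (phi B1 B2 iota).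

Let live_coord : exists u : 'I_n -> D', forall i, f (u i) = iota (lf (lam i)) / T.
Proof.
suff ex i : exists u : D', f u = iota (lf (lam i)) / T.
  by have [u uE] := choice ex; exists u.
have : (lam i <= B1)%MS by rewrite eq_row_base -(rowK lam) row_sub.
case/submxP => v ->; exists (lf (row_mx v 0)).
by rewrite phi_lf row_mxKl row_mxKr mul0mx frac_lf0 addr0.
Qed.

Let lf_span v : (v <= P)%MS -> exists a : D', f a = iota (lf v).
Proof.
move=> vP; have /submxP[c ->] := submx_trans vP PB.
exists ('X_ord0 * lf (row_mx (lsubmx c) 0) + lf (row_mx 0 (rsubmx c))).
rewrite rmorphD rmorphM /= !phi_lf phiX /zvar unlift_none !row_mxKl !row_mxKr.
rewrite !mul0mx !frac_lf0 mul0r addr0 add0r mulrC divfK // -rmorphD -lfD.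
by rewrite -{3}[c]hsubmxK mul_row_col.
Qed.

(** Inverting the [T / lam i] adjoins the [lam i / T], which span the first block of coordinates.
    Conversely, each generator of the algebra is a polynomial in the coordinates up to the
    denominator [w], the product of the live [lam i / T], whose value is the inverse of [s]. *)
Let local_chart : exists w : D', f w != 0 /\ As = locz f w (fun=> True).
Proof.
have [u uE] := live_coord; pose w := \prod_(i | lam i != 0) u i.
have ys i : lam i != 0 -> e 'X_i * f (u i) = 1.
  move=> li; rewrite evX uE mulrA divfK ?mulfV // (frac_lf_eq0 iota_inj) //.
have sw : s * f w = 1.
  rewrite /s /sS /live_prod /w !rmorph_prod -big_split /=.
  by apply: big1 => i li; exact: ys.
have s0 : s != 0 by apply/eqP => s0; move: sw; rewrite s0 mul0r => /esym/eqP; rewrite oner_eq0.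
have w0 : f w != 0 by apply/eqP => w0; move: sw; rewrite w0 mulr0 => /esym/eqP; rewrite oner_eq0.
have [Ls L1 LM] := @locz_subring D' F f w.
have [As1 As2 As3] := As_ring.
exists w; split=> //; apply/funext => x; apply/propext; split.
  have fin y : locz f w (fun=> True) (s ^+ y).
    exists y, 1; split=> //; rewrite rmorph1 -exprMn mulrC sw expr1n //.
  have fim (a : D') : locz f w (fun=> True) (f a).
    by exists 0%N, a; rewrite expr0 mul1r.
  have Lp p : locz f w (fun=> True) (e p).
    elim/mpoly_ring_ind: p => [c|i|p q Lp Lq|p q Lp Lq].
    - rewrite evC; elim/mpoly_ring_ind: c => [c|i|p q Lp Lq|p q Lp Lq].
      + by rewrite endoC -(phiC B1 B2); exact: fim.
      + have [->|[j ->]] := ord0_or_lift i.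
          rewrite endoX0; have := fim 'X_ord0; by rewrite phiX /zvar unlift_none.
        by rewrite endoX; have [a <-] := lf_span (row_sub j P); exact: fim.
      + by rewrite !rmorphD; exact: (subgroupD Ls Lp Lq).
      by rewrite !rmorphM; exact: (LM _ _ Lp Lq).
    - have [li|li] := eqVneq (lam i) 0.
        by rewrite evX li frac_lf0 invr0 mulr0; exact: Ls.1.
      exists 1%N, (\prod_(j | (lam j != 0) && (j != i)) u j); split=> //.
      rewrite expr1 /w (bigD1 i li) /= rmorphM mulrAC [f (u i) * _]mulrC ys //.
      by rewrite mul1r.
    - by rewrite rmorphD; exact: (subgroupD Ls Lp Lq).
    by rewrite rmorphM; exact: (LM _ _ Lp Lq).
  move=> [N [p sp]]; have -> : x = f w ^+ N * e p.
    by rewrite -sp mulrA -exprMn [f w * s]mulrC sw expr1n mul1r.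
  by rewrite -rmorphXn; exact: (LM _ _ (fim _) (Lp p)).
have Asu i : As (f (u i)).
  have [li|li] := eqVneq (lam i) 0.
    by rewrite uE li frac_lf0 mul0r; exact: As1.1.
  exists 1%N; exists (\prod_(j | (lam j != 0) && (j != i)) 'X_j).
  rewrite expr1 /s /sS /live_prod (bigD1 i li) /= rmorphM /= mulrAC ys ?mul1r //.
have Asf a : As (f a).
  elim/mpoly_ring_ind: a => [c|i|p q Lp Lq|p q Lp Lq].
  - by rewrite phiC; exact: As_scal.
  - rewrite phiX /zvar; case: (unliftP ord0 i) => [j _|_]; last first.
      by apply: Aim_As; exists ('X_ord0)%:MP; rewrite evX0.
    case: (split j) => [a|b].
      have /submxP[c ->] : (row a B1 <= Lam)%MS.
        by rewrite (submx_trans (row_sub _ _)) // eq_row_base.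
      rewrite mulmx_sum_row lf_sum rmorph_sum mulr_suml.
      apply: subgroup_sum => // i'; rewrite lfZ rmorphM -mulrA rowK -uE.
      by apply: As3; [exact: As_scal|exact: Asu].
    have /submxP[c ->] : (row b B2 <= P)%MS.
      rewrite (submx_trans (row_sub _ _)) // eq_row_base; exact: diffmxSl.
    by apply: Aim_As; exists (lf c)%:MP; rewrite ev_lf.
  - by rewrite rmorphD; exact: (subgroupD As1 Lp Lq).
  by rewrite rmorphM; exact: (As3 _ _ Lp Lq).
move=> [N [a [_ xa]]]; have -> : x = s ^+ N * f a.
  by rewrite -xa mulrA -exprMn sw expr1n mul1r.
apply: As3 => //; apply: Aim_As; exists (sS ^+ N); by rewrite rmorphXn.
Qed.

(** There are [\rank P + 1] coordinates, and for each one some nonzero polynomial in it lies in the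
    extension of [M]; their regularity is that of one-variable polynomials in a polynomial ring. *)
Theorem kvan_units : kvan ms ((\rank P).+1 : int) (fun=> True) (jker iota P lam).
Proof.
apply: kvan_image; have [t st] := live_prod_inv.
have mA a : a \in map e ms -> Aim a by case/mapP => p _ ->; exists p.
apply: (@kvan_locs F (map e ms) Aim s (e t)) => //; first by exists t.
  have [c Ac cE] := image_ideal st; exists c => //.
  by rewrite -cE rmorphB rmorphM rmorph1.
have [w [w0 AsE]] := local_chart.
have As_f a : As (f a) by rewrite AsE; exists 0%N, a; rewrite expr0 mul1r.
have qex (i : 'I_(r1 + r2).+1) : exists q : {poly K}, q != 0 /\ MA (map_poly scal q).[f ('X_i : D')].
  by have [q q0 Mq] := alg_As (As_f 'X_i); exists q.
have [q Hq] := choice qex.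
pose gs := [seq coord_poly (q i) 'X_i | i <- enum 'I_(r1 + r2).+1].
have szgs : size (map f gs) = (\rank P).+1.
  by rewrite /gs 2!size_map size_enum_ord rank_split.
rewrite -szgs; apply: kvan_wreg => //.
- split; first by split=> // x y -> ->; rewrite subr0.
    by move=> x ->; have [[]] := As_ring.
  by move=> x y _ ->; rewrite mulr0.
- by move=> a /mA; exact: Aim_As.
- move=> g /mapP[g' /mapP[i _ ->] ->]; have [_ [c Ac cE]] := Hq i.
  exists c => //; rewrite -cE /coord_poly -horner_map /=; congr (_.[_]).
  by rewrite -map_poly_comp; apply: eq_map_poly => u /=; rewrite phiC.
rewrite -/As AsE -(locz_zero w0); apply: wreg_locz => //; first exact: phi_inj.
  by split; first split=> // x y -> ->; rewrite ?subr0 //; move=> a x ->; rewrite mulr0.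
apply: coord_wreg => //.
- by move=> i; have [] := Hq i.
- exact: enum_uniq.
- by split; first split=> // x y -> ->; rewrite ?subr0 //; move=> a x ->; rewrite mulr0.
by move=> i _ a -> j; rewrite rmorph0 coef0.
Qed.

End Units.

(** * Koszul cohomology of an arrangement *)

Section KoszulArrangement.
Variables (K : fieldType) (n k : nat).
Local Notation D := {mpoly K[k.+1]}.
Local Notation S := {mpoly D[n]}.
Variables (F : fieldType) (iota : {rmorphism D -> F}).
Hypothesis iota_inj : injective iota.
Variable ms : seq S.
Let M : {pred S} := ideal_gen (mem ms).
Hypothesis Minv : forall a, a \notin M -> exists b, 1 - a * b \in M.
Hypothesis Malg : forall a : S, exists2 q : {poly K}, q != 0 &
  (map_poly (fun c => c%:MP%:MP) q).[a] \in M.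

Lemma pideal_submod (G : comNzRingType) (m : seq G) (N : G -> Prop) :
  pideal N -> submod m N.
Proof. by move=> [Ns NM]; split=> // a _ x; exact: NM. Qed.

(** The forms killed by the restriction lie on the line spanned by [h]. *)
Lemma rank_coker (P : 'M[K]_k) (h : 'rV[K]_k) : (\rank P <= (\rank (P *m cokermx h)).+1)%N.
Proof.
rewrite -(mxrank_mul_ker P (cokermx h)) -[(\rank _).+1]addn1 leq_add2l.
apply: leq_trans (rank_leq_row h); apply: mxrankS.
by apply: submx_trans (capmxSr _ _) _; rewrite submxE mulmx_ker.
Qed.

Theorem kvan_arrangement (P : 'M[K]_k) lam : (forall i, (lam i <= P)%MS) ->
  kvan ms ((\rank P).+1 : int) (fun=> True) (jker iota P lam).
Proof.
have [N] := ubnP (nlive lam); elim: N P lam => // N IH P lam; rewrite ltnS => lN lP.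
have [[r /andP[lr XrM]]|noM] := pselect (exists r, (lam r != 0) && ('X_r \in M)); last first.
  apply: kvan_units => // i li; apply/negP => XM; apply: noM; exists i; by rewrite li.
set h := lam r; pose s := cokermx h.
pose Z : pred 'I_n := [pred i | (lam i <= h)%MS].
have Zr : Z r by rewrite /Z /=.
pose lam' := lam_zero Z lam.
have lN' : (nlive lam' < N)%N by exact: leq_trans (nlive_zero Zr lr) lN.
pose J := jker iota P lam; pose J0 := jker iota P lam'.
pose Js := jker iota (P *m s) (lam_mul lam' s).
pose I (b : S) := exists2 u, True & J (b - 'X_r * u).
have lP' i : (lam' i <= P)%MS by apply: lam_zero_sub.
have ls i : lam' i != 0 -> lam' i *m s != 0.
  by move=> /lam_zero_live[Zi ei]; rewrite -submxE /lam' ei.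
have Ji : pideal J by exact: jker_ideal.
have J0i : pideal J0 by exact: jker_ideal.
have Jsi : pideal Js by exact: jker_ideal.
have Ii : pideal I by exact: pideal_quo_mul.
have [w wP] : exists w : 'rV_k, w *m P = h by have /submxP[w hw] := lP r; exists w.
have J0s x : J0 x -> Js x by exact: jker_spec.
have [d dP] : exists d : nat, \rank P = d by eexists.
have V0 : kvan ms (d.+1 : int) (fun=> True) J0 by rewrite -dP; exact: IH.
(* Restriction lowers the rank by at most one, which costs one degree. *)
have Vs : kvan ms (d : int) (fun=> True) Js.
  apply: (@kvan_le _ _ ((\rank (P *m s)).+1 : int)).
    by rewrite lez_nat -dP rank_coker.
  apply: IH => [|i]; first by exact: leq_ltn_trans (nlive_mul lam' s) lN'.
  exact: submxMr.
(* [Js / J0] is Q, the kernel of A' -> A''. *)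
have Vs0 : kvan ms (d.+1 : int) Js J0.
  apply: (kvan_sub (N1 := fun=> True)) => //; try exact: pideal_submod.
  by apply: kvan_le Vs; lia.
have J0I y : J0 y -> I y.
  by exact: deletion_sub.
have h0 : ev iota P lam' (lf w)%:MP != 0 by rewrite ev_lf wP (frac_lf_eq0 iota_inj).
have T0 : ev iota P lam' ('X_ord0)%:MP != 0 by rewrite evX0 (frac_T_neq0 iota_inj).
have reg c : ev iota P lam' c != 0 -> forall x : S, True -> J0 (c * x) -> J0 x.
  move=> c0 x _; rewrite /J0 /jker rmorphM /= => /eqP.
  by rewrite mulf_eq0 (negPf c0) => /eqP.
(* Multiplication by [T / h] identifies Q with [I / J0]. *)
have V0I : kvan ms (d.+1 : int) I J0.
  apply: (@kvan_iso _ _ _ (lf w)%:MP ('X_ord0)%:MP (fun=> True) J0 Js I) => //;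
    try exact: pideal_submod; try exact: (J0i.2); try exact: reg.
  - by move=> x; exact: deletion_fwd.
  by move=> y; exact: deletion_bwd.
(* A modulo ['X_r] is the quotient of A' by [I / J0]. *)
have VI : kvan ms (d : int) (fun=> True) I.
  apply: (kvan_quo (N3 := J0)) => //; try exact: pideal_submod.
    by apply: kvan_le V0; lia.
  by have -> : (d : int) + 1 = (d.+1 : int) by lia.
have -> : ((\rank P).+1 : int) = (d : int) + 1 by rewrite dP; lia.
apply: (@kvan_regularS _ _ _ 'X_r) => //; try exact: pideal_submod.
- have [e ->] := ideal_gen_nth XrM; exists e; split=> // j x; exact: Ji.2.
- move=> x _; rewrite /jker rmorphM /= evX => /eqP.
  rewrite !mulf_eq0 invr_eq0 (negPf (frac_T_neq0 iota_inj)) (frac_lf_eq0 iota_inj).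
  by rewrite (negPf lr) => /eqP.
by move=> x; exact: Ji.2.
Qed.

End KoszulArrangement.

(** * Regular sequences and dimension *)

Section RegularElements.
Variable A : comNzRingType.
Hypothesis nA : noetherian A.
Implicit Types (I M : A -> Prop).

(** If an element [x] avoiding the earlier primes falls into the new one, add an element [z] of [M]
    lying in all the earlier primes but not in the new one. Incomparability supplies the factors of
    [z]. *)
Lemma prime_avoidance (T : eqType) (p : T -> A -> Prop) M (ws : seq T) : pideal M ->
    (forall w, w \in ws -> pprime (p w) /\ exists x, M x /\ ~ p w x) ->
    (forall v w, v \in ws -> w \in ws -> (forall x, p v x -> p w x) -> forall x, p w x -> p v x) ->
  exists x, M x /\ forall w, w \in ws -> ~ p w x.
Proof.
move=> [Ms MM]; elim: ws => [|w ws IH] pw pmax; first by exists 0; split=> //; exact: Ms.1.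
have [||x [Mx nx]] := IH.
- by move=> v vs; apply: pw; rewrite inE vs orbT.
- by move=> u v us vs; apply: pmax; rewrite inE ?us ?vs orbT.
have [px|npx] := pselect (p w x); last first.
  by exists x; split=> // v; rewrite inE => /orP[/eqP->|/nx].
have [[[wi wM] w1 wP] [m [Mm nm]]] := pw w (mem_head _ _).
have [z [Mz nz zin]] : exists z, [/\ M z, ~ p w z & forall v, v \in ws -> p v z].
  have sub : forall v, v \in ws -> exists y, p v y /\ ~ p w y.
    move=> v vs; apply: contrapT => no; apply: (nx v vs).
    apply: (pmax v w) px; rewrite ?inE ?vs ?eqxx ?orbT // => y pvy.
    by apply: contrapT => npwy; apply: no; exists y.
  have pid v : v \in ws -> pideal (p v).
    by move=> vs; have [[]] := pw v (mem_behead (s := w :: ws) vs).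
  elim: (ws) sub pid => [|v vs IHv] sub pid; first by exists m.
  have [||z [Mz nz zin]] := IHv.
  - by move=> u us; apply: sub; rewrite inE us orbT.
  - by move=> u us; apply: pid; rewrite inE us orbT.
  have [y [py npy]] := sub v (mem_head _ _); exists (y * z); split.
  - exact: MM.
  - by case/wP.
  move=> u; rewrite inE => /orP[/eqP->|us].
    by rewrite mulrC; apply: (pid v (mem_head _ _)).2.
  by apply: (pid u (mem_behead (s := v :: vs) us)).2; exact: zin.
exists (x + z); split; first exact: subgroupD.
move=> v; rewrite inE => /orP[/eqP->|vs] pxz.
  apply: nz; have -> : z = (x + z) - x by ring.
  exact: wi.2.
apply: (nx v vs); have -> : x = (x + z) - z by ring.
have [[[vi _] _ _] _] := pw v (mem_behead (s := w :: ws) vs).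
by apply: vi.2 => //; exact: zin.
Qed.

Definition colon I v : A -> Prop := fun a => I (a * v).

Lemma pideal_colon I v : pideal I -> pideal (colon I v).
Proof.
move=> [Is IM]; split; first split; rewrite /colon.
- by rewrite mul0r; exact: Is.1.
- by move=> x y Ix Iy; rewrite mulrBl; exact: Is.2.
by move=> a x Ix; rewrite -mulrA; exact: IM.
Qed.

(** Maximal annihilators of nonzero elements of [A / I] are prime. Each annihilator of a nonzero
    element lies in one of finitely many of these primes, and [M] is contained in none, so prime
    avoidance applies. *)
Lemma regular_element I M : pideal I -> pideal M ->
    (forall v, (forall x, M x -> I (x * v)) -> I v) ->
  exists2 a, M a & forall x, I (a * x) -> I x.
Proof.
move=> Ii Mi ann; have [Is IM] := Ii.
pose assoc v := ~ I v /\ forall u, ~ I u -> (forall a, colon I v a -> colon I u a) ->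
  forall a, colon I u a -> colon I v a.
have above v : ~ I v -> exists u, assoc u /\ forall a, colon I v a -> colon I u a.
  move=> nIv; pose Fam J := exists2 u, ~ I u & J = colon I u.
  have [||J [[u nIu ->] vu umax]] := @noetherian_max A nA Fam (colon I v).
  - by exists v.
  - by move=> J [u _ ->]; exact: pideal_colon.
  exists u; split=> //; split=> // t nIt ut a ta.
  by apply: (umax (colon I t)) => //; exists t.
have assoc_prime v : assoc v -> pprime (colon I v).
  move=> [nIv vmax]; split; first exact: pideal_colon.
    by rewrite /colon mul1r.
  move=> a b; have [|nb] := pselect (colon I v b); first by right.
  rewrite /colon -mulrA => Iabv; left; apply: (vmax (b * v)) => // c.
  by rewrite /colon mulrCA; exact: IM.
(* The ideal generated by [I] and all elements with maximal annihilator; finitely many such elements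
   [vs] generate it modulo [I]. *)
pose U (x : A) := exists vs : seq A, (forall v, v \in vs -> assoc v) /\
  exists2 y, I y & x - y \in ideal_gen (mem vs).
have Ui : pideal U.
  split; first split.
  - by exists [::]; split=> //; exists 0; [exact: Is.1|rewrite subrr; exact: ideal_gen0].
  - move=> x y [vs [va [x' Ix gx]]] [ws [wa [y' Iy gy]]]; exists (vs ++ ws); split.
      by move=> v; rewrite mem_cat => /orP[/va|/wa].
    exists (x' - y'); first exact: Is.2.
    have -> : x - y - (x' - y') = (x - x') + (-1) * (y - y') by ring.
    apply: ideal_genD; last apply: ideal_genM.
      by apply: ideal_gen_subset gx => t tv; rewrite mem_cat tv.
    by apply: ideal_gen_subset gy => t tv; rewrite mem_cat tv orbT.
  move=> a x [vs [va [x' Ix gx]]]; exists vs; split=> //; exists (a * x'); first exact: IM.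
  by rewrite -mulrBr; exact: ideal_genM.
have [s sP] := (noetherianP A).1 nA U Ui.
have [vs [va vgen]] : exists vs : seq A, (forall v, v \in vs -> assoc v) /\
    forall x, x \in s -> exists2 y, I y & x - y \in ideal_gen (mem vs).
  have : forall x, x \in s -> U x by move=> x xs; apply/sP; exact: mem_ideal_gen.
  elim: s {sP} => [|x s IH] sU; first by exists [::].
  have [vs [va vgen]] := IH (fun x xs => sU x (mem_behead (s := _ :: s) xs)).
  have [ws [wa [y Iy wgen]]] := sU x (mem_head _ _); exists (ws ++ vs); split.
    by move=> v; rewrite mem_cat => /orP[/wa|/va].
  move=> z; rewrite inE => /orP[/eqP->|/vgen[t It tgen]]; [exists y => //|exists t => //].
    by apply: ideal_gen_subset wgen => u uw; rewrite mem_cat uw.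
  by apply: ideal_gen_subset tgen => u uw; rewrite mem_cat uw orbT.
(* Otherwise primality gives some [z] killing every element of [vs] but not [w], although [w] is a
   combination of [vs] modulo [I]. *)
have cover w : assoc w -> exists2 v, v \in vs & forall a, colon I w a -> colon I v a.
  move=> aw; have Uw : U w.
    exists [:: w]; split; first by move=> v; rewrite inE => /eqP->.
    by exists 0; [exact: Is.1|rewrite subr0; apply: mem_ideal_gen; exact: mem_head].
  have [y Iy wy] : exists2 y, I y & w - y \in ideal_gen (mem vs).
    move/sP: Uw; apply: (@ideal_gen_min _ _
      (fun x => exists2 y, I y & x - y \in ideal_gen (mem vs))); last exact: vgen.
    split; first split.
    - by exists 0; [exact: Is.1|rewrite subrr; exact: ideal_gen0].
    - move=> x z [x' Ix gx] [z' Iz gz]; exists (x' - z'); first exact: Is.2.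
      have -> : x - z - (x' - z') = (x - x') + (-1) * (z - z') by ring.
      by apply: ideal_genD => //; exact: ideal_genM.
    move=> a x [x' Ix gx]; exists (a * x'); first exact: IM.
    by rewrite -mulrBr; exact: ideal_genM.
  have [wi w1 wP] := assoc_prime w aw.
  apply: contrapT => no.
  have [z zv zw] : exists2 z, (forall v, v \in vs -> I (z * v)) & ~ colon I w z.
    have sub v : v \in vs -> exists2 z, I (z * v) & ~ colon I w z.
      move=> vv; apply: contrapT => noz; apply: no; exists v => //.
      have [nIw _] := aw; have [_ vmax] := va v vv.
      by apply: vmax => // a va'; apply: contrapT => nwa; apply: noz; exists a.
    elim: (vs) sub => [|v us IH] sub; first by exists 1.
    have [|z zv zw] := IH; first by move=> u uu; apply: sub; rewrite inE uu orbT.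
    have [t tv tw] := sub v (mem_head _ _); exists (t * z); last by case/wP.
    move=> u; rewrite inE => /orP[/eqP->|/zv Iu].
      by rewrite mulrAC mulrC; exact: IM.
    by rewrite -mulrA; exact: IM.
  apply: zw; rewrite /colon; have -> : z * w = z * (w - y) + z * y by ring.
  apply: (subgroupD Is); last exact: IM.
  move: wy => /(ideal_gen_min (I := fun x => I (z * x))); apply.
    split; last by move=> a x Ix; rewrite mulrCA; exact: IM.
    split; first by rewrite mulr0; exact: Is.1.
    by move=> x t Ix It; rewrite mulrBr; exact: Is.2.
  by move=> v /zv.
have [||a [Ma na]] := prime_avoidance (p := colon I) (ws := vs) Mi.
- move=> w wv; split; first exact: assoc_prime (va w wv).
  apply: contrapT => no; have [nIw _] := va w wv; apply: nIw; apply: ann => x Mx.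
  by apply: contrapT => nx; apply: no; exists x.
- by move=> v w /va[_ vmax] /va[nIw _] vw; exact: vmax.
exists a => // x Iax; apply: contrapT => nIx.
have [u [au xu]] := above x nIx; have [v vv uv] := cover u au.
by apply: (na v vv); apply: uv; apply: xu.
Qed.

(** An element killed by [M] modulo [I] is a cocycle of degree 0; there are no nonzero coboundaries
    in that degree, so vanishing forces the element into [I]. *)
Lemma kvan_regular_element (ms : seq A) I (d : int) : pideal I -> 0 < d ->
    kvan ms d (fun=> True) I ->
  exists2 a, a \in ideal_gen (mem ms) & forall x, I (a * x) -> I x.
Proof.
move=> Ii d0 V; have Mi := pideal_gen (mem ms).
have kdI (m : seq A) (z : seq bool -> A) s : (forall a t, a \in m -> I (a * z t)) -> I (kd m z s).
  elim: m z s => [|a m IH] z [|b s] //= am; try exact: Ii.1.1.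
  have am' c : forall x t, x \in m -> I (x * z (c :: t)).
    by move=> x t xm; apply: am; rewrite inE xm orbT.
  case: b; last exact: (IH _ _ (am' false)).
  by apply: Ii.1.2; [apply: am; exact: mem_head|exact: (IH _ _ (am' true))].
apply: (@regular_element I _ Ii Mi) => v vI.
pose z s : A := if (count id s == 0)%N then v else 0.
have [||s szs|w [_ dw Iw]] := V 0 z d0.
- by [].
- by move=> s szs; rewrite /z; case: eqP => [->|].
- apply: kdI => a t am; rewrite /z; case: ifP => _; last by rewrite mulr0; exact: Ii.1.1.
  by apply: vI; exact: mem_ideal_gen.
have := Iw (nseq (size ms) false) (size_nseq _ _).
rewrite (kd_ext (z' := fun=> 0)) ?size_nseq // => [|t szt].
  by rewrite kd0 subr0 /z count_nseq mul0n eqxx.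
by have [//|/eqP/(dw t szt)] := eqVneq (w t) 0; lia.
Qed.

(** Converse of [kvan_wreg]: dividing by a regular element costs one degree of vanishing, so the
    choice can be repeated [d] times. *)
Lemma kvan_wreg_exists (ms : seq A) I (d : nat) : pideal I ->
    kvan ms (d : int) (fun=> True) I ->
  exists gs, [/\ size gs = d, wreg (fun=> True) I gs &
    forall g, g \in gs -> g \in ideal_gen (mem ms)].
Proof.
elim: d I => [|d IH] I Ii V; first by exists [::].
have [|a aM reg] := kvan_regular_element Ii _ V; first by [].
have Tm : submod ms (fun _ : A => True) by split.
have Im : submod ms I by split; [exact: Ii.1|move=> c _ x; exact: Ii.2].
have [||gs [szgs wr gsM]] := IH (quo_mul (fun=> True) I a).
- exact: pideal_quo_mul.
- apply: kvan_quo_regular => //; first by move=> x _; exact: reg.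
    by move=> x; exact: Ii.2.
  by move: V; rewrite -addn1 PoszD.
exists (a :: gs); split=> //=; first by rewrite szgs.
  by split=> // x _; exact: reg.
by move=> g; rewrite inE => /orP[/eqP->|/gsM].
Qed.

Lemma ideal_gen_rcons (s : seq A) a :
  quo_mul (fun=> True) (fun x => x \in ideal_gen (mem s)) a
  = (fun x => x \in ideal_gen (mem (rcons s a))).
Proof.
have mem_rcons_last : a \in rcons s a by rewrite mem_rcons mem_head.
apply/funext => x; apply/propext; split=> [[u _ xu]|].
  rewrite -(subrK (a * u) x); apply: ideal_genD; last first.
    by rewrite mulrC; apply: ideal_genM; apply: mem_ideal_gen; exact: mem_rcons_last.
  by apply: ideal_gen_subset xu => y ys; rewrite mem_rcons inE ys orbT.
apply: ideal_gen_min; first by apply: pideal_quo_mul; exact: pideal_gen.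
move=> y; rewrite -[y \in _]/(y \in rcons s a) mem_rcons inE => /orP[/eqP->|ys].
  by exists 1 => //; rewrite mulr1 subrr; exact: ideal_gen0.
by exists 0 => //; rewrite mulr0 subr0; exact: mem_ideal_gen.
Qed.

Lemma wreg_regular_sequence (s0 gs : seq A) :
    wreg (fun=> True) (fun x => x \in ideal_gen (mem s0)) gs ->
  forall i, (i < size gs)%N -> forall a,
    gs`_i * a \in ideal_gen (mem (s0 ++ take i gs)) -> a \in ideal_gen (mem (s0 ++ take i gs)).
Proof.
elim: gs s0 => //= g gs IH s0 [reg]; rewrite ideal_gen_rcons => /IH wr [|i] /=.
  by move=> _ a; rewrite cats0; exact: reg.
by move=> igs a; have := wr i igs a; rewrite cat_rcons.
Qed.

Lemma wreg_zero_regular_sequence (gs : seq A) :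
    wreg (fun=> True) (fun x => x = 0) gs -> 1 \notin ideal_gen (mem gs) ->
  regular_sequence gs.
Proof.
have -> : (fun x : A => x = 0) = (fun x => x \in ideal_gen (mem ([::] : seq A))).
  apply/funext => x; apply/propext; split=> [->|]; first exact: ideal_gen0.
  apply: (@ideal_gen_min _ _ (fun x => x = 0)) => //.
  by split; first split=> // y z -> ->; rewrite ?subr0 //; move=> a y ->; rewrite mulr0.
by move=> wr n1; split=> //; exact: (wreg_regular_sequence wr).
Qed.

End RegularElements.

(** * Chains of primes and algebraic independence *)

Section ChainIndependence.
Variables (K : fieldType) (A : comNzRingType) (cA : {rmorphism K -> A}) (m : nat).
Local Notation D := {mpoly K[m]}.

Definition kill_vars i : D -> D :=
  mev (@mpolyC m K) (fun j : 'I_m => if (j < i)%N then 0 else 'X_j).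
HB.instance Definition _ i := GRing.RMorphism.copy (kill_vars i)
  (mev (@mpolyC m K) (fun j : 'I_m => if (j < i)%N then 0 else 'X_j)).

Lemma kill_varsC i c : kill_vars i c%:MP = c%:MP. Proof. exact: mevC. Qed.
Lemma kill_varsX i j : kill_vars i 'X_j = if (j < i)%N then 0 else 'X_j.
Proof. exact: mevX. Qed.

Lemma kill_vars0 p : kill_vars 0 p = p.
Proof.
elim/mpoly_ring_ind: p => [c|j|p q ep eq|p q ep eq].
- exact: kill_varsC.
- by rewrite kill_varsX ltn0.
- by rewrite rmorphD /= ep eq.
by rewrite rmorphM /= ep eq.
Qed.

Lemma kill_vars_all p : exists c, kill_vars m p = c%:MP.
Proof.
elim/mpoly_ring_ind: p => [c|j|p q [c ep] [d eq]|p q [c ep] [d eq]].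
- by exists c; exact: kill_varsC.
- by exists 0; rewrite kill_varsX ltn_ord mpolyC0.
- by exists (c + d); rewrite rmorphD /= ep eq mpolyCD.
by exists (c * d); rewrite rmorphM /= ep eq mpolyCM.
Qed.

Lemma kill_split (i : 'I_m) p :
  map_poly (kill_vars i.+1) (split_var i (kill_vars i p)) = split_var i (kill_vars i p).
Proof.
elim/mpoly_ring_ind: p => [c|j|p q ep eq|p q ep eq].
- by rewrite kill_varsC split_varC map_polyC /= kill_varsC.
- rewrite kill_varsX; case: ifP => ji; first by rewrite rmorph0 map_poly0.
  rewrite split_varX; case: eqP => [_|/eqP jni]; first by rewrite map_polyX.
  rewrite map_polyC /= kill_varsX ltnS leq_eqVlt ji orbF.
  by rewrite (_ : (_ == _)%N = false) //; apply/negbTE.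
- by rewrite !rmorphD /= ep eq.
by rewrite !rmorphM /= ep eq.
Qed.

(** By downward induction on [i], a nonzero polynomial in the variables from [i] on has its value
    outside [C i]. Its largest factor ['X_i ^+ l] may be dropped, as [b i] is outside the prime
    [C i]; since [b i] is in [C i.+1], the part free of ['X_i] would otherwise have its value in
    [C i.+1]. *)
Lemma chain_independent (b : nat -> A) (C : nat -> A -> Prop) (p : D) :
    (forall i, (i <= m)%N -> pprime (C i)) ->
    (forall i x, (i < m)%N -> C i x -> C i.+1 x) ->
    (forall i, (i < m)%N -> C i.+1 (b i) /\ ~ C i (b i)) ->
    p != 0 -> ~ C 0%N (mev cA (fun j : 'I_m => b j) p).
Proof.
move=> Cp Cs Cb; set v := mev _ _.
suff cl i (q : D) : (i <= m)%N -> kill_vars i q = q -> q != 0 -> ~ C i (v q).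
  by move=> p0; apply: (cl 0%N) => //; exact: kill_vars0.
move: {2}(m - i)%N (erefl (m - i)%N) => d; elim: d i q => [|d IH] i q di im kq q0.
  have ei : i = m by lia.
  rewrite ei in kq *; have [c ec] := kill_vars_all q; rewrite kq in ec.
  have c0 : c != 0 by apply: contraNneq q0 => c0; rewrite ec c0 mpolyC0.
  have [[_ CM] C1 _] := Cp m (leqnn m).
  rewrite ec /v mevC => Cc; apply: C1.
  by rewrite -(rmorph1 cA) -(mulVf c0) rmorphM; exact: CM.
have lim : (i < m)%N by lia.
pose o := Ordinal lim; pose P := split_var o q.
have P0 : P != 0.
  by apply: contraNneq q0 => P0; rewrite -(split_varK o q) -/P P0 horner0.
have kP l : kill_vars i.+1 P`_l = P`_l.
  by rewrite -coef_map /= /P -kq (kill_split o).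
have [l Pl Pm] : exists2 l, P`_l != 0 & forall j, (j < l)%N -> P`_j = 0.
  have ex : exists l, P`_l != 0 by exists (size P).-1; rewrite -[_`__]/(lead_coef P) lead_coef_eq0.
  case: (ex_minnP ex) => l Pl lmin; exists l => // j jl.
  by apply/eqP; apply: contraLR jl => /lmin; rewrite -leqNgt.
have [[Cs0 CM] C1 CP] := Cp i im.
have [C2 nb] := Cb i lim.
have qE : exists R, q = 'X_o ^+ l * (P`_l + 'X_o * R).
  exists (\sum_(l.+1 <= j < maxn l.+1 (size P)) P`_j * 'X_o ^+ (j - l.+1)).
  rewrite -[LHS](split_varK o) -/P (horner_coef_wide _ (leq_maxr l.+1 (size P))).
  rewrite -(big_mkord xpredT (fun j => P`_j * 'X_o ^+ j)).
  rewrite (big_cat_nat (leq0n l) (leq_trans (leqnSn l) (leq_maxl _ _))) /=.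
  rewrite big_nat_cond big1 ?add0r => [|j /andP[/andP[_ jl] _]]; last by rewrite Pm // mul0r.
  rewrite big_ltn ?leq_maxl // mulrDr [P`_l * _]mulrC; congr (_ + _).
  rewrite mulrA mulr_sumr big_nat_cond [RHS]big_nat_cond; apply: eq_bigr => j.
  move=> /andP[/andP[lj _] _]; rewrite mulrCA -exprSr -exprD; congr (_ * _ ^+ _); lia.
have [R ->] := qE; rewrite /v rmorphM rmorphXn rmorphD rmorphM /= mevX -/v => Cq.
have CX e x : C i (b i ^+ e * x) -> C i x.
  by elim: e => [|e IHe]; rewrite ?mul1r // exprS -mulrA => /CP[//|/IHe].
have := Cs i _ lim (CX _ _ Cq); have [[Cs1 CM1] _ _] := Cp i.+1 lim => Csum.
apply: (IH i.+1 P`_l _ lim (kP l) Pl); first by lia.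
rewrite -(addrK (b i * v R) (v P`_l)); apply: Cs1.2 => //.
by rewrite mulrC; exact: CM1.
Qed.

End ChainIndependence.

Section AlgebraicDependence.
Variables (K : fieldType) (d m : nat).
Local Notation R := {mpoly K[d]}.

Lemma mdeg_prod_le (I : finType) (b : I -> R) B (e : I -> nat) :
  (forall i, (msize (b i) <= B.+1)%N) ->
  (msize (\prod_i b i ^+ e i) <= (\sum_i e i * B).+1)%N.
Proof.
have mM (p q : R) a c : (msize p <= a.+1)%N -> (msize q <= c.+1)%N -> (msize (p * q) <= (a + c).+1)%N.
  move=> pa qc; have [->|p0] := eqVneq p 0; first by rewrite mul0r msize0.
  have [->|q0] := eqVneq q 0; first by rewrite mulr0 msize0.
  by rewrite msizeM //; move: (msize p) (msize q) pa qc => x y; lia.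
move=> bB; apply: (big_ind2 (fun (p : R) a => (msize p <= a.+1)%N)).
- by rewrite msize1.
- by move=> p a q c; exact: mM.
move=> i _; elim: (e i) => [|x IH]; first by rewrite expr0 msize1.
by rewrite exprS mulSn; exact: mM.
Qed.

Lemma algebraic_dependence (b : 'I_m -> R) : (d < m)%N ->
  exists2 p : {mpoly K[m]}, p != 0 & mev (@mpolyC d K) b p = 0.
Proof.
(* There are [N^m] monomials with exponents below [N], and their values have degree at most
   [L = m N B]. As [L + 1 <= N c], these values lie in a space of dimension at most [(N c)^d], which
   is less than [N^(d+1)] because [c^d < N]. *)
move=> dm; pose B := (\max_i msize (b i))%N; pose c := (m * B).+1.
pose N := (c ^ d).+1; pose L := (m * N * B)%N.
pose E := {ffun 'I_m -> 'I_N}; pose V := {ffun 'I_d -> 'I_L.+1}.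
pose mon (f : E) := [multinom (f i : nat) | i < m].
pose vmon (f : V) := [multinom (f i : nat) | i < d].
pose pw (f : E) : R := \prod_i b i ^+ f i.
pose X : 'M[K]_(#|{: E}|, #|{: V}|) :=
  \matrix_(i, j) (pw (enum_val i))@_(vmon (enum_val j)).
have cardlt : (#|{: V}| < #|{: E}|)%N.
  rewrite !card_ffun !card_ord.
  have Lc : (L.+1 <= N * c)%N.
    rewrite /L /c mulnS mulnA [(m * N)%N]mulnC -add1n; exact: leq_add.
  have le_exp a e u : (a <= e)%N -> (a ^ u <= e ^ u)%N.
    by case: u => // u ae; rewrite leq_exp2r.
  apply: leq_ltn_trans (le_exp _ _ d Lc) _; rewrite expnMn.
  apply: (@leq_trans (N ^ d.+1)); last by rewrite leq_pexp2l.
  by rewrite expnSr ltn_pmul2l // expn_gt0.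
have [v vX v0] : exists2 v : 'rV[K]_(#|{: E}|), v *m X = 0 & v != 0.
  have : kermx X != 0.
    rewrite -mxrank_eq0 mxrank_ker -lt0n subn_gt0.
    by apply: leq_ltn_trans cardlt; exact: rank_leq_col.
  case/rowV0Pn => v /sub_kermxP vX v0; by exists v.
exists (\sum_i v 0 i *: 'X_[mon (enum_val i)]).
  have [i vi] : exists i, v 0 i != 0 by apply/rV0Pn.
  apply: contraNneq vi => /(congr1 (mcoeff (mon (enum_val i)))).
  rewrite mcoeff0 raddf_sum /= (bigD1 i) //= mcoeffZ mcoeffX eqxx mulr1 big1 ?addr0 => [->//|j ji].
  rewrite mcoeffZ mcoeffX (_ : (_ == _) = false) ?mulr0 //.
  apply: contraNF ji => /eqP/mnmP mij; apply/eqP/enum_val_inj/ffunP => t.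
  by apply: val_inj; have := mij t; rewrite !mnmE.
rewrite rmorph_sum /=; apply/mpolyP => mm; rewrite mcoeff0 raddf_sum /=.
have pwE i : mev (@mpolyC d K) b 'X_[mon (enum_val i)] = pw (enum_val i).
  by rewrite mevE mmapX /mmap1 /pw; apply: eq_bigr => j _; rewrite mnmE.
have vpw i : (mev (@mpolyC d K) b (v 0 i *: 'X_[mon (enum_val i)]))@_mm
    = v 0 i * (pw (enum_val i))@_mm.
  by rewrite -mul_mpolyC rmorphM /= mevC pwE mul_mpolyC mcoeffZ.
under eq_bigr => i _ do rewrite vpw.
have [small|big] := boolP [forall j, mm j <= L]%N.
  pose f : V := [ffun j => inord (mm j)].
  have vf : vmon f = mm.
    by apply/mnmP => j; rewrite mnmE ffunE inordK // ltnS; have /forallP := small.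
  have := congr1 (fun w : 'rV[K]__ => w 0 (enum_rank f)) vX.
  rewrite [LHS]mxE [RHS]mxE => vX0; rewrite -[RHS]vX0.
  by apply: eq_bigr => i _; rewrite mxE enum_rankK vf.
apply: big1 => i _; rewrite memN_msupp_eq0 ?mulr0 //.
apply: contra big => mmp; apply/forallP => j.
have jm : (mm j <= mdeg mm)%N by rewrite mdegE (bigD1 j) //= leq_addr.
apply: leq_trans jm _; have := msize_mdeg_lt mmp => /leq_trans h.
have bB l : (msize (b l) <= B.+1)%N by apply: leqW; exact: (leq_bigmax l).
have := h _ (mdeg_prod_le (fun l => enum_val i l) bB); rewrite ltnS => /leq_trans; apply.
apply: (@leq_trans (\sum_(l < m) N * B)%N).
  by apply: leq_sum => l _; rewrite leq_mul2r ltnW ?orbT.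
by rewrite sum_nat_const card_ord mulnA.
Qed.

End AlgebraicDependence.

Lemma prime_ideal_pprime (A : comNzRingType) (P : {pred A}) :
  prime_ideal P -> pprime (fun x => x \in P).
Proof.
move=> [Pi PM]; split; [exact: idealr_pideal| |].
  by have [_ /negP] := Pi.
by move=> a b /PM/orP.
Qed.

(** Elements picked from the successive steps of a chain are algebraically independent, while
    [d + 1] elements of a polynomial ring in [d] variables are not. *)
Lemma prime_chain_bound (K : fieldType) (A : comNzRingType) (cA : {rmorphism K -> A}) d
    (rho : {rmorphism A -> {mpoly K[d]}}) :
    injective rho -> (forall c, rho (cA c) = c%:MP) ->
  forall (M : {pred A}) e C, prime_chain M e C -> (e <= d)%N.
Proof.
move=> rho_inj rhoC M e C [Cp Cs _]; rewrite leqNgt; apply/negP => de.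
have bex i : exists b : A, (i < e)%N -> b \in C i.+1 /\ b \notin C i.
  have [ie|] := boolP (i < e)%N; last by exists 0.
  have [_ nsub] := Cs i ie; apply: contrapT => no; apply: nsub => x xC.
  by apply: contrapT => /negP nx; apply: no; exists x.
have [b bP] := choice bex.
have [p p0 pb] := algebraic_dependence (fun i : 'I_d.+1 => rho (b i)) (ltnSn d).
have rb : rho (mev cA (fun i : 'I_d.+1 => b i) p) = 0.
  rewrite -pb; elim/mpoly_ring_ind: p {p0 pb} => [c|j|p q ep eq|p q ep eq].
  - by rewrite !mevC rhoC.
  - by rewrite !mevX.
  - by rewrite !rmorphD /= ep eq.
  by rewrite !rmorphM /= ep eq.
apply: (@chain_independent K A cA d.+1 b (fun i x => x \in C i) p _ _ _ p0).
- by move=> i id; apply: prime_ideal_pprime; apply: Cp; exact: leq_trans id de.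
- by move=> i x id; have [sub _] := Cs i (leq_trans id de); exact: sub.
- by move=> i id; have [? /negP] := bP i (leq_trans id de).
have [[[C0 _] _] _ _] := prime_ideal_pprime (Cp 0%N isT).
by rewrite (_ : mev _ _ p = 0) //; apply: rho_inj; rewrite rb rmorph0.
Qed.

(** * Finitely generated algebras and Zariski's lemma *)

Section FinitelyGenerated.

(** Generation as an algebra, stated as an induction principle: a subring containing the image of
    [D] and the elements of [a] is everything. *)
Definition gen_over (D A : comNzRingType) (phi : D -> A) (a : seq A) :=
  forall Q : A -> Prop, (forall d, Q (phi d)) -> (forall x, x \in a -> Q x) ->
    (forall x y, Q x -> Q y -> Q (x - y)) -> (forall x y, Q x -> Q y -> Q (x * y)) ->
  forall z, Q z.

Definition adjoin (D A : comNzRingType) (phi : {rmorphism D -> A}) (x : A) :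
  {poly D} -> A := fun p => (map_poly phi p).[x].
HB.instance Definition _ (D A : comNzRingType) (phi : {rmorphism D -> A}) x :=
  GRing.RMorphism.copy (adjoin phi x) (horner_eval x \o map_poly phi)%FUN.

Lemma adjoinE (D A : comNzRingType) (phi : {rmorphism D -> A}) x p :
  adjoin phi x p = (map_poly phi p).[x].
Proof. by []. Qed.

Lemma gen_over_adjoin (D A : comNzRingType) (phi : {rmorphism D -> A}) x a :
  gen_over phi (x :: a) -> gen_over (adjoin phi x) a.
Proof.
move=> g Q Qp Qa QB QM; apply: g => // [d|y].
  by have := Qp d%:P; rewrite adjoinE map_polyC hornerC.
rewrite inE => /orP[/eqP->|/Qa//].
by have := Qp 'X; rewrite adjoinE map_polyX hornerX.
Qed.

Lemma gen_over_nil (D A : comNzRingType) (phi : {rmorphism D -> A}) :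
  gen_over phi [::] -> forall z, exists d, z = phi d.
Proof.
move=> g; apply: g => // [d|x y [d ->] [e ->]|x y [d ->] [e ->]].
- by exists d.
- by exists (d - e); rewrite rmorphB.
by exists (d * e); rewrite rmorphM.
Qed.

Lemma ideal_gen_image (A B : comNzRingType) (f : {rmorphism A -> B}) (s : seq A) x :
  x \in ideal_gen (mem s) -> f x \in ideal_gen (mem (map f s)).
Proof.
apply: (ideal_gen_min (I := fun x => f x \in ideal_gen (mem (map f s)))).
  have [[h0 hB] hM] := pideal_gen (mem (map f s)).
  split; first split; rewrite ?rmorph0 // => y z; rewrite ?rmorphB ?rmorphM; [exact: hB|exact: hM].
by move=> y ys; apply: mem_ideal_gen; exact: map_f.
Qed.

Lemma noetherian_surj (A B : comNzRingType) (f : {rmorphism A -> B}) :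
  (forall z, exists d, z = f d) -> noetherian A -> noetherian B.
Proof.
move=> fs nA; apply/noetherianP => I Ii.
have Ji : pideal (fun x => I (f x)).
  split; first split; rewrite ?rmorph0; first exact: Ii.1.1.
    by move=> x y Ix Iy; rewrite rmorphB; exact: Ii.1.2.
  by move=> x y Iy; rewrite rmorphM; exact: Ii.2.
have [s sP] := (noetherianP A).1 nA _ Ji.
exists (map f s) => x; split=> [|]; last first.
  apply: ideal_gen_min => // y; rewrite -[y \in _]/(y \in map f s) => /mapP[z zs ->].
  by apply/sP; exact: mem_ideal_gen.
by have [d ->] := fs x => /sP; exact: ideal_gen_image.
Qed.

(** Hilbert's basis theorem. In a [good] sequence the degree of each term is at most that of any
    element of [I] outside the ideal of the preceding terms. A good sequence whose ideal of leading
    coefficients is maximal generates [I]. *)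
Lemma noetherian_poly (D : comNzRingType) : noetherian D -> noetherian {poly D}.
Proof.
move=> nD; apply/noetherianP => I Ii.
pose good (s : seq {poly D}) := forall i, (i < size s)%N -> I s`_i /\
  forall f, I f -> f \notin ideal_gen (mem (take i s)) -> (size (s`_i)%R <= size f)%N.
pose lc s : D -> Prop := fun x => x \in ideal_gen (mem (map lead_coef s)).
pose Fam L := exists2 s, good s & L = lc s.
have [||L [[s gs ->] _ Lmax]] := noetherian_max nD (Fam := Fam) (I0 := lc [::]).
- by exists [::].
- by move=> L [s _ ->]; exact: pideal_gen.
have sI x : x \in s -> I x.
  by move=> xs; have [] := gs (index x s); rewrite ?index_mem // nth_index.
exists s => x; split; last by apply: ideal_gen_min => // y ys; exact: sI.
move=> Ix; apply: contrapT => /negP nx.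
have [m] := ubnP (size x).
have [f [If nf fmin]] : exists f, [/\ I f, f \notin ideal_gen (mem s) &
    forall g, I g -> g \notin ideal_gen (mem s) -> (size f <= size g)%N].
  have ex : exists n, `[< exists f, [/\ I f, f \notin ideal_gen (mem s) & size f = n] >].
    by exists (size x); apply/asboolP; exists x.
  case: (ex_minnP ex) => n /asboolP[f [If nf <-]] nmin; exists f; split=> // g Ig ng.
  by apply: nmin; apply/asboolP; exists g.
move=> _ {m x Ix nx}.
have gf : good (rcons s f).
  move=> i; rewrite size_rcons ltnS leq_eqVlt => /orP[/eqP->|si].
    rewrite nth_rcons ltnn eqxx -cats1 take_size_cat //.
  by rewrite nth_rcons si -cats1 takel_cat ?(ltnW si) //; exact: gs.
have lf : lead_coef f \in ideal_gen (mem (map lead_coef s)).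
  apply: (Lmax (lc (rcons s f))); first by exists (rcons s f).
    move=> x; apply: ideal_gen_subset => y; rewrite map_rcons mem_rcons inE => ->.
    by rewrite orbT.
  by apply: mem_ideal_gen; rewrite -[_ \in _]/(_ \in map _ _) map_rcons mem_rcons mem_head.
have sf i : (i < size s)%N -> (size (s`_i)%R <= size f)%N.
  move=> si; have [_ h] := gs i si; apply: h => //; apply: contra nf.
  by apply: ideal_gen_subset => y /mem_take.
have [e le] := ideal_gen_nth lf.
have szl : size (map lead_coef s) = size s by rewrite size_map.
(* The shifts bring each element of [s] to the degree of [f], so that the leading term of [f]
   cancels in [g]. *)
pose t (j : 'I_(size (map lead_coef s))) := (e j)%:P * ('X^(size f - size s`_j) * s`_j).
pose g := f - \sum_j t j.
have tI j : t j \in ideal_gen (mem s).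
  rewrite /t mulrA; apply: ideal_genM; apply: mem_ideal_gen.
  by rewrite -[_ \in _]/(_ \in s) mem_nth // -szl.
have f0 : f != 0 by apply: contraNneq nf => ->; exact: ideal_gen0.
have tsum : \sum_j t j \in ideal_gen (mem s) by exact: ideal_gen_sum.
have Ig : I g by apply: Ii.1.2 => //; apply: ideal_gen_min tsum.
have ng : g \notin ideal_gen (mem s).
  by apply: contra nf => gi; rewrite -(subrK (\sum_j t j) f); exact: ideal_genD.
have := fmin g Ig ng; rewrite leqNgt => /negP; apply.
have tcoef (j : 'I_(size (map lead_coef s))) :
    (t j)`_(size f).-1 = e j * (map lead_coef s)`_j.
  have js : (j < size s)%N by rewrite -szl.
  rewrite coefCM coefXnM (nth_map 0) //; congr (_ * _).
  have := sf j js; have [-> _|sj0 sj] := eqVneq s`_j 0.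
    by rewrite coef0 lead_coef0 if_same.
  have sp : (0 < size (s`_j)%R)%N by rewrite size_poly_gt0.
  rewrite ifF; last by lia.
  by rewrite lead_coefE; congr (_`_ _); lia.
rewrite -(prednK (n := size f)) ?size_poly_gt0 // ltnS; apply/leq_sizeP => j.
rewrite leq_eqVlt => /orP[/eqP<-|fj].
  rewrite coefB coef_sum -/(lead_coef f) le; apply/eqP; rewrite subr_eq0; apply/eqP.
  by apply: eq_bigr => i _; rewrite tcoef.
rewrite coefB nth_default; last exact: leq_trans (leqSpred _) fj.
rewrite coef_sum big1 ?subr0 // => i _; rewrite coefCM coefXnM.
have := sf i; rewrite -szl => /(_ (ltn_ord i)) si.
case: ifP => _; [by rewrite mulr0|rewrite nth_default ?mulr0 //].
by have fj2 := leq_trans (leqSpred _) fj; move: (size f) (size (s`_i)%R) si fj2 => u w; lia.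
Qed.

Lemma noetherian_gen_over (D A : comNzRingType) (phi : {rmorphism D -> A}) a :
  noetherian D -> gen_over phi a -> noetherian A.
Proof.
elim: a D phi => [|x a IH] D phi nD g.
  exact: (noetherian_surj (gen_over_nil g)).
exact: (IH _ _ (noetherian_poly nD) (gen_over_adjoin g)).
Qed.

Lemma noetherian_field (K : fieldType) : noetherian K.
Proof.
apply/noetherianP => I Ii.
have [[x Ix x0]|no] := pselect (exists2 x, I x & x != 0).
  exists [:: 1] => y; split=> _; last first.
    by rewrite -[y](mulfVK x0); exact: Ii.2.
  by rewrite -[y]mulr1; apply: ideal_genM; apply: mem_ideal_gen; exact: mem_head.
exists [::] => y; split=> [Iy|].
  have [->|y0] := eqVneq y 0; first exact: ideal_gen0.
  by case: no; exists y.
by apply: ideal_gen_min.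
Qed.

End FinitelyGenerated.

Section ResidueField.
Variables (A : comNzRingType) (M : {pred A}) (Mmax : maximal_ideal M).
Local Open Scope quotient_scope.

(** The proof of maximality is a parameter, so that the ideal structure can be attached to the
    predicate as an instance. *)
Definition max_pred of maximal_ideal M : {pred A} := M.
HB.instance Definition _ := isIdealr.Build A (max_pred Mmax) Mmax.1.

Definition residue := Quotient.quot (max_pred Mmax).
HB.instance Definition _ := GRing.ComNzRing.on residue.

Definition residue_map : A -> residue := fun x => \pi_(residue) x.

Lemma residue_map_zmod : zmod_morphism residue_map.
Proof. exact: (rmorphB (\pi_(Quotient.quot (max_pred Mmax)))). Qed.
Lemma residue_map_monoid : monoid_morphism residue_map.
Proof.
split; first exact: (rmorph1 (\pi_(Quotient.quot (max_pred Mmax)))).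
exact: (rmorphM (\pi_(Quotient.quot (max_pred Mmax)))).
Qed.
HB.instance Definition _ :=
  GRing.isZmodMorphism.Build A residue residue_map residue_map_zmod.
HB.instance Definition _ :=
  GRing.isMonoidMorphism.Build A residue residue_map residue_map_monoid.

Lemma residue_map_eq0 x : (residue_map x == 0) = (x \in M).
Proof.
by rewrite -(rmorph0 residue_map) /residue_map -Quotient.idealrBE subr0.
Qed.

Lemma residue_map_surj z : exists x, z = residue_map x.
Proof. by exists (repr z); rewrite /residue_map reprK. Qed.

Lemma residue_inv_ex (z : residue) : exists y : residue,
  (z != 0 -> y * z = 1) /\ (z = 0 -> y = 0).
Proof.
have [->|z0] := eqVneq z 0; first by exists 0; split.
have [x zx] := residue_map_surj z.
have xM : x \notin M by rewrite -residue_map_eq0 -zx.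
have [_ /(_ x xM)[y xy]] := maximal_prime Mmax.
exists (residue_map y); split=> [_|/eqP]; last by rewrite (negPf z0).
apply/esym/eqP; rewrite -subr_eq0 zx mulrC -rmorphM -(rmorph1 residue_map) -rmorphB.
by rewrite residue_map_eq0.
Qed.

Definition residue_inv (z : residue) : residue := sval (cid (residue_inv_ex z)).

Lemma residue_mulVf z : z != 0 -> residue_inv z * z = 1.
Proof. by rewrite /residue_inv; case: cid => y []. Qed.

Lemma residue_inv0 : residue_inv 0 = 0.
Proof. by rewrite /residue_inv; case: cid => y [] _ /=; apply. Qed.

HB.instance Definition _ :=
  GRing.ComNzRing_isField.Build residue residue_mulVf residue_inv0.

End ResidueField.

Section Zariski.
Variable F : fieldType.

Section Localized.
Variables (D : comNzRingType) (phi : {rmorphism D -> F}) (d : D).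
Hypothesis d0 : phi d != 0.

(* z is integral over the localization of D at d. *)
Definition locint (z : F) := exists N, integralOver phi (phi d ^+ N * z).

Lemma locint_up z N N' : (N <= N')%N ->
  integralOver phi (phi d ^+ N * z) -> integralOver phi (phi d ^+ N' * z).
Proof.
move=> /subnK <-; rewrite exprD -mulrA => iz; apply: integral_mul => //.
by rewrite -rmorphXn; exact: integral_id.
Qed.

Lemma locint_phi x : locint (phi x).
Proof. by exists 0%N; rewrite mul1r; exact: integral_id. Qed.

Lemma locintM x y : locint x -> locint y -> locint (x * y).
Proof.
move=> [N xN] [N' yN]; exists (N + N')%N; rewrite exprD mulrACA; exact: integral_mul.
Qed.

Lemma locintD x y : locint x -> locint y -> locint (x + y).
Proof.
move=> [N xN] [N' yN]; exists (N + N')%N; rewrite mulrDr; apply: integral_add.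
  by apply: locint_up xN; exact: leq_addr.
by apply: locint_up yN; exact: leq_addl.
Qed.

Lemma locintX x e : locint x -> locint (x ^+ e).
Proof.
move=> ix; elim: e => [|e IH]; first by rewrite expr0 -(rmorph1 phi); exact: locint_phi.
by rewrite exprS; exact: locintM.
Qed.

(** Scaling the root by [phi d ^+ E] multiplies the coefficient of degree [i] by that power to the
    [m - i], which makes all lower coefficients integral at once. *)
Lemma locint_root (p : {poly F}) x : p \is monic -> root p x ->
  (forall i, locint p`_i) -> locint x.
Proof.
move=> pm px ip; have [N Np] := choice ip.
pose E := \max_(i < size p) N i.
have pE i : integralOver phi (phi d ^+ E * p`_i).
  have [si|si] := ltnP i (size p); last by rewrite nth_default // mulr0; exact: integral0.
  by apply: locint_up (Np i); exact: (leq_bigmax (Ordinal si)).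
have p0 := monic_neq0 pm; pose m := (size p).-1.
have szp : size p = m.+1 by rewrite prednK // size_poly_gt0.
pose q := \poly_(i < m.+1) (p`_i * (phi d ^+ E) ^+ (m - i)).
have qm : q`_m = 1.
  by rewrite coef_poly ltnSn subnn expr0 mulr1; exact: (monicP pm).
have szq : size q = m.+1.
  by rewrite size_poly_eq // subnn expr0 mulr1 -[p`_m]/(lead_coef p) lead_coef_eq0.
exists E; apply: (@integral_root_monic _ _ phi _ q).
- by rewrite monicE lead_coefE szq /= qm.
- apply/rootP; rewrite (horner_coef_wide _ (eq_leq szq)).
  have /rootP := px; rewrite (horner_coef_wide _ (eq_leq szp)) => px0.
  transitivity ((phi d ^+ E) ^+ m * \sum_(i < m.+1) p`_i * x ^+ i); last first.
    by rewrite px0 mulr0.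
  rewrite mulr_sumr; apply: eq_bigr => i _.
  rewrite coef_poly ltn_ord exprMn.
  have im : (i <= m)%N by rewrite -ltnS.
  have -> : (phi d ^+ E) ^+ m = (phi d ^+ E) ^+ (m - i) * (phi d ^+ E) ^+ i.
    by rewrite -exprD subnK.
  by rewrite -!mulrA mulrCA; congr (_ * _); exact: mulrCA.
apply/integral_poly => i; rewrite coef_poly; case: ifP => im; last exact: integral0.
rewrite ltnS leq_eqVlt in im; case/orP: im => [/eqP->|im].
  by rewrite subnn mulr1 [p`_m](monicP pm); exact: integral1.
have -> : (m - i = (m - i).-1.+1)%N by lia.
rewrite exprS mulrA [p`_i * _]mulrC; apply: integral_mul => //.
by rewrite -!rmorphXn; exact: integral_id.
Qed.

Lemma locint_div_lead (p : {poly D}) x l : size (map_poly phi p) = l.+1 ->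
  p`_l = d -> root (map_poly phi p) x -> locint x.
Proof.
move=> sp pl px; apply: (@locint_root ((phi d)^-1 *: map_poly phi p)).
- by rewrite monicE lead_coefZ lead_coefE sp /= coef_map /= pl mulVf.
- by rewrite rootZ ?invr_eq0.
move=> i; exists 1%N; rewrite expr1 coefZ mulVKf // coef_map; exact: integral_id.
Qed.

End Localized.

Lemma locint_mulr (D : comNzRingType) (phi : {rmorphism D -> F}) d c z :
  locint phi d z -> locint phi (d * c) z.
Proof.
move=> [N iz]; exists N; rewrite rmorphM exprMn mulrAC mulrC; apply: integral_mul => //.
by rewrite -rmorphXn; exact: integral_id.
Qed.

(** The reversed equation of [u] vanishes at its inverse; its leading coefficient, which has to be
    inverted, is the lowest nonzero coefficient of the equation. *)
Lemma integral_inv_locint (D : comNzRingType) (phi : {rmorphism D -> F}) u :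
  u != 0 -> integralOver phi u -> exists2 c, phi c != 0 & locint phi c u^-1.
Proof.
move=> u0 [p pm /rootP pu]; set P := map_poly phi p in pu.
have P0 : P != 0 by apply: monic_neq0; exact: monic_map.
have ex : exists j, P`_j != 0 by exists (size P).-1; rewrite -[_`__]/(lead_coef P) lead_coef_eq0.
case: (ex_minnP ex) => j Pj jmin.
have Pi i : P`_i = phi p`_i by rewrite /P coef_map.
(* [m] is one more than the degree, so the reversed polynomial merely gains a factor ['X]. *)
pose m := size p; have jm : (j < m)%N.
  by rewrite ltnNge; apply: contra Pj => sj; rewrite Pi nth_default ?rmorph0.
have cj : phi p`_j != 0 by rewrite -Pi.
exists p`_j => //.
pose q := \poly_(i < (m - j).+1) p`_(m - i).
have qE i : (map_poly phi q)`_i = if (i < (m - j).+1)%N then P`_(m - i) else 0.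
  by rewrite coef_map coef_poly Pi; case: ifP => _; rewrite /= ?rmorph0.
have sq : size (map_poly phi q) = (m - j).+1.
  apply/eqP; rewrite eqn_leq; apply/andP; split.
    by apply/leq_sizeP => i mi; rewrite qE ltnNge mi.
  rewrite ltnNge; apply: contra Pj => sm.
  have := qE (m - j)%N; rewrite ltnSn subKn; last exact: ltnW.
  by rewrite nth_default // => <-.
apply: (locint_div_lead cj sq); first by rewrite coef_poly ltnSn subKn // ltnW.
have sm : (size (map_poly phi q) <= m.+1)%N by rewrite sq ltnS leq_subr.
apply/rootP; rewrite (horner_coef_wide _ sm).
apply: (mulIf (x := u ^+ m)); first by rewrite expf_neq0.
have sP : (size P <= m.+1)%N by apply: leqW; exact: size_poly.
rewrite mul0r; transitivity P.[u]; last exact: pu.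
rewrite (horner_coef_wide _ sP).
rewrite mulr_suml (reindex_inj rev_ord_inj) /=; apply: eq_bigr => i _.
have im : (i <= m)%N by rewrite -ltnS.
have -> : (map_poly phi q)`_(m.+1 - i.+1) = P`_i.
  rewrite qE subSS subKn //; case: ifP => // /negbT; rewrite -leqNgt => mji.
  have ij : (i < j)%N by lia.
  by apply/esym/eqP; apply: contraLR ij => /jmin; rewrite -leqNgt.
rewrite subSS exprVn -mulrA; congr (_ * _).
have -> : u ^+ m = u ^+ (m - i) * u ^+ i by rewrite -exprD subnK.
by rewrite mulKf // expf_neq0.
Qed.

(** By induction, [F] is integral over [D[x]] after inverting some [d']. If [x] is algebraic, both
    [x] and the inverse of [d'] become integral after inverting one element of [D]. If [x] is
    transcendental, the inverse of [1 + x d'] is integral over [D[x]] with [d'] inverted, so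
    [1 + x d'] divides a power of [d'], although the two are coprime. *)
Lemma zariski a (D : comNzRingType) (phi : {rmorphism D -> F}) : gen_over phi a ->
  exists2 d, phi d != 0 & forall z, locint phi d z.
Proof.
elim: a D phi => [|x a IH] D phi g.
  exists 1; first by rewrite rmorph1 oner_eq0.
  by move=> z; have [d ->] := gen_over_nil g z; exact: locint_phi.
have [d' /= v0 Hz] := IH _ _ (gen_over_adjoin g).
have [[p [px p0]]|trans] := pselect (exists p, (adjoin phi x) p = 0 /\ map_poly phi p != 0).
  pose l := (size (map_poly phi p)).-1; pose d1 := p`_l.
  have d10 : phi d1 != 0 by rewrite -coef_map -[_`__]/(lead_coef _) lead_coef_eq0.
  have ix : locint phi d1 x.
    apply: (locint_div_lead d10 (p := p) (l := l)) => //; last exact/rootP.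
    by rewrite prednK // size_poly_gt0.
  have iphi1 q : locint phi d1 ((adjoin phi x) q).
    elim/poly_ind: q => [|q c iq]; first by rewrite rmorph0 -(rmorph0 phi); exact: locint_phi.
    rewrite adjoinE rmorphD rmorphM /= map_polyX map_polyC /= hornerMXaddC.
    by apply: locintD; [apply: locintM|exact: locint_phi].
  have [N iv] := iphi1 d'.
  have [|c c0 ic] := integral_inv_locint _ iv; first by rewrite mulf_neq0 ?expf_neq0.
  have dc0 : phi (d1 * c) != 0 by rewrite rmorphM mulf_neq0.
  exists (d1 * c) => //.
  have iphi1' q : locint phi (d1 * c) ((adjoin phi x) q) by exact: locint_mulr.
  have iv' : locint phi (d1 * c) ((adjoin phi x) d')^-1.
    have -> : ((adjoin phi x) d')^-1 = phi d1 ^+ N * (phi d1 ^+ N * (adjoin phi x) d')^-1.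
      by rewrite invfM mulVKf // expf_neq0.
    apply: locintM; first by rewrite -rmorphXn; exact: locint_phi.
    by rewrite mulrC; exact: locint_mulr.
  move=> z; have [M [q qm qz]] := Hz z.
  have -> : z = (adjoin phi x) d' ^+ M * z * ((adjoin phi x) d')^-1 ^+ M.
    by rewrite exprVn mulrAC mulfV ?mul1r // expf_neq0.
  apply: locintM; last exact: locintX.
  apply: (locint_root dc0 _ qz); first exact: monic_map.
  by move=> i; rewrite coef_map; exact: iphi1'.
exfalso.
pose delta := map_poly phi d'; pose gam := 1 + 'X * delta.
have delta0 : delta != 0.
  by apply: contraNneq v0 => d0; rewrite adjoinE -/delta d0 horner0.
have sgam : size gam = (size delta).+1.
  rewrite /gam addrC size_polyDl mulrC size_mulX // size_poly1 ltnS size_poly_gt0 //.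
have g0 : (adjoin phi x) (1 + 'X * d') != 0.
  apply/negP => /eqP g0; apply: trans; exists (1 + 'X * d'); split=> //.
  by rewrite rmorphD rmorphM rmorph1 /= map_polyX -/delta -/gam -size_poly_gt0 sgam.
have [N [q qm /rootP qz]] := Hz ((adjoin phi x) (1 + 'X * d'))^-1.
set v := (adjoin phi x) d' in v0 qz *; set y := (adjoin phi x) (1 + 'X * d') in g0 qz *.
have [h hE] : exists h, v ^+ (N * (size q).-1) = y * (adjoin phi x) h.
  pose Q := map_poly (adjoin phi x) q; pose m := (size q).-1.
  have sq : size q = m.+1 by rewrite prednK // size_poly_gt0 monic_neq0.
  have sQ : (size Q <= m.+1)%N by rewrite -sq; exact: size_poly.
  exists (- \sum_(i < m) q`_i * (d' ^+ (N * i) * (1 + 'X * d') ^+ (m - i.+1))).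
  have := congr1 (fun t => t * y ^+ m) qz; rewrite mul0r (horner_coef_wide _ sQ).
  rewrite big_ord_recr mulrDl /= addrC => /eqP; rewrite addr_eq0 => /eqP e.
  transitivity (Q`_m * (v ^+ N / y) ^+ m * y ^+ m).
    have -> : Q`_m = 1 by rewrite /Q coef_map [q`_m](monicP qm); exact: rmorph1.
    rewrite mul1r exprMn exprVn.
    by rewrite mulfVK ?expf_neq0 // exprM.
  rewrite e rmorphN rmorph_sum mulrN mulr_sumr mulr_suml; congr (- _); apply: eq_bigr => i _.
  rewrite /Q coef_map !rmorphM !rmorphXn /= -/v -/y exprMn exprVn exprM -!mulrA.
  rewrite [RHS]mulrCA; congr (_ * _); rewrite [RHS]mulrCA; congr (_ * _).
  have im : (i < m)%N by [].
  have -> : y ^+ m = y ^+ (m - i) * y ^+ i by rewrite -exprD subnK // ltnW.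
  by rewrite -exprS subnSK // mulrC mulfK // expf_neq0.
have big : delta ^+ (N * (size q).-1) = gam * map_poly phi h.
  apply/eqP; rewrite -subr_eq0; apply/negP => /negP ne; apply: trans.
  exists (d' ^+ (N * (size q).-1) - (1 + 'X * d') * h); split.
    by rewrite rmorphB rmorphXn rmorphM /= -/v -/y hE subrr.
  by rewrite rmorphB rmorphXn rmorphM rmorphD rmorphM rmorph1 /= map_polyX.
have cop : coprimep gam delta.
  by rewrite coprimep_sym /gam addrC coprimep_addl_mul coprimep1.
have : gam %| delta ^+ (N * (size q).-1) by rewrite big dvdp_mulr.
have copN : coprimep gam (delta ^+ (N * (size q).-1)) by exact: coprimep_expr.
move=> gd; have := dvdp_gcd_idl gd => /eqp_size; rewrite sgam.
by move: copN; rewrite coprimep_def => /eqP -> [] /esym/eqP; rewrite size_poly_eq0 (negPf delta0).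
Qed.

End Zariski.

(** * Rees algebras *)

(** Zariski's lemma for the residue field gives a nonzero scalar [d] such that [d^N x] is integral
    over [K]; composing its equation with [d^N 'X] gives one for [x]. *)
Lemma maximal_algebraic (K : fieldType) (A : comNzRingType) (cA : {rmorphism K -> A}) a
    (M : {pred A}) : gen_over cA a -> maximal_ideal M ->
  forall x, exists2 q : {poly K}, q != 0 & (map_poly cA q).[x] \in M.
Proof.
move=> g Mmax x; pose phi : {rmorphism K -> residue Mmax} := (residue_map Mmax \o cA)%FUN.
have gphi : gen_over phi (map (residue_map Mmax) a).
  move=> Q Qp Qa QB QM z; have [y ->] := residue_map_surj z.
  apply: (g (fun y => Q (residue_map Mmax y))) => [d|t ta|s t Qs Qt|s t Qs Qt].
  - exact: Qp.
  - by apply: Qa; exact: map_f.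
  - by rewrite rmorphB; exact: QB.
  by rewrite rmorphM; exact: QM.
have [d d0 Hz] := zariski gphi; have [N [p pm pz]] := Hz (residue_map Mmax x).
have dn0 : d != 0 by apply: contraNneq d0 => ->; rewrite rmorph0.
exists (p \Po (d ^+ N *: 'X)).
  rewrite -size_poly_gt0 size_comp_poly2 ?size_poly_gt0 ?monic_neq0 //.
  by rewrite size_scale ?expf_neq0 // size_polyX.
rewrite -residue_map_eq0 -horner_map -map_poly_comp /=.
rewrite -[map_poly _ _]/(map_poly phi _) map_comp_poly horner_comp.
by rewrite map_polyZ map_polyX hornerZ hornerX rmorphXn.
Qed.

Lemma kvan_surj (S G : comNzRingType) (e : {rmorphism S -> G}) (m : seq S) d :
    (forall z, exists p, z = e p) -> kvan m d (fun=> True) (fun p => e p = 0) ->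
  kvan (map e m) d (fun=> True) (fun x => x = 0).
Proof.
move=> es V i z id _ dz z0.
have [s szs|s szs ci||z' [_ dz' zz']] :=
    @kcochain_choice S m (fun s u => z s = e u) (fun=> True) i.
- by have [u ->] := es (z s); exists u.
- rewrite rmorph0; have [//|/eqP zs0] := eqVneq (z s) 0.
  by case: ci; apply: dz; rewrite ?size_map.
- by split.
have zE s : size s = size m -> kd (map e m) z s = e (kd m z' s).
  move=> szs; rewrite -kd_map; apply: kd_ext; last by rewrite size_map.
  by move=> t; rewrite size_map => szt; rewrite zz'.
have [|s szs|w [_ dw ew]] := V i z' id _ dz'; first by [].
  by rewrite -zE // z0 ?size_map.
exists (fun s => e (w s)); split=> // s; rewrite size_map => szs.
  by move=> nz; apply: dw => // w0; apply: nz; rewrite w0 rmorph0.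
by rewrite kd_map zz' // -rmorphB ew.
Qed.

(** Regular sequences give chains of primes of the same length, so depth and height are both
    squeezed between the given sequence and the bound on chains. *)
Lemma cohen_macaulay_criterion (A : comNzRingType) d : noetherian A ->
    (forall M : {pred A}, maximal_ideal M ->
       exists s, [/\ regular_sequence s, {subset s <= M} & size s = d]) ->
    (forall (M : {pred A}) e C, prime_chain M e C -> (e <= d)%N) ->
  cohen_macaulay A.
Proof.
move=> nA reg bound; split=> // M Mmax; exists d.
have [Mp _] := maximal_prime Mmax.
have chain s : regular_sequence s -> {subset s <= M} -> exists C, prime_chain M (size s) C.
  move=> rs sM; have [C [Cp Cs Ce]] := regular_chain nA rs Mp sM.
  by exists C; split=> // x; rewrite Ce; apply/asboolP/idP.
have [s [rs sM sd]] := reg M Mmax; split; split.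
- by exists s.
- by move=> t rt tM; have [C /bound] := chain t rt tM.
- by have := chain s rs sM; rewrite sd.
exact: bound.
Qed.

Section ReesConstants.
Variables (R : comNzRingType) (I : {pred R}).

Lemma rees_const r : r%:P \in rees_pred I.
Proof.
apply/asboolP => s; rewrite coefC; case: eqP => [->|_]; first exact: ideal_pow0.
exact: ideal_gen0.
Qed.

Lemma rees_deg1 r : r \in I -> r%:P * 'X \in rees_pred I.
Proof.
move=> rI; apply/asboolP => s; rewrite coefCM coefX; case: eqP => [->|_].
  rewrite mulr1; apply: mem_ideal_gen; apply/asboolP; exists (fun=> r); split=> //.
  by rewrite big_ord1.
rewrite mulr0; exact: ideal_gen0.
Qed.

Definition rees_of_const r : rees_algebra I := ReesAlgebra (rees_const r).

Lemma rees_of_const_zmod : zmod_morphism rees_of_const.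
Proof. by move=> x y; apply: val_inj; rewrite /= polyCB. Qed.
Lemma rees_of_const_monoid : monoid_morphism rees_of_const.
Proof. by split=> [|x y]; apply: val_inj; rewrite //= polyCM. Qed.
HB.instance Definition _ :=
  GRing.isZmodMorphism.Build R (rees_algebra I) rees_of_const rees_of_const_zmod.
HB.instance Definition _ :=
  GRing.isMonoidMorphism.Build R (rees_algebra I) rees_of_const rees_of_const_monoid.

End ReesConstants.

Section PolynomialCoordinates.
Variables (K : fieldType) (k : nat).
Local Notation R := {mpoly K[k]}.
Local Notation D := {mpoly K[k.+1]}.

Definition shift : R -> D := mev (@mpolyC k.+1 K) (fun j => 'X_(lift ord0 j)).
HB.instance Definition _ := GRing.RMorphism.copy shift
  (mev (@mpolyC k.+1 K) (fun j => 'X_(lift ord0 j))).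

Definition join : {poly R} -> D := fun p => (map_poly shift p).['X_ord0].
HB.instance Definition _ := GRing.RMorphism.copy join
  (horner_eval ('X_ord0 : D) \o map_poly shift)%FUN.

(* D = K[x, T] is mapped to R[t] by sending T to u t. *)
Definition separate_var (u : R) (i : 'I_k.+1) : {poly R} :=
  if unlift ord0 i is Some j then ('X_j)%:P else u%:P * 'X.
Definition separate (u : R) : D -> {poly R} :=
  mev (@polyC R \o @mpolyC k K)%FUN (separate_var u).
HB.instance Definition _ u := GRing.RMorphism.copy (separate u)
  (mev (@polyC R \o @mpolyC k K)%FUN (separate_var u)).

Lemma separateC u c : separate u c%:MP = (c%:MP)%:P. Proof. exact: mevC. Qed.
Lemma separateX u j : separate u 'X_(lift ord0 j) = ('X_j)%:P.
Proof. by rewrite /separate mevX /separate_var liftK. Qed.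
Lemma separateX0 u : separate u 'X_ord0 = u%:P * 'X.
Proof. by rewrite /separate mevX /separate_var unlift_none. Qed.
Lemma separate_shift u r : separate u (shift r) = r%:P.
Proof.
elim/mpoly_ring_ind: r => [c|j|p q ep eq|p q ep eq].
- by rewrite /shift mevC separateC.
- by rewrite /shift mevX separateX.
- by rewrite !rmorphD /= ep eq.
by rewrite !rmorphM /= ep eq.
Qed.

Lemma shift_inj : injective shift.
Proof. by move=> x y /(congr1 (separate 1)); rewrite !separate_shift => /polyC_inj. Qed.

Lemma separate_join p : separate 1 (join p) = p.
Proof.
elim/poly_ind: p => [|p c ep]; first by rewrite !rmorph0.
rewrite rmorphD rmorphM /= {2 3}/join map_polyX map_polyC /= hornerX hornerC.
by rewrite rmorphD rmorphM /= ep separateX0 separate_shift mul1r.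
Qed.

Lemma join_inj : injective join.
Proof. exact: can_inj separate_join. Qed.

Local Notation iD := (@FracField.tofrac D).

(** After inverting [u], sending t to [T / u] recovers the original polynomial. *)
Lemma separate_inj u : u != 0 -> injective (separate u).
Proof.
move=> u0.
have iD_inj : injective iD by move=> x y /eqP; rewrite tofrac_eq => /eqP.
pose g : {rmorphism {poly R} -> {fraction D}} :=
  (horner_eval (iD 'X_ord0 / iD (shift u)) \o map_poly (iD \o shift))%FUN.
have su0 : iD (shift u) != 0.
  by rewrite -(rmorph0 iD) (inj_eq iD_inj) -(rmorph0 shift) (inj_eq shift_inj).
have gs p : g (separate u p) = iD p.
  elim/mpoly_ring_ind: p => [c|i|p q ep eq|p q ep eq].
  - by rewrite separateC /g /= map_polyC /horner_eval hornerC /= /shift mevC.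
  - have [->|[j ->]] := ord0_or_lift i; last first.
      by rewrite separateX /g /= map_polyC /horner_eval hornerC /= /shift mevX.
    rewrite separateX0 rmorphM /g /= map_polyC map_polyX /horner_eval hornerC hornerX /=.
    by rewrite mulrCA mulfV ?mulr1.
  - by rewrite (rmorphD (separate u)) (rmorphD g) ep eq rmorphD.
  by rewrite (rmorphM (separate u)) (rmorphM g) ep eq rmorphM.
by move=> x y /(congr1 g); rewrite !gs => /iD_inj.
Qed.

End PolynomialCoordinates.

Section ReesArrangement.
Variables (K : fieldType) (k n : nat) (l : 'I_n -> {mpoly K[k]}) (i0 : 'I_n).
Hypothesis l_lin : forall i, l i \is 1.-homog /\ l i != 0.
Local Notation R := {mpoly K[k]}.
Local Notation D := {mpoly K[k.+1]}.
Local Notation S := {mpoly D[n]}.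
Local Notation I := (arrangement_ideal l).
Local Notation A := (rees_algebra I).

Definition full_product : R := \prod_i l i.
Local Notation f := full_product.

Lemma full_product_neq0 : f != 0.
Proof. by apply/prodf_neq0 => i _; have [] := l_lin i. Qed.

Lemma full_productE i : f = l i * deleted_product l i.
Proof. by rewrite /full_product (bigD1 i). Qed.

Lemma deleted_product_in i : deleted_product l i \in I.
Proof. by apply: mem_ideal_gen; exact: codom_f. Qed.

(** The index [i0] matters: for the empty arrangement the product is 1 while the ideal is zero. *)
Lemma full_product_in : f \in I.
Proof. rewrite (full_productE i0); apply: ideal_genM; exact: deleted_product_in. Qed.

Definition rees_pres0 : S -> {poly R} :=
  mev (separate f : {rmorphism D -> {poly R}}) (fun i => (deleted_product l i)%:P * 'X).
HB.instance Definition _ := GRing.RMorphism.copy rees_pres0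
  (mev (separate f : {rmorphism D -> {poly R}}) (fun i => (deleted_product l i)%:P * 'X)).

Lemma rees_presC c : rees_pres0 c%:MP = separate f c. Proof. exact: mevC. Qed.
Lemma rees_presX i : rees_pres0 'X_i = (deleted_product l i)%:P * 'X.
Proof. exact: mevX. Qed.

Lemma rees_pres_mem p : rees_pres0 p \in rees_pred I.
Proof.
elim/mpoly_ring_ind: p => [c|i|p q ep eq|p q ep eq].
- rewrite rees_presC; elim/mpoly_ring_ind: c => [c|i|p q ep eq|p q ep eq].
  + rewrite separateC; exact: rees_const.
  + have [->|[j ->]] := ord0_or_lift i.
      by rewrite separateX0; apply: rees_deg1; exact: full_product_in.
    by rewrite separateX; exact: rees_const.
  + by rewrite rmorphD rpredD.
  by rewrite rmorphM rpredM.
- by rewrite rees_presX; apply: rees_deg1; exact: deleted_product_in.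
- by rewrite rmorphD rpredD.
by rewrite rmorphM rpredM.
Qed.

Definition rees_pres p : A := ReesAlgebra (rees_pres_mem p).

Lemma rees_pres_zmod : zmod_morphism rees_pres.
Proof. by move=> x y; apply: val_inj; rewrite /= rmorphB. Qed.
Lemma rees_pres_monoid : monoid_morphism rees_pres.
Proof. by split=> [|x y]; apply: val_inj; rewrite /= ?rmorph1 ?rmorphM. Qed.
HB.instance Definition _ := GRing.isZmodMorphism.Build S A rees_pres rees_pres_zmod.
HB.instance Definition _ := GRing.isMonoidMorphism.Build S A rees_pres rees_pres_monoid.

Let img (p : {poly R}) := exists q, rees_pres0 q = p.
Let img_sub p q : img p -> img q -> img (p - q).
Proof. by move=> [a <-] [b <-]; exists (a - b); rewrite rmorphB. Qed.
Let img_mul p q : img p -> img q -> img (p * q).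
Proof. by move=> [a <-] [b <-]; exists (a * b); rewrite rmorphM. Qed.
Let img_const r : img r%:P.
Proof. by exists (shift r)%:MP; rewrite rees_presC separate_shift. Qed.
Let img_add p q : img p -> img q -> img (p + q).
Proof.
move=> ip iq; rewrite -[q]opprK; apply: (img_sub ip).
rewrite -sub0r; exact: (img_sub (img_const 0) iq).
Qed.

Let img_deg1 r : r \in I -> img (r%:P * 'X).
Proof.
apply: (@ideal_gen_min _ _ (fun r => img (r%:P * 'X))).
  split; first split.
  - by exists 0; rewrite rmorph0 polyC0 mul0r.
  - by move=> x y ix iy; rewrite polyCB mulrBl; exact: (img_sub ix iy).
  by move=> a x ix; rewrite polyCM -mulrA; exact: (img_mul (img_const a) ix).
by move=> y /codomP[i ->]; exists 'X_i; rewrite rees_presX.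
Qed.

Let img_degs s r : r \in ideal_pow I s -> img (r%:P * 'X^s).
Proof.
apply: (@ideal_gen_min _ _ (fun r => img (r%:P * 'X^s))).
  split; first split.
  - by exists 0; rewrite rmorph0 polyC0 mul0r.
  - by move=> x y ix iy; rewrite polyCB mulrBl; exact: (img_sub ix iy).
  by move=> a x ix; rewrite polyCM -mulrA; exact: (img_mul (img_const a) ix).
move=> y /asboolP[g [gI ->]].
have -> : (\prod_i g i)%:P * 'X^s = \prod_(i < s) ((g i)%:P * 'X).
  by rewrite big_split /= rmorph_prod prodr_const card_ord.
apply: (big_ind img); [exact: (img_const 1)|exact: img_mul|].
by move=> i _; apply: img_deg1.
Qed.

Lemma rees_pres_surj (z : A) : exists p, z = rees_pres p.
Proof.
suff [q qz] : img (rees_val z) by exists q; apply: val_inj; rewrite /= qz.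
case: z => p /= /asboolP pI; rewrite -[p]coefK poly_def.
apply: (big_ind img); [exact: (img_const 0)|exact: img_add|].
by move=> i _; rewrite -mul_polyC; apply: img_degs.
Qed.

Definition lin_coefs i : 'rV[K]_k := \row_j (l i)@_U_(j).

Lemma separate_lin_coefs i : separate f (lf (lin_coefs i)) = (l i)%:P.
Proof.
have [/dhomogP lh _] := l_lin i.
have lE : l i = \sum_j (l i)@_U_(j) *: 'X_j.
  apply/mpolyP => m; rewrite raddf_sum /=.
  have [mm|/memN_msupp_eq0 m0] := boolP (m \in msupp (l i)).
    have /eqP/mdeg1P[j /eqP mj] := lh m mm; rewrite mj (bigD1 j) //= mcoeffZ mcoeffX eqxx mulr1.
    rewrite big1 ?addr0 // => j' jj'; rewrite mcoeffZ mcoeffX (_ : (_ == _) = false) ?mulr0 //.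
    by rewrite eq_mnm1 (negPf jj').
  rewrite m0 big1 // => j _; rewrite mcoeffZ mcoeffX.
  by case: eqP => [mj|_]; rewrite ?mulr0 // mj m0 mul0r.
rewrite lE /lf !rmorph_sum; apply: eq_bigr => j _.
by rewrite /= rmorphM /= separateC separateX mxE -mul_mpolyC polyCM.
Qed.

(** T is sent to [f t], so that [T / l_i] becomes [f_i t]; with [P = 1] the evaluation [ev] is then
    the presentation of the Rees algebra. *)
Definition rees_iota : D -> {fraction {poly R}} := (@FracField.tofrac {poly R} \o separate f)%FUN.
HB.instance Definition _ := GRing.RMorphism.copy rees_iota
  (@FracField.tofrac {poly R} \o separate f)%FUN.

Lemma rees_iota_inj : injective rees_iota.
Proof.
move=> x y; rewrite /rees_iota /= => /eqP; rewrite tofrac_eq => /eqP.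
exact: (separate_inj full_product_neq0).
Qed.

Lemma rees_pres_ev p : FracField.tofrac (rees_pres0 p) = ev rees_iota 1%:M lin_coefs p.
Proof.
elim/mpoly_ring_ind: p => [c|i|p q ep eq|p q ep eq].
- by rewrite rees_presC evC endo1.
- rewrite rees_presX evX /frac_T /= /rees_iota /= separateX0 separate_lin_coefs (full_productE i).
  have l0 : FracField.tofrac (l i)%:P != 0.
    by rewrite tofrac_eq0 polyC_eq0; have [] := l_lin i.
  rewrite polyCM -[(_%:P * _%:P) * 'X]mulrA [in RHS]tofracM.
  by rewrite mulrAC mulfV // mul1r.
- by rewrite !rmorphD /= ep eq.
by rewrite !rmorphM /= ep eq.
Qed.

Lemma rees_pres_ker p : rees_pres p = 0 <-> jker rees_iota 1%:M lin_coefs p.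
Proof.
rewrite /jker -rees_pres_ev; split=> [/(congr1 (@rees_val _ _))/= ->|/eqP].
  exact: rmorph0.
by rewrite tofrac_eq0 => /eqP p0; apply: val_inj.
Qed.

Let cS : {rmorphism K -> S} := (@mpolyC n D \o @mpolyC k.+1 K)%FUN.

Lemma pres_gen_over : gen_over cS
  ([seq ('X_i)%:MP | i : 'I_k.+1] ++ [seq 'X_i | i : 'I_n]).
Proof.
move=> Q QC QX QB QM.
have Q0 : Q 0 by have := QC 0; rewrite rmorph0.
have QD x y : Q x -> Q y -> Q (x + y).
  by move=> Qx Qy; rewrite -[y]opprK; apply: (QB) => //; rewrite -sub0r; exact: QB.
elim/mpoly_ring_ind => [c|i|p q|p q]; [|by apply: QX; rewrite mem_cat image_f ?orbT|exact: QD|exact: QM].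
elim/mpoly_ring_ind: c => [c|i|p q Qp Qq|p q Qp Qq].
- exact: QC.
- by apply: QX; rewrite mem_cat image_f.
- by rewrite mpolyCD; exact: QD.
by rewrite mpolyCM; exact: QM.
Qed.

Lemma noetherian_pres : noetherian S.
Proof. exact: (noetherian_gen_over (@noetherian_field K) pres_gen_over). Qed.

Lemma noetherian_rees : noetherian A.
Proof. exact: (noetherian_surj rees_pres_surj noetherian_pres). Qed.

Lemma maximal_preim (M : {pred A}) : maximal_ideal M ->
  maximal_ideal (pset (fun p => rees_pres p \in M)).
Proof.
move=> Mmax; have [Mp Minv] := maximal_prime Mmax; have [[Ms MM] M1 _] := Mp.
split.
  apply: pideal_idealr; last by rewrite rmorph1.
  split; first split; rewrite ?rmorph0; first exact: Ms.1.
    by move=> x y Mx My; rewrite rmorphB; exact: Ms.2.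
  by move=> a x Mx; rewrite rmorphM; exact: MM.
move=> J Ji MJ p pJ; apply/asboolP; apply: contrapT => /negP npM.
have [z Mz] := Minv _ npM; have [q zq] := rees_pres_surj z.
have Jp := idealr_pideal Ji; have [_ /negP J1 _] := Ji; apply: J1.
have -> : 1 = (1 - p * q) + q * p by rewrite mulrC subrK.
apply: (subgroupD Jp.1); last exact: Jp.2.
by apply: MJ; apply/asboolP; rewrite rmorphB rmorphM rmorph1 /= -zq.
Qed.

Lemma rees_regular_sequence (M : {pred A}) : maximal_ideal M ->
  exists s, [/\ regular_sequence s, {subset s <= M} & size s = k.+1].
Proof.
move=> Mmax; have M'max := maximal_preim Mmax.
have [ms msP] := noetherian_pres M'max.1.
have [M'p M'inv] := maximal_prime M'max.
have V : kvan ms (k.+1 : int) (fun=> True) (jker rees_iota 1%:M lin_coefs).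
  have -> : (k.+1 : int) = ((\rank (1%:M : 'M[K]_k)).+1 : int) by rewrite mxrank1.
  apply: (kvan_arrangement rees_iota_inj).
  - by move=> a; rewrite -msP => /M'inv[b]; rewrite msP; exists b.
  - move=> a; have [q q0 qM] := maximal_algebraic pres_gen_over M'max a.
    by exists q => //; rewrite -msP.
  by move=> i; exact: submx1.
have V' : kvan (map rees_pres ms) (k.+1 : int) (fun=> True) (fun x => x = 0).
  apply: kvan_surj; first exact: rees_pres_surj.
  by apply: kvan_ext V => // x; split=> /rees_pres_ker.
have zi : pideal (fun x : A => x = 0).
  by split; first split=> // x y -> ->; rewrite ?subr0 //; move=> a x ->; rewrite mulr0.
have [gs [szgs wr gsm]] := kvan_wreg_exists noetherian_rees zi V'.
have [[Mi _ _] _] := maximal_prime Mmax.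
have msM x : x \in ideal_gen (mem (map rees_pres ms)) -> x \in M.
  apply: (ideal_gen_min Mi) => y ; rewrite -[y \in _]/(y \in map _ _) => /mapP[p pms ->].
  have : p \in ideal_gen (mem ms) by exact: mem_ideal_gen.
  by rewrite -msP => /asboolP.
exists gs; split=> //; last by move=> x /gsm/msM.
apply: (wreg_zero_regular_sequence wr).
have [_ M1 _] := Mmax.1; apply: contra M1; apply: (ideal_gen_min Mi) => x xg.
by apply/msM/gsm.
Qed.

(** Chains of primes are bounded through the embedding of the Rees algebra in [R[t]], a polynomial
    ring in [k + 1] variables over [K]. *)
Lemma cohen_macaulay_rees_arrangement : cohen_macaulay A.
Proof.
apply: (cohen_macaulay_criterion noetherian_rees rees_regular_sequence).
pose cA : {rmorphism K -> A} := (@rees_of_const R I \o @mpolyC k K)%FUN.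
pose rho : {rmorphism A -> D} := (@join K k \o (val : A -> {poly R}))%FUN.
apply: (prime_chain_bound (cA := cA) (rho := rho)).
  by move=> x y /join_inj/val_inj.
move=> c; rewrite /rho /cA /= /join map_polyC hornerC /= /shift; exact: mevC.
Qed.

End ReesArrangement.

Lemma ideal_gen_empty (A : comNzRingType) (S : {pred A}) x :
  (forall y, y \notin S) -> x \in ideal_gen S -> x = 0.
Proof.
move=> S0; apply: (@ideal_gen_min _ _ (fun x => x = 0)) => [|y yS].
  by split; first split=> // y z -> ->; rewrite ?subr0 //; move=> a y ->; rewrite mulr0.
by have := S0 y; rewrite yS.
Qed.

Lemma mpoly0_const (K : fieldType) (p : {mpoly K[0]}) : exists c, p = c%:MP.
Proof.
elim/mpoly_ring_ind: p => [c|[]//|p q [c ->] [d ->]|p q [c ->] [d ->]].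
- by exists c.
- by exists (c + d); rewrite mpolyCD.
by exists (c * d); rewrite mpolyCM.
Qed.

(** The ideal is zero and the Rees algebra is [K] itself, of dimension 0. *)
Lemma cohen_macaulay_rees_empty (K : fieldType) (l : 'I_0 -> {mpoly K[0]}) :
  cohen_macaulay (rees_algebra (arrangement_ideal l)).
Proof.
set I := arrangement_ideal l.
have I0 x : x \in I -> x = 0.
  by apply: ideal_gen_empty => y; apply/negP => /codomP[[]].
have Is0 s x : x \in ideal_pow I s.+1 -> x = 0.
  apply: (@ideal_gen_min _ _ (fun x => x = 0)) => [|y /asboolP[g [gI ->]]].
    by split; first split=> // y z -> ->; rewrite ?subr0 //; move=> a y ->; rewrite mulr0.
  by rewrite big_ord_recl (I0 _ (gI ord0)) mul0r.
pose A := rees_algebra I.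
have Aconst (z : A) : exists c, z = rees_of_const I c%:MP.
  case: z => p pI; have /asboolP pI' := pI; have [c cE] := mpoly0_const p`_0.
  exists c; apply: val_inj => /=; rewrite -cE; apply/polyP => -[|s]; rewrite coefC //=.
  exact: Is0 (pI' s.+1).
pose cA : {rmorphism K -> A} := (@rees_of_const _ I \o @mpolyC 0 K)%FUN.
pose rho : {rmorphism A -> {mpoly K[0]}} := (horner_eval 0 \o (val : A -> {poly {mpoly K[0]}}))%FUN.
have rhoC c : rho (cA c) = c%:MP by rewrite /rho /cA /= /horner_eval hornerC.
apply: (@cohen_macaulay_criterion _ 0).
- by apply: (noetherian_surj (f := cA)) (@noetherian_field K).
- move=> M Mmax; exists [::]; split=> //; split=> //.
  by apply/negP => /ideal_gen_empty => /(_ (fun _ => isT))/eqP; rewrite oner_eq0.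
apply: (prime_chain_bound (cA := cA) (rho := rho)) => // x y.
have [c ->] := Aconst x; have [d ->] := Aconst y.
rewrite -[rees_of_const I c%:MP]/(cA c) -[rees_of_const I d%:MP]/(cA d) !rhoC.
by move/(congr1 (mcoeff 0%MM)); rewrite !mcoeffC eqxx !mulr1 => ->.
Qed.

Theorem theorem4p9 (K : fieldType) (n k : nat) (l : 'I_n -> {mpoly K[k]})
  (hl : central_arrangement l) :
  cohen_macaulay (rees_algebra (arrangement_ideal l)).
Proof.
have [l_lin _ l_span] := hl.
case: n l hl l_lin l_span => [|n] l _ l_lin l_span.
  (* Without forms the spanning condition forces [k = 0], as a variable cannot lie in the zero
     ideal. *)
  case: k l l_lin l_span => [|k] l _ l_span; first exact: cohen_macaulay_rees_empty.
  have : ('X_ord0 : {mpoly K[k.+1]}) \in ideal_gen (mem (codom l)).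
    by rewrite l_span; apply: mem_ideal_gen; apply/codomP; exists ord0.
  have no y : y \notin mem (codom l) by apply/negP => /codomP[[]].
  move/(ideal_gen_empty no)/(congr1 (mcoeff U_(ord0))).
  by rewrite mcoeffX eqxx mcoeff0 => /eqP; rewrite oner_eq0.
exact: (cohen_macaulay_rees_arrangement ord0 l_lin).
Qed.
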